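(* Let $n\ge3$, $m=\lfloor n/2\rfloor$ and $\rho\in\mathrm{Par}_m$ (with $\rho_i=0$ for $i>\ell(\rho)$). Write $\boxed{l}$ for the one-box tableau with entry $l$. (1) If $n$ is even and $\rho_m\ne1$, then the map $$\mathrm{SST}_n^{\mathrm{AI}}(\rho)\otimes\mathrm{SST}_n(1)\to\bigsqcup_{\sigma\in\mathrm{Par}_m,\ \rho\triangleleft\sigma\text{ or }\sigma\triangleleft\rho}\mathrm{SST}_n^{\mathrm{AI}}(\sigma);\quad T\otimes\boxed{l}\mapsto P^{\mathrm{AI}}(T\leftarrow l)$$ is an isomorphism of $\mathrm{AI}$-crystals. (2) If $n$ is even and $\rho_m=1$, put $\rho'=(\rho_1,\dots,\rho_{m-1})$. Then the map $$\mathrm{SST}_n^{\mathrm{AI}}(\rho)\otimes\mathrm{SST}_n(1)\to\Big(\bigsqcup_{\sigma\in\mathrm{Par}_m\setminus\mathrm{Par}_{m-1},\ \rho\triangleleft\sigma\text{ or }\sigma\triangleleft\rho}\mathrm{SST}_n^{\mathrm{AI}}(\sigma)\Big)\sqcup\big(\mathrm{SST}_n^{\mathrm{AI}}(\rho')\times\{+,-\}\big),$$ $$T\otimes\boxed{l}\mapsto\begin{cases}P^{\mathrm{AI}}(T\leftarrow l)&\text{if }\ell(\mathrm{sh}(P^{\mathrm{AI}}(T\leftarrow l)))=m,\\(P^{\mathrm{AI}}(T\leftarrow l),+)&\text{if }\ell(\mathrm{sh}(P^{\mathrm{AI}}(T\leftarrow l)))<m\text{ and }\ell(\mathrm{sh}(T\leftarrow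 l))>m,\\(P^{\mathrm{AI}}(T\leftarrow l),-)&\text{if }\ell(\mathrm{sh}(P^{\mathrm{AI}}(T\leftarrow l)))<m\text{ and }\ell(\mathrm{sh}(T\leftarrow l))=m\end{cases}$$ is an isomorphism of $\mathrm{AI}$-crystals. (3) If $n$ is odd and $\rho_m=0$, then the map $$\mathrm{SST}_n^{\mathrm{AI}}(\rho)\otimes\mathrm{SST}_n(1)\to\bigsqcup_{\sigma\in\mathrm{Par}_m,\ \rho\triangleleft\sigma\text{ or }\sigma\triangleleft\rho}\mathrm{SST}_n^{\mathrm{AI}}(\sigma);\quad T\otimes\boxed{l}\mapsto P^{\mathrm{AI}}(T\leftarrow l)$$ is an isomorphism of $\mathrm{AI}$-crystals. (4) If $n$ is odd and $\rho_m\ne0$, then the map $$\mathrm{SST}_n^{\mathrm{AI}}(\rho)\otimes\mathrm{SST}_n(1)\to\bigsqcup_{\sigma\in\mathrm{Par}_m,\ \rho=\sigma,\ \rho\triangleleft\sigma\text{ or }\sigma\triangleleft\rho}\mathrm{SST}_n^{\mathrm{AI}}(\sigma);\quad T\otimes\boxed{l}\mapsto P^{\mathrm{AI}}(T\leftarrow l)$$ is an isomorphism of $\mathrm{AI}$-crystals.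
   Context: Tableaux and words. $\mathrm{Par}_l$ is the set of partitions of length $\ell(\lambda)\le l$. $\lambda\triangleleft\mu$ means that the diagram of $\mu$ is obtained from that of $\lambda$ by adding one box. $\mathrm{SST}_n(\lambda)$ is the set of semistandard Young tableaux of shape $\lambda$ with entries in $\{1,\dots,n\}$; $\mathrm{sh}(T)$ is the shape of $T$; $d_j$ is the length of the $j$-th column of the diagram. $(T\leftarrow l)$ is Schensted row insertion of $l$ into $T$. The column reading $\mathrm{CR}(T)$ reads the columns left to right, each from bottom to top. $P(w)$ is the Robinson–Schensted $P$-symbol of a word $w$ (successive row insertion of its letters into the empty tableau). Operators. For $i\in\{1,\dots,n-1\}$ and a word $w$, keep only letters $i,i+1$ and successively delete adjacent pairs $(i+1),i$ (an $i+1$ immediately left of an $i$ among the remaining letters) until $i^{a}(i+1)^{b}$ is left; $\varphi_i(w)=a$, $\varepsilon_i(w)=b$; $\widetilde F_i w$ changes the rightmost undeleted $i$ into $i+1$ ($0$ if $a=0$), $\widetilde E_iw$ changes the leftmost undeleted $i+1$ into $i$ ($0$ if $b=0$). For $T\in\mathrm{SST}_n(\lambda)$, $\varphi_i,\varepsilon_i$ are those of $\mathrm{CR}(T)$, and $\widetilde E_iT,\widetilde F_iT$ are the tableaux of shape $\lambda$ (or $0$) with column readings $\widetilde E_i\mathrm{CR}(T),\widetilde F_i\mathrm{CR}(T)$. The $\mathrm{AI}$-crystal structure on $\mathrm{SST}_n(\lambda)$ is: $\deg_i(T)=\varepsilon_i(T)$, $\widetilde B_iT=\widetilde E_iT$ if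 $\varphi_i(T)$ is even; $\deg_i(T)=\varepsilon_i(T)+1$, $\widetilde B_iT=\widetilde F_iT$ if $\varphi_i(T)$ is odd. The map $K_1$. For a column $C$ with entry set $J\subset\{1,\dots,n\}$ (possibly empty), $K(C)$ is the column with entry set $\{1,\dots,n\}\setminus J$. For $T\in\mathrm{SST}_n(\lambda)$ with columns $C_1,\dots,C_{\lambda_1}$ (for $\lambda=\emptyset$ take $C_1$ empty), $K_1(T):=P(\mathrm{CR}(K(C_1))*\mathrm{CR}(C_2)*\cdots*\mathrm{CR}(C_{\lambda_1}))$ ($*$ = concatenation). $\mathrm{AI}$-tableaux. $T\in\mathrm{SST}_n(\lambda)$ (entries $t_{i,j}$) is an $\mathrm{AI}$-tableau if $d_1\le m$ and $t^c_{i,1}\le t_{i,2}$ for all $1\le i\le d_2$, where $t^c_{1,1}<\dots<t^c_{n-d_1,1}$ are the elements of $\{1,\dots,n\}\setminus\{t_{1,1},\dots,t_{d_1,1}\}$. $\mathrm{SST}_n^{\mathrm{AI}}(\lambda)$ is the set of $\mathrm{AI}$-tableaux of shape $\lambda$; it is stable under the $\widetilde B_i$ and carries the restricted structure maps. $P^{\mathrm{AI}}(T):=K_1^r(T)$, where $r\ge0$ is minimal such that $K_1^r(T)$ is an $\mathrm{AI}$-tableau (such $r$ exists). Tensor product. $\mathrm{SST}_n^{\mathrm{AI}}(\rho)\otimes\mathrm{SST}_n(1)$ is the product set with $\deg_i(b_1\otimes b_2)=\deg_i(b_1)-\varphi_i(b_2)+\varepsilon_i(b_2)$, $\widetilde B_i(b_1\otimes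 b_2)=\widetilde B_ib_1\otimes b_2$ if $\deg_i(b_1)>\varphi_i(b_2)$; $\deg_i=\varepsilon_i(b_2)$, $\widetilde B_i(b_1\otimes b_2)=b_1\otimes\widetilde E_ib_2$ if $\varphi_i(b_2)-\deg_i(b_1)$ is nonnegative and even; $\deg_i=\varepsilon_i(b_2)+1$, $\widetilde B_i(b_1\otimes b_2)=b_1\otimes\widetilde F_ib_2$ if $\varphi_i(b_2)-\deg_i(b_1)$ is nonnegative and odd ($0\otimes b=b\otimes0=0$). On $\mathrm{SST}_n^{\mathrm{AI}}(\rho')\times\{+,-\}$ the structure maps act through the first factor. An isomorphism of $\mathrm{AI}$-crystals is a bijection which (with $0\mapsto0$) commutes with all $\widetilde B_i$ and preserves all $\deg_i$, $1\le i\le n-1$. *)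

(* Defs.v *)
(* boolp is used only for the case split in PAI. *)
From mathcomp Require Import all_boot.
From mathcomp.classical Require Import boolp.

Set Implicit Arguments.
Unset Strict Implicit.
Unset Printing Implicit Defensive.

(* Partitions are weakly decreasing sequences of positive integers, without
   trailing zeros, so that the length of la is [size la] and the 1-based part
   la_k is [part la k]. *)
Definition is_part (la : seq nat) : bool := sorted geq la && (0 \notin la).

Definition Par (l : nat) : {pred seq nat} :=
  [pred la | is_part la && (size la <= l)].

Definition part (la : seq nat) (k : nat) : nat := nth 0 la k.-1.

(* [incr_nth la k] adds a box at the end of the row of (0-based) index k; on
   partitions this yields a diagram only for k <= size la. *)
Definition adds_box (la mu : seq nat) : bool :=
  has (fun k => mu == incr_nth la k) (iota 0 (size la).+1).

Definition neighbours (rho : seq nat) : {pred seq nat} :=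
  [pred sigma | adds_box rho sigma || adds_box sigma rho].

Definition word := seq nat.

(* A tableau is the list of its rows, from top to bottom. *)
Definition tableau := seq (seq nat).

Definition shape (T : tableau) : seq nat := map size T.

(* [column T j] has the 0-based index j and is listed from top to bottom; it is
   empty when j is out of range. *)
Definition column (T : tableau) (j : nat) : seq nat :=
  [seq nth 0 r j | r <- T & j < size r].

(* Also sends the list of columns of a tableau of partition shape back to the
   list of its rows. *)
Definition columns (T : seq (seq nat)) : seq (seq nat) :=
  [seq column T j | j <- iota 0 (size (head [::] T))].

Definition is_sst (n : nat) (T : tableau) : bool :=
  [&& is_part (shape T),
      all (fun r => sorted leq r && all (fun x => 0 < x <= n) r) T
    & all (sorted ltn) (columns T)].

Definition SST (n : nat) (la : seq nat) : {pred tableau} :=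
  [pred T | is_sst n T && (shape T == la)].

Definition CR (T : tableau) : word := flatten [seq rev c | c <- columns T].

Fixpoint row_insert (T : tableau) (x : nat) : tableau :=
  if T is r :: T' then
    let p := find (fun y => x < y) r in
    if p < size r then set_nth 0 r p x :: row_insert T' (nth 0 r p)
    else rcons r x :: T'
  else [:: [:: x]].

Definition Psym (w : word) : tableau := foldl row_insert [::] w.

(* Letters are paired with their positions. The word is processed from right to
   left: each new letter is put in front of an already reduced word, and the
   only adjacent pair (i+1), i that can appear is then at the front. *)
Definition push_letter (i : nat) (x : nat * nat) (s : seq (nat * nat)) :=
  if s is y :: s' then
    if (x.2 == i.+1) && (y.2 == i) then s' else x :: s
  else [:: x].

Definition undeleted (i : nat) (w : word) : seq (nat * nat) :=
  foldr (push_letter i) [::]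
    [seq x <- zip (iota 0 (size w)) w | (x.2 == i) || (x.2 == i.+1)].

(* Positions in w, from left to right, of the undeleted letters equal to a. *)
Definition undeleted_pos (i : nat) (w : word) (a : nat) : seq nat :=
  [seq x.1 | x <- undeleted i w & x.2 == a].

Definition phiw (i : nat) (w : word) : nat := size (undeleted_pos i w i).
Definition epsw (i : nat) (w : word) : nat := size (undeleted_pos i w i.+1).

(* Throughout, [None] encodes the zero of a crystal. *)
Definition Fw (i : nat) (w : word) : option word :=
  if undeleted_pos i w i is p :: s then Some (set_nth 0 w (last p s) i.+1)
  else None.

Definition Ew (i : nat) (w : word) : option word :=
  if undeleted_pos i w i.+1 is p :: _ then Some (set_nth 0 w p i) else None.

Definition phi (i : nat) (T : tableau) : nat := phiw i (CR T).
Definition eps (i : nat) (T : tableau) : nat := epsw i (CR T).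

(* The filling of the diagram of T whose column reading is w. *)
Definition refill (T : tableau) (w : word) : tableau :=
  columns [seq rev c | c <- reshape [seq size c | c <- columns T] w].

Definition Ft (i : nat) (T : tableau) : option tableau :=
  omap (refill T) (Fw i (CR T)).

Definition Et (i : nat) (T : tableau) : option tableau :=
  omap (refill T) (Ew i (CR T)).

Definition degT (i : nat) (T : tableau) : nat :=
  if odd (phi i T) then (eps i T).+1 else eps i T.

Definition BT (i : nat) (T : tableau) : option tableau :=
  if odd (phi i T) then Ft i T else Et i T.

Definition compl_column (n : nat) (C : seq nat) : seq nat :=
  [seq x <- iota 1 n | x \notin C].

Definition K1 (n : nat) (T : tableau) : tableau :=
  let cs := columns T in
  Psym (rev (compl_column n (head [::] cs))
        ++ flatten [seq rev c | c <- behead cs]).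

Definition is_AI (n : nat) (T : tableau) : bool :=
  [&& is_sst n T,
      size (column T 0) <= n./2
    & all (fun i => nth 0 (compl_column n (column T 0)) i
                    <= nth 0 (column T 1) i)
          (iota 0 (size (column T 1)))].

Definition SSTAI (n : nat) (la : seq nat) : {pred tableau} :=
  [pred T | is_AI n T && (shape T == la)].

(* The default value T is only returned when no iterate of K1 on T, not even T
   itself, is an AI-tableau. *)
Definition PAI (n : nat) (T : tableau) : tableau :=
  if pselect (exists r, is_AI n (iter r (K1 n) T)) is left h
  then iter (ex_minn h) (K1 n) T else T.

(* The underlying set of a crystal is a subset of an ambient type on which the
   structure maps are given; restricting a structure to a stable subset then
   only changes [elements]. *)
Record AIcrystal := MkAIcrystal {
  ambient : Type;
  elements : {pred ambient};
  deg : nat -> ambient -> nat;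
  Bop : nat -> ambient -> option ambient
}.
Arguments elements X : clear implicits, rename.

Definition is_AI_iso (n : nat) (X Y : AIcrystal)
    (f : ambient X -> ambient Y) : Prop :=
  [/\ forall x, x \in elements X -> f x \in elements Y,
      forall x x', x \in elements X -> x' \in elements X ->
        f x = f x' -> x = x',
      forall y, y \in elements Y -> exists2 x, x \in elements X & f x = y,
      forall i x, 0 < i < n -> x \in elements X ->
        Bop i (f x) = omap f (Bop i x)
    & forall i x, 0 < i < n -> x \in elements X -> deg i (f x) = deg i x].

(* The disjoint union of the SSTAI n sigma over the sigma in S: a plain union,
   since a tableau determines its shape. *)
Definition bigsqcup_SSTAI (n : nat) (S : {pred seq nat}) : AIcrystal :=
  MkAIcrystal [pred T | (shape T \in S) && (T \in SSTAI n (shape T))] degT BT.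

(* The natural subtraction in the first branch is not truncated. *)
Definition deg_tensor (i : nat) (b : tableau * tableau) : nat :=
  if phi i b.2 < degT i b.1 then degT i b.1 - phi i b.2 + eps i b.2
  else if odd (phi i b.2 - degT i b.1) then (eps i b.2).+1
  else eps i b.2.

Definition B_tensor (i : nat) (b : tableau * tableau) :
    option (tableau * tableau) :=
  if phi i b.2 < degT i b.1 then omap (fun b1 => (b1, b.2)) (BT i b.1)
  else if odd (phi i b.2 - degT i b.1) then omap (pair b.1) (Ft i b.2)
  else omap (pair b.1) (Et i b.2).

Definition SSTAI_tensor_box (n : nat) (rho : seq nat) : AIcrystal :=
  MkAIcrystal [pred b | (b.1 \in SSTAI n rho) && (b.2 \in SST n [:: 1])]
    deg_tensor B_tensor.

Inductive sign := Plus | Minus.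

Definition SSTAI_times_signs (n : nat) (rho : seq nat) : AIcrystal :=
  MkAIcrystal [pred b : tableau * sign | b.1 \in SSTAI n rho]
    (fun i b => degT i b.1)
    (fun i b => omap (fun b1 => (b1, b.2)) (BT i b.1)).

Definition sqcup (X Y : AIcrystal) : AIcrystal :=
  @MkAIcrystal (ambient X + ambient Y)
    (fun z => match z with
              | inl x => x \in elements X
              | inr y => y \in elements Y
              end)
    (fun i z => match z with inl x => deg i x | inr y => deg i y end)
    (fun i z => match z with
                | inl x => omap inl (Bop i x)
                | inr y => omap inr (Bop i y)
                end).

Definition box_entry (S : tableau) : nat := head 0 (head [::] S).

Definition insert_box (b : tableau * tableau) : tableau :=
  row_insert b.1 (box_entry b.2).

Definition PAI_insert (n : nat) (b : tableau * tableau) : tableau :=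
  PAI n (insert_box b).

(* Used for rho with n./2 parts: U has at most n./2 rows and the inserted
   tableau n./2 or n./2 + 1, so the three branches are exhaustive. *)
Definition PAI_insert_signed (n : nat) (b : tableau * tableau) :
    tableau + tableau * sign :=
  let U := PAI_insert n b in
  if size (shape U) == n./2 then inl U
  else if n./2 < size (shape (insert_box b)) then inr (U, Plus)
  else inr (U, Minus).

(* Main.v *)
(* A tableau is recorded by its columns C_1, C_2, ... Columns A and D can stand
   side by side iff D has at most as many entries <= k as A for every k. If this
   fails by at most one, first at y, then moving y from D to A repairs it and does
   not change the Knuth class of the column reading. A tableau satisfies the
   AI-condition (without d_1 <= m) iff both C_1 and its complement can stand to
   the left of C_2. Complementing the first column preserves the AI-structure of
   the column reading, and Knuth equivalent words have isomorphic crystal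
   structures, so that K_1, insertion and PAI commute with the structure maps.

   To insert l into an AI-tableau, put l into a new column on the right; a letter
   then moves to the left from column to column, until it adds a box or reaches
   column 2. There the conditions against C_1 and against its complement are
   repaired independently: one of the moves makes the first column grow, the other
   one makes it shrink, and if both are needed then column 2 has lost one letter
   too many, and this deficiency travels back to the right until it removes a box.
   Applying PAI amounts to doing these moves, and to complementing the first
   column in the end if it has more than m entries. Every move is undone by moving
   back the last entry at which the counts of the two columns separate; therefore
   T and l are determined by the result and by the shape of the result, except
   that for n even and d_1 = m both growing and shrinking lead to the same shape. *)

From mathcomp Require Import all_boot zify.
From mathcomp.classical Require boolp.
Require Import Defs.

Set Implicit Arguments.
Unset Strict Implicit.
Unset Printing Implicit Defensive.

(** * Row insertion and Knuth equivalence *)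

(** The cases come from the first column. If d_1 < m it may grow, and every result is a neighbour of
    rho. If d_1 = m, growing gives m + 1 entries and the complement has n - (m + 1): this is m for n
    odd, so that rho itself occurs, and m - 1 for n even, which shrinking gives as well. For n even
    a partition with first column m - 1 needs d_2 < m; together with d_1 = m this says rho_m = 1,
    and only then do the two coincide. The sign tells whether the insertion itself lengthened the
    first column. The AI-degree retains just enough of phi and eps: for a concatenation it depends
    on the left factor only through the AI-structure of that factor, and it does not distinguish a
    column from its complement, although their phi and eps may differ. Since PAI takes the least
    number of applications of K_1, linking the inserted tableau to the result by Knuth moves and
    complements is not enough: the tableaux met on the way must not be AI, and their number must not
    change under the operators. Counts of entries up to k turn the comparison of columns into linear
    inequalities. *)

Definition ins_pos (r : seq nat) (x : nat) : nat := find (fun y => x < y) r.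

Definition ins_row (r : seq nat) (x : nat) : seq nat :=
  set_nth 0 r (ins_pos r x) x.

Definition ins_out (r : seq nat) (x : nat) : seq nat :=
  if ins_pos r x < size r then [:: nth 0 r (ins_pos r x)] else [::].

(** Feeding a whole word to one row and collecting the bumped letters allows an induction on the
    rows: the rows below see only the output word. *)
Fixpoint row_pass (r w : seq nat) : seq nat * seq nat :=
  if w is x :: w' then
    ((row_pass (ins_row r x) w').1, ins_out r x ++ (row_pass (ins_row r x) w').2)
  else (r, [::]).

Lemma ins_pos_size r x : ins_pos r x <= size r.
Proof. exact: find_size. Qed.

Lemma ins_posE r x p : p <= size r ->
  (forall i, i < p -> nth 0 r i <= x) -> (p < size r -> x < nth 0 r p) ->
  ins_pos r x = p.
Proof.
move=> ple Hlt Hp; apply/eqP; rewrite eqn_leq; apply/andP; split.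
  case: ltnP => // Hlt'; move: (before_find 0 Hlt').
  by rewrite Hp // (leq_trans Hlt' (ins_pos_size _ _)).
case: leqP => // H.
have Hh : has (fun y => x < y) r by rewrite has_find (leq_trans H ple).
by have := nth_find 0 Hh; rewrite -/(ins_pos r x) ltnNge Hlt.
Qed.

Lemma ins_pos_before r x i : i < ins_pos r x -> nth 0 r i <= x.
Proof. by move=> /(before_find 0) /negbT; rewrite -leqNgt. Qed.

Lemma ins_pos_at r x : ins_pos r x < size r -> x < nth 0 r (ins_pos r x).
Proof. by rewrite -has_find => /(nth_find 0). Qed.

Lemma sorted_leq_nthP (r : seq nat) i j :
  sorted leq r -> i <= j -> j < size r -> nth 0 r i <= nth 0 r j.
Proof.
move=> rs ij jr; apply: (sorted_leq_nth leq_trans leqnn) => //.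
by rewrite inE (leq_ltn_trans ij jr).
Qed.

Lemma ins_pos_after r x i : sorted leq r ->
  ins_pos r x <= i -> i < size r -> x < nth 0 r i.
Proof.
move=> rs pi ir; apply: leq_trans (sorted_leq_nthP rs pi ir).
by apply: ins_pos_at; apply: leq_ltn_trans ir.
Qed.

Lemma nth_ins_row r x i :
  nth 0 (ins_row r x) i = if i == ins_pos r x then x else nth 0 r i.
Proof. by rewrite nth_set_nth. Qed.

Lemma size_ins_row r x : size (ins_row r x) = maxn (ins_pos r x).+1 (size r).
Proof. exact: size_set_nth. Qed.

Lemma sorted_ins_row r x : sorted leq r -> sorted leq (ins_row r x).
Proof.
move=> rs; apply/(sortedP 0) => i; rewrite size_ins_row !nth_ins_row => Hi.
have Hp := ins_pos_size r x.
case: eqP => [e1|/eqP ne1]; case: eqP => [e2|/eqP ne2] //.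
- by apply: ltnW; apply: (ins_pos_after rs); lia.
- by apply: ins_pos_before; lia.
by apply: sorted_leq_nthP => //; lia.
Qed.

Lemma row_insert_cons r T x :
  row_insert (r :: T) x = ins_row r x :: foldl row_insert T (ins_out r x).
Proof.
rewrite /= /ins_row /ins_out -/(ins_pos r x); case: ltnP => //= H.
by rewrite set_nthE ltnNge H /= (_ : ins_pos r x = size r) ?subnn ?cats1 //;
   apply/eqP; rewrite eqn_leq H ins_pos_size.
Qed.

Lemma foldl_row_insert_cons r T w :
  foldl row_insert (r :: T) w =
    (row_pass r w).1 :: foldl row_insert T (row_pass r w).2.
Proof.
elim: w r T => [|x w IH] r T //.
by rewrite [LHS]/= -/(row_insert (r :: T) x) row_insert_cons IH foldl_cat.
Qed.

Inductive knuth3 : word -> word -> Prop :=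
| Knuth3_yzx x y z : x < y -> y <= z -> knuth3 [:: y; z; x] [:: y; x; z]
| Knuth3_xzy x y z : x <= y -> y < z -> knuth3 [:: x; z; y] [:: z; x; y].

(** The two exchanged letters fall into different cells or compete for the same one. In both cases
    the row ends up the same and the outputs agree or form a Knuth pair again, so that the relation
    is handed down to the next row. *)
Lemma row_pass_knuth3 r t t' : sorted leq r -> knuth3 t t' ->
  (row_pass r t).1 = (row_pass r t').1 /\
  ((row_pass r t).2 = (row_pass r t').2 \/
   knuth3 (row_pass r t).2 (row_pass r t').2 \/
   knuth3 (row_pass r t').2 (row_pass r t).2).
Proof.
move=> rs [] x y z xy yz; rewrite /= !cats0.
- set r1 := ins_row r y; set p := ins_pos r y.
  have r1s : sorted leq r1 by apply: sorted_ins_row.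
  have pr : p <= size r by apply: ins_pos_size.
  have sr1 : size r1 = maxn p.+1 (size r) by apply: size_ins_row.
  have r1p : nth 0 r1 p = y by rewrite nth_ins_row eqxx.
  set q := ins_pos r1 x; set s := ins_pos r1 z.
  have qp : q <= p.
    case: (leqP q p) => // pq; have := ins_pos_before pq.
    by rewrite r1p; lia.
  have ps : p < s.
    case: (ltnP p s) => // sp.
    by have := ins_pos_after r1s sp; rewrite r1p sr1; lia.
  have sr1' : s <= size r1 by apply: ins_pos_size.
  have e1 : ins_pos (ins_row r1 z) x = q.
    apply: ins_posE.
    + by rewrite size_ins_row; lia.
    + move=> i iq; rewrite nth_ins_row -/s; case: eqP => [|_]; first lia.
      exact: ins_pos_before iq.
    + move=> _; rewrite nth_ins_row -/s; case: eqP => [|_]; first lia.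
      by apply: ins_pos_at; rewrite -/q; lia.
  have e2 : ins_pos (ins_row r1 x) z = s.
    apply: ins_posE.
    + by rewrite size_ins_row -/q; lia.
    + move=> i iq; rewrite nth_ins_row -/q; case: eqP => [_|_]; first lia.
      exact: ins_pos_before iq.
    + rewrite size_ins_row -/q => H.
      rewrite nth_ins_row -/q; case: eqP => [|_]; first lia.
      by apply: ins_pos_at; rewrite -/s; lia.
  split; first by rewrite /ins_row e1 e2 -/q -/s set_set_nth ifF //; lia.
  have o1 : ins_out (ins_row r1 z) x = [:: nth 0 r1 q].
    rewrite /ins_out e1 size_ins_row nth_ins_row -/s ifT; last lia.
    by rewrite ifN //; lia.
  have o2 : ins_out r1 x = [:: nth 0 r1 q] by rewrite /ins_out ifT // -/q; lia.
  have o3 : ins_out (ins_row r1 x) z = ins_out r1 z.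
    rewrite /ins_out e2 size_ins_row nth_ins_row -/q -/s.
    rewrite (_ : maxn q.+1 (size r1) = size r1); last lia.
    by rewrite (_ : (s == q) = false) //; lia.
  rewrite o1 o2 o3 /ins_out -/p -/s.
  case: (ltnP s (size r1)) => ss; last by left.
  right; left; have -> /= : p < size r by lia.
  have Hq : nth 0 r1 q <= y by rewrite -r1p; apply: sorted_leq_nthP => //; lia.
  have Hp : y < nth 0 r p by apply: ins_pos_at; rewrite -/p; lia.
  constructor; first lia.
  by rewrite /r1 nth_ins_row ifN; [apply: sorted_leq_nthP; lia | rewrite -/p; lia].
- set p := ins_pos r x; set s := ins_pos r z.
  have pr : p <= size r by apply: ins_pos_size.
  have sr : s <= size r by apply: ins_pos_size.
  have ps : p <= s.
    case: (leqP p s) => // sp; have := ins_pos_after rs (leqnn _) (leq_trans sp pr).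
    by have := ins_pos_before sp; rewrite -/s; lia.
  move: ps; rewrite leq_eqVlt => /orP[/eqP ps|ps].
  (* [x] and [z] compete for the cell [p]. With [x] first, [z] goes to [p.+1] and is bumped by [y];
     with [z] first, it is bumped by [x], and [y] goes to [p.+1]. A relation of the second kind thus
     becomes one of the first kind. *)
  + have e1 : ins_pos (ins_row r x) z = p.+1.
      apply: ins_posE.
      * by rewrite size_ins_row -/p; lia.
      * move=> i ip; rewrite nth_ins_row -/p; case: eqP => [|ne]; first lia.
        by apply: ins_pos_before; rewrite -/s; lia.
      * rewrite size_ins_row -/p => H; rewrite nth_ins_row -/p ifN; last lia.
        by apply: ins_pos_after; rewrite -/s ?ps; lia.
    have e1' : ins_pos (ins_row r z) x = p.
      apply: ins_posE.
      * by rewrite size_ins_row -/s; lia.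
      * move=> i ip; rewrite nth_ins_row -/s; case: eqP => [|ne]; first lia.
        by apply: ins_pos_before; rewrite -/p; lia.
      * by move=> _; rewrite nth_ins_row -/s ps eqxx; lia.
    have e2 : ins_pos (ins_row (ins_row r x) z) y = p.+1.
      apply: ins_posE.
      * by rewrite size_ins_row e1; lia.
      * move=> i ip; rewrite nth_ins_row e1 ifN; last lia.
        rewrite nth_ins_row -/p; case: eqP => [|ne]; first lia.
        by apply: (@leq_trans x) => //; apply: ins_pos_before; rewrite -/p; lia.
      * by move=> _; rewrite nth_ins_row e1 eqxx.
    have e2' : ins_pos (ins_row (ins_row r z) x) y = p.+1.
      apply: ins_posE.
      * by rewrite !size_ins_row e1' -/s; lia.
      * move=> i ip; rewrite nth_ins_row e1'; case: eqP => [|ne]; first lia.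
        rewrite nth_ins_row -/s ifN; last lia.
        by apply: (@leq_trans x) => //; apply: ins_pos_before; rewrite -/p; lia.
      * rewrite !size_ins_row e1' -/s => H.
        rewrite nth_ins_row e1' ifN; last lia.
        rewrite nth_ins_row -/s ifN; last lia.
        by apply: (leq_ltn_trans (ltnW yz)); apply: ins_pos_after; rewrite -/s; lia.
    split.
      rewrite {1}/ins_row e2 {1}/ins_row e1 set_set_nth eqxx.
      rewrite {2}/ins_row e2' {2}/ins_row e1' /ins_row -/p -/s ps.
      by rewrite [X in _ = set_nth _ X _ _]set_set_nth eqxx.
    have o1 : ins_out (ins_row r x) z =
        if p.+1 < size r then [:: nth 0 r p.+1] else [::].
      rewrite /ins_out e1 size_ins_row nth_ins_row -/p.
      rewrite (_ : (p.+1 == p) = false); last lia.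
      by rewrite (_ : (p.+1 < maxn p.+1 (size r)) = (p.+1 < size r)) //; lia.
    have o2 : ins_out (ins_row (ins_row r x) z) y = [:: z].
      rewrite /ins_out e2 !size_ins_row nth_ins_row e1 eqxx ifT //; lia.
    have o1' : ins_out (ins_row r z) x = [:: z].
      rewrite /ins_out e1' size_ins_row nth_ins_row -/s ps eqxx ifT //; lia.
    have o2' : ins_out (ins_row (ins_row r z) x) y =
        if p.+1 < size r then [:: nth 0 r p.+1] else [::].
      rewrite /ins_out e2' !size_ins_row !nth_ins_row e1' -/s.
      rewrite (_ : (p.+1 == p) = false); last lia.
      rewrite (_ : (p.+1 == s) = false); last lia.
      by rewrite (_ : (p.+1 < _) = (p.+1 < size r)) //; lia.
    rewrite o1 o2 o1' o2' /ins_out -/p -/s -ps.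
    case: (ltnP p.+1 (size r)) => H; last by left; rewrite cats0.
    rewrite ifT /=; last lia.
    right; left; constructor; last by apply: sorted_leq_nthP => //; lia.
    by rewrite ps; apply: ins_pos_at; rewrite -/s; lia.
  (* Different cells [p < s]: [x] and [z] do not interfere, and [y] then bumps strictly to the right
     of [x] and weakly to the left of [z]. *)
  + have e1 : ins_pos (ins_row r x) z = s.
      apply: ins_posE.
      * by rewrite size_ins_row -/p; lia.
      * move=> i ip; rewrite nth_ins_row -/p; case: eqP => [|ne]; first lia.
        by apply: ins_pos_before; rewrite -/s; lia.
      * rewrite size_ins_row -/p => H; rewrite nth_ins_row -/p ifN; last lia.
        by apply: ins_pos_after; rewrite -/s ?ps; lia.
    have e1' : ins_pos (ins_row r z) x = p.
      apply: ins_posE.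
      * by rewrite size_ins_row -/s; lia.
      * move=> i ip; rewrite nth_ins_row -/s; case: eqP => [|ne]; first lia.
        by apply: ins_pos_before; rewrite -/p; lia.
      * move=> _; rewrite nth_ins_row -/s ifN; last lia.
        by apply: ins_pos_at; rewrite -/p; lia.
    have e0 : ins_row (ins_row r x) z = ins_row (ins_row r z) x.
      by rewrite /ins_row e1 e1' -/p -/s set_set_nth ifN //; lia.
    rewrite e0; split => //.
    set r2 := ins_row (ins_row r z) x; set v := ins_pos r2 y.
    have r2s : sorted leq r2 by rewrite /r2; do 2![apply: sorted_ins_row].
    have sr2 : size r2 = maxn s.+1 (size r) by rewrite !size_ins_row e1' -/s; lia.
    have r2p : nth 0 r2 p = x by rewrite nth_ins_row e1' eqxx.
    have r2s' : nth 0 r2 s = z by rewrite /r2 -e0 nth_ins_row e1 eqxx.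
    have pv : p < v.
      case: (ltnP p v) => // vp.
      have H : p < size r2 by lia.
      by have := ins_pos_after r2s vp H; rewrite r2p; lia.
    have vs : v <= s.
      by case: (leqP v s) => // sv; have := ins_pos_before sv; rewrite r2s'; lia.
    have o1 : ins_out (ins_row r z) x = ins_out r x.
      rewrite /ins_out e1' size_ins_row nth_ins_row -/p -/s ifT; last lia.
      by rewrite ifN ?ifT //; lia.
    have o2 : ins_out (ins_row r x) z = ins_out r z.
      rewrite /ins_out e1 size_ins_row nth_ins_row -/p -/s.
      rewrite (_ : maxn p.+1 (size r) = size r); last lia.
      by rewrite (_ : (s == p) = false) //; lia.
    have o3 : ins_out r2 y = [:: nth 0 r2 v] by rewrite /ins_out ifT // -/v; lia.
    rewrite o1 o2 o3 /ins_out -/p -/s.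
    rewrite (_ : p < size r); last lia.
    case: (ltnP s (size r)) => H; last by left.
    right; left => /=; constructor; last first.
      apply: (@leq_ltn_trans z); last by apply: ins_pos_at.
      by rewrite -r2s'; apply: sorted_leq_nthP => //; lia.
    case: (ltnP v s) => v1.
      rewrite nth_ins_row e1' ifN; last lia.
      rewrite nth_ins_row -/s ifN; last lia.
      by apply: sorted_leq_nthP => //; lia.
    have -> : v = s by lia.
    by rewrite r2s'; apply: ins_pos_before.
Qed.

Lemma knuth3_row0 t t' : knuth3 t t' ->
  row_pass [::] t = row_pass [::] t'.
Proof.
case=> x y z xy yz; rewrite /= /ins_out /ins_row /ins_pos.
- have xz : x < z by apply: leq_trans yz.
  by rewrite /= (ltnNge z) yz /= xy /= ltnNge (ltnW xz).
- have xz : x < z by apply: leq_ltn_trans yz.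
  by rewrite /= (ltnNge z) (ltnW xz) /= (ltnNge y) xy /= yz /= xz /= (ltnNge y) xy.
Qed.

Lemma row_insert_sorted T x :
  all (sorted leq) T -> all (sorted leq) (row_insert T x).
Proof.
elim: T x => [|r T IH] x //; rewrite row_insert_cons => /andP[rs Ts].
apply/andP; split; first exact: sorted_ins_row.
by rewrite /ins_out; case: ifP => //= _; apply: IH.
Qed.

Lemma foldl_row_insert_sorted T w :
  all (sorted leq) T -> all (sorted leq) (foldl row_insert T w).
Proof. by elim: w T => [|x w IH] T //= H; apply: IH; apply: row_insert_sorted. Qed.

Lemma foldl_knuth3 T t t' : all (sorted leq) T -> knuth3 t t' ->
  foldl row_insert T t = foldl row_insert T t'.
Proof.
elim: T t t' => [|r T IH] t t'.
  (* A nonempty word has the same effect on the empty tableau and on a single empty row, so the base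
     case is a pass through a row as well. *)
  move=> _ k; have E u v : knuth3 u v ->
      foldl row_insert [::] u = foldl row_insert [:: [::]] u /\
      foldl row_insert [::] v = foldl row_insert [:: [::]] v by case.
  by have [-> ->] := E _ _ k; rewrite !foldl_row_insert_cons (knuth3_row0 k).
move=> /andP[rs Ts] k; rewrite !foldl_row_insert_cons.
have [-> [->|[]]] := row_pass_knuth3 rs k => // k'; congr (_ :: _).
  exact: IH.
by apply/esym/IH.
Qed.

Inductive knuth : word -> word -> Prop :=
| Knuth_refl w : knuth w w
| Knuth_sym w w' : knuth w w' -> knuth w' w
| Knuth_trans w w' w'' : knuth w w' -> knuth w' w'' -> knuth w w''
| Knuth_ctx u v t t' : knuth3 t t' -> knuth (u ++ t ++ v) (u ++ t' ++ v).

Lemma Psym_knuth w w' : knuth w w' -> Psym w = Psym w'.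
Proof.
elim=> // [w1 w2 w3 _ -> _ -> //|u v t t' k].
rewrite /Psym !foldl_cat (foldl_knuth3 _ k) //.
exact: foldl_row_insert_sorted.
Qed.

Lemma knuth_cat u v w w' : knuth w w' -> knuth (u ++ w ++ v) (u ++ w' ++ v).
Proof.
elim=> [w1|w1 w2 _ H|w1 w2 w3 _ H1 _ H2|u1 v1 t t' k].
- exact: Knuth_refl.
- exact: Knuth_sym.
- exact: Knuth_trans H1 H2.
by rewrite -!catA !(catA u); apply: Knuth_ctx.
Qed.

Lemma knuth_catl u w w' : knuth w w' -> knuth (u ++ w) (u ++ w').
Proof. by move=> k; have := knuth_cat u [::] k; rewrite !cats0. Qed.

Lemma knuth_catr v w w' : knuth w w' -> knuth (w ++ v) (w' ++ v).
Proof. by move=> k; have := knuth_cat [::] v k. Qed.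

(** * Crystal operators on words *)

Section Signature.
Variable i : nat.

Let iSF : (i == i.+1) = false. Proof. by lia. Qed.
Let SiF : (i.+1 == i) = false. Proof. by lia. Qed.

(** What is left of a word is always a power of [i] followed by a power of [i.+1]; the two lists
    hold their positions. Unlike [undeleted], this recursion is compatible with concatenation. *)
Fixpoint undel (w : word) : seq nat * seq nat :=
  if w is x :: w' then
    let I := map S (undel w').1 in let J := map S (undel w').2 in
    if x == i then (0 :: I, J)
    else if x == i.+1 then
      (if I is _ :: I' then (I', J) else ([::], 0 :: J))
    else (I, J)
  else ([::], [::]).

Lemma undeleted_undel w :
  undeleted i w = [seq (p, i) | p <- (undel w).1] ++ [seq (p, i.+1) | p <- (undel w).2].
Proof.
rewrite /undeleted -[in RHS](map_id (undel w).1) -[in RHS](map_id (undel w).2).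
rewrite -!map_comp.
suff H m : foldr (push_letter i) [::]
    [seq x <- zip (iota m (size w)) w | (x.2 == i) || (x.2 == i.+1)] =
    [seq (m + p, i) | p <- (undel w).1] ++ [seq (m + p, i.+1) | p <- (undel w).2].
  by rewrite H; congr (_ ++ _); apply: eq_map => p /=.
elim: w m => [|x w IH] m //=.
have E a : [seq (m + p, a) | p <- map S (undel w).1] = [seq (m.+1 + p, a) | p <- (undel w).1].
  by rewrite -map_comp; apply: eq_map => p /=; rewrite addnS.
have E2 a : [seq (m + p, a) | p <- map S (undel w).2] = [seq (m.+1 + p, a) | p <- (undel w).2].
  by rewrite -map_comp; apply: eq_map => p /=; rewrite addnS.
have [->|ne] /= := eqVneq x i.
  rewrite IH -E -E2; case: (_ ++ _) => [|y s] /=; first by rewrite addn0.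
  by rewrite iSF addn0.
have [->|ne2] /= := eqVneq x i.+1; last by rewrite IH -E -E2.
rewrite IH -E -E2; case: (undel w).1 => [|q I] /=; last by rewrite !eqxx.
case: (undel w).2 => [|q J] /=; by rewrite ?addn0 // SiF ?andbF.
Qed.

Lemma undeleted_posE w :
  undeleted_pos i w i = (undel w).1 /\ undeleted_pos i w i.+1 = (undel w).2.
Proof.
rewrite /undeleted_pos undeleted_undel !filter_cat.
have F a b (s : seq nat) : [seq x <- [seq (p, a) | p <- s] | x.2 == b] =
    if a == b then [seq (p, a) | p <- s] else [::].
  by elim: s => [|p s /= ->]; case: (a == b).
rewrite !F !eqxx iSF SiF.
by rewrite cats0 -!map_comp !map_id.
Qed.

Lemma phiwE w : phiw i w = size (undel w).1.
Proof. by rewrite /phiw (undeleted_posE w).1. Qed.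

Lemma epswE w : epsw i w = size (undel w).2.
Proof. by rewrite /epsw (undeleted_posE w).2. Qed.

(** Once both factors are reduced, only the letters [i.+1] that end [u] can still meet the letters
    [i] that begin [v]. The nearest ones cancel: the last of [u] against the first of [v]. *)
Lemma undel_cat u v : undel (u ++ v) =
  ((undel u).1 ++ map (addn (size u)) (drop (size (undel u).2) (undel v).1),
   take (size (undel u).2 - size (undel v).1) (undel u).2 ++
     map (addn (size u)) (undel v).2).
Proof.
elim: u => [|x u IH] /=.
  by rewrite drop0 !map_id; case: (undel v).
have E s : map S (map (addn (size u)) s) = map (addn (size u).+1) s.
  by rewrite -map_comp.
rewrite IH /= !map_cat -!E; case: (x == i) => /=; first by rewrite size_map map_take.
case: (x == i.+1) => /=; last by rewrite size_map map_take.
case: ((undel u).1) => [|p I] /=; last by rewrite size_map map_take.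
rewrite size_map; case: (ltnP (size (undel v).1) (size (undel u).2)) => H.
  rewrite (drop_oversize (ltnW H)) drop_oversize; last by lia.
  rewrite /=.
  by rewrite subSn ?(ltnW H) //= map_take.
move: H; rewrite leq_eqVlt => /orP[/eqP H|H].
  rewrite !drop_oversize -?H //=.
  by rewrite subSnn subnn /= !take0.
rewrite (drop_nth 0 H) /=.
have -> : size (undel u).2 - size (undel v).1 = 0 by lia.
have -> : (size (undel u).2).+1 - size (undel v).1 = 0 by lia.
by rewrite !take0.
Qed.

Lemma undel_lt w : all (fun p => p < size w) (undel w).1 && all (fun p => p < size w) (undel w).2.
Proof.
elim: w => [|x w /andP[IH1 IH2]] //=.
have E s : all (fun p => p < size w) s -> all (fun p => p < (size w).+1) (map S s).
  by rewrite all_map.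
have {}IH1 := E _ IH1; have {}IH2 := E _ IH2.
case: eqP => _ /=; first by rewrite IH1 IH2.
case: eqP => _ /=; last by rewrite IH1 IH2.
by case: (undel w).1 IH1 => [|p I] /=; rewrite IH2 ?andbT // => /andP[].
Qed.

Lemma phiw_cat u v : phiw i (u ++ v) = phiw i u + (phiw i v - epsw i u).
Proof. by rewrite !phiwE !epswE undel_cat /= size_cat size_map size_drop. Qed.

Lemma epsw_cat u v : epsw i (u ++ v) = (epsw i u - phiw i v) + epsw i v.
Proof.
rewrite !phiwE !epswE undel_cat /= size_cat size_map size_take_min.
by congr (_ + _); lia.
Qed.

Lemma FwE w : Fw i w =
  if (undel w).1 == [::] then None else Some (set_nth 0 w (last 0 (undel w).1) i.+1).
Proof. by rewrite /Fw (undeleted_posE w).1; case: (undel w).1. Qed.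

Lemma EwE w : Ew i w =
  if (undel w).2 is p :: _ then Some (set_nth 0 w p i) else None.
Proof. by rewrite /Ew (undeleted_posE w).2. Qed.

Lemma set_nth_catl (u v : word) p a : p < size u ->
  set_nth 0 (u ++ v) p a = set_nth 0 u p a ++ v.
Proof. by elim: u p => [|x u IH] [|p] //= H; rewrite IH. Qed.

Lemma set_nth_catr (u v : word) p a :
  set_nth 0 (u ++ v) (size u + p) a = u ++ set_nth 0 v p a.
Proof. by elim: u => [|x u IH] //=; rewrite IH. Qed.

Lemma Fw_cat u v : Fw i (u ++ v) =
  if epsw i u < phiw i v then omap (cat u) (Fw i v)
  else omap (cat^~ v) (Fw i u).
Proof.
rewrite phiwE epswE !FwE undel_cat /=; case: ltnP => H.
  have Hd : drop (size (undel u).2) (undel v).1 != [::].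
    by rewrite -size_eq0 size_drop -lt0n subn_gt0.
  have El : last 0 (drop (size (undel u).2) (undel v).1) = last 0 (undel v).1.
    rewrite -[in RHS](cat_take_drop (size (undel u).2) (undel v).1) last_cat.
    by case: (drop _ _) Hd.
  rewrite [X in _ = omap _ (if X then _ else _)](_ : _ = false); last first.
    by apply/negbTE; rewrite -size_eq0 -lt0n (leq_ltn_trans _ H).
  rewrite (_ : (_ ++ _ == _) = false) /=; last first.
    by apply/negbTE; rewrite -size_eq0 size_cat size_map addn_eq0 negb_and !size_eq0 Hd orbT.
  rewrite -El last_cat; case: (drop _ _) Hd => [|p s] //= _.
  by rewrite (last_map (addn (size u))) set_nth_catr.
rewrite drop_oversize // cats0; have /andP[/allP/= Hu _] := undel_lt u.
case EU: (undel u).1 Hu => [|p s] //= Hu; rewrite set_nth_catl //.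
by apply: Hu; apply: mem_last.
Qed.

Lemma Ew_cat u v : Ew i (u ++ v) =
  if phiw i v < epsw i u then omap (cat^~ v) (Ew i u)
  else omap (cat u) (Ew i v).
Proof.
rewrite phiwE epswE !EwE undel_cat /=; have /andP[_ Hu] := undel_lt u.
case: ltnP => H.
  case: (undel u).2 H Hu => [|p s] //= H /andP[Hp _].
  by rewrite subSn //= set_nth_catl.
rewrite (_ : _ - _ = 0) ?take0 /=; last lia.
by case: (undel v).2 => [|p s] //=; rewrite set_nth_catr.
Qed.

Lemma phiw1 x : phiw i [:: x] = (x == i).
Proof. by rewrite phiwE /=; case: (x == i) => //=; case: (x == i.+1). Qed.

Lemma epsw1 x : epsw i [:: x] = (x == i.+1).
Proof.
rewrite epswE /=; case: (eqVneq x i) => [->|_] /=; first by rewrite iSF.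
by case: (x == i.+1).
Qed.

Lemma Fw1 x : Fw i [:: x] = if x == i then Some [:: i.+1] else None.
Proof.
rewrite FwE /=; case: (x == i) => //=; by case: (x == i.+1).
Qed.

Lemma Ew1 x : Ew i [:: x] = if x == i.+1 then Some [:: i] else None.
Proof.
rewrite EwE /=; case: (eqVneq x i) => [->|_] /=; first by rewrite iSF.
by case: (x == i.+1).
Qed.

Lemma phiw_cons x w : phiw i (x :: w) = (x == i) + (phiw i w - (x == i.+1)).
Proof. by rewrite -cat1s phiw_cat phiw1 epsw1. Qed.

Lemma epsw_cons x w : epsw i (x :: w) = ((x == i.+1) - phiw i w) + epsw i w.
Proof. by rewrite -cat1s epsw_cat epsw1. Qed.

Lemma Fw_cons x w : Fw i (x :: w) =
  if (x == i.+1) < phiw i w then omap (cons x) (Fw i w)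
  else if x == i then Some (i.+1 :: w) else None.
Proof. by rewrite -cat1s Fw_cat epsw1 Fw1; case: ifP => // _; case: ifP. Qed.

Lemma Ew_cons x w : Ew i (x :: w) =
  if phiw i w < (x == i.+1) then Some (i :: w) else omap (cons x) (Ew i w).
Proof. by rewrite -cat1s Ew_cat epsw1 Ew1; case: eqP. Qed.

Lemma Ew_inv w w' : Ew i w = Some w' ->
  [/\ Fw i w' = Some w, phiw i w' = (phiw i w).+1 & epsw i w = (epsw i w').+1].
Proof.
elim: w w' => [|x w IH] w' //; rewrite Ew_cons; case: eqP => [-> | nx].
  case: ltnP => H.
    move=> [<-]; rewrite Fw_cons !phiw_cons !epsw_cons eqxx.
    rewrite iSF SiF.
    by split => //; [rewrite ifF //; lia | lia | lia].
  case E: (Ew i w) => [v|] //= [<-]; have [F1 F2 F3] := IH _ E.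
  rewrite Fw_cons !phiw_cons !epsw_cons F1 F2 F3 eqxx.
  by split => //; [rewrite ifT //; lia | lia | lia].
rewrite ltn0; case E: (Ew i w) => [v|] //= [<-]; have [F1 F2 F3] := IH _ E.
rewrite Fw_cons !phiw_cons !epsw_cons F1 F2 F3; move/eqP/negPf: nx => ->.
by split => //; lia.
Qed.

Lemma Fw_inv w w' : Fw i w = Some w' ->
  [/\ Ew i w' = Some w, phiw i w = (phiw i w').+1 & epsw i w' = (epsw i w).+1].
Proof.
elim: w w' => [|x w IH] w' //; rewrite Fw_cons; case: ltnP => H.
  case E: (Fw i w) => [v|] //= [<-]; have [F1 F2 F3] := IH _ E.
  rewrite Ew_cons !phiw_cons !epsw_cons F1 F2 F3.
  by split => //; [rewrite ifF //; lia | lia | lia].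
case: eqP => // e [<-]; move: H; rewrite e => H.
rewrite Ew_cons !phiw_cons !epsw_cons !eqxx.
rewrite SiF; move: H; rewrite iSF.
by move=> H; split=> //; [rewrite ifT //; lia | lia | lia].
Qed.

Definition oknuth (o o' : option word) : Prop :=
  match o, o' with
  | Some w, Some w' => knuth w w'
  | None, None => True
  | _, _ => False
  end.

Lemma knuth_of3 t t' : knuth3 t t' -> knuth t t'.
Proof. by move=> k; have := Knuth_ctx [::] [::] k; rewrite /= !cats0. Qed.

End Signature.

(** A finite check: only whether each of the three letters is [i], [i.+1] or something else matters,
    and the inequalities between them exclude most of the combinations. *)
Lemma knuth_sig3 i t t' : knuth3 t t' ->
  [/\ phiw i t = phiw i t', epsw i t = epsw i t',
      oknuth (Fw i t) (Fw i t') & oknuth (Ew i t) (Ew i t')].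
Proof.
have K1 x y z : x < y -> y <= z -> knuth [:: y; z; x] [:: y; x; z].
  by move=> ? ?; apply/knuth_of3/Knuth3_yzx.
have K2 x y z : x <= y -> y < z -> knuth [:: x; z; y] [:: z; x; y].
  by move=> ? ?; apply/knuth_of3/Knuth3_xzy.
have P0 : phiw i [::] = 0 by [].
have E0 : epsw i [::] = 0 by [].
have F0 : Fw i [::] = None by [].
have G0 : Ew i [::] = None by [].
have iSF : (i == i.+1) = false by lia.
have SiF : (i.+1 == i) = false by lia.
case=> x y z xy yz; rewrite !(Fw_cons, Ew_cons, phiw_cons, epsw_cons) P0 E0 F0 G0;
 (case: (eqVneq x i) => [ex|nx]; [|case: (eqVneq x i.+1) => [ex'|nx']]);
 (case: (eqVneq y i) => [ey|ny]; [|case: (eqVneq y i.+1) => [ey'|ny']]);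
 (case: (eqVneq z i) => [ez|nz]; [|case: (eqVneq z i.+1) => [ez'|nz']]);
 try (exfalso; lia); split => //; try subst x; try subst y; try subst z; rewrite ?iSF ?SiF;
 repeat match goal with |- context [if ?b then _ else _] =>
   let b' := eval compute in b in change b with b'; lazy iota end;
 try lia; rewrite /=; try exact I; try (apply: Knuth_refl);
 first [ by apply: K1; lia | by apply: K2; lia
       | by apply: Knuth_sym; apply: K1; lia
       | by apply: Knuth_sym; apply: K2; lia | idtac ].
Qed.

Lemma oknuth_refl o : oknuth o o.
Proof. by case: o => //= w; apply: Knuth_refl. Qed.

Lemma oknuth_map_cat u v o o' :
  oknuth o o' -> oknuth (omap (fun w => u ++ w ++ v) o) (omap (fun w => u ++ w ++ v) o').
Proof. by case: o o' => [w|] [w'|] //=; apply: knuth_cat. Qed.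

Lemma oknuth_map (f g : word -> word) o :
  (forall w, knuth (f w) (g w)) -> oknuth (omap f o) (omap g o).
Proof. by case: o => //= w; apply. Qed.

Lemma omap_omap (f g : word -> word) o : omap f (omap g o) = omap (f \o g) o.
Proof. by case: o. Qed.

Lemma omap_cat_ctx (u v : word) (o : option word) :
  omap (cat u) (omap (cat^~ v) o) = omap (fun w => u ++ w ++ v) o.
Proof. by case: o. Qed.

Lemma knuth_sig i w w' : knuth w w' ->
  [/\ phiw i w = phiw i w', epsw i w = epsw i w',
      oknuth (Fw i w) (Fw i w') & oknuth (Ew i w) (Ew i w')].
Proof.
elim=> [v|v v' _ [-> -> F E]|v1 v2 v3 _ [-> -> F1 E1] _ [-> -> F2 E2]|u v t t' k].
- by split => //; apply: oknuth_refl.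
- split => //; [move: F|move: E];
    by case: (_ i v) (_ i v') => [a|] [b|] //=; apply: Knuth_sym.
- split => //; [move: F1 F2|move: E1 E2];
    by case: (_ i v1) (_ i v2) (_ i v3) => [a|] [b|] [c|] //=; apply: Knuth_trans.
have [p e F E] := knuth_sig3 i k.
split; rewrite ?phiw_cat ?epsw_cat ?phiw_cat ?epsw_cat ?p ?e //.
  rewrite !Fw_cat !phiw_cat p e; case: ifP => _; last first.
    by apply: oknuth_map => s; apply: knuth_catl; apply: knuth_catr; apply: knuth_of3.
  case: ifP => _; last by rewrite !omap_cat_ctx; apply: oknuth_map_cat.
  rewrite !omap_omap; apply: oknuth_map => s /=.
  by apply: knuth_catl; apply: knuth_catr; apply: knuth_of3.
rewrite !Ew_cat !phiw_cat p e; case: ifP => _.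
  by apply: oknuth_map => s; apply: knuth_catl; apply: knuth_catr; apply: knuth_of3.
case: ifP => _; first by rewrite !omap_cat_ctx; apply: oknuth_map_cat.
rewrite !omap_omap; apply: oknuth_map => s /=.
by apply: knuth_catl; apply: knuth_catr; apply: knuth_of3.
Qed.

Definition degw (i : nat) (w : word) : nat :=
  if odd (phiw i w) then (epsw i w).+1 else epsw i w.

Definition Bw (i : nat) (w : word) : option word :=
  if odd (phiw i w) then Fw i w else Ew i w.

Lemma degw_knuth i w w' : knuth w w' -> degw i w = degw i w'.
Proof. by case/(knuth_sig i) => p e _ _; rewrite /degw p e. Qed.

Lemma Bw_knuth i w w' : knuth w w' -> oknuth (Bw i w) (Bw i w').
Proof. by case/(knuth_sig i) => p e F E; rewrite /Bw p; case: ifP. Qed.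

(** The left factor enters only through [degw], not through [phiw] and [epsw] separately, because
    the parity of [phiw i u] is absorbed in the shift by one. This is the tensor product rule, and
    it is the reason why a left factor may be replaced by any word with the same AI-structure. *)
Lemma degw_cat i u v : degw i (u ++ v) =
  if phiw i v < degw i u then degw i u - phiw i v + epsw i v
  else if odd (phiw i v - degw i u) then (epsw i v).+1
  else epsw i v.
Proof.
rewrite /degw phiw_cat epsw_cat oddD.
case: (boolP (odd (phiw i u))) => o /=.
  case: ltnP => H; first by rewrite (_ : phiw i v - epsw i u = 0) /=; lia.
  rewrite (_ : phiw i v - epsw i u = (phiw i v - (epsw i u).+1).+1); last by lia.
  by rewrite /= negbK (_ : epsw i u - phiw i v = 0) //; lia.
case: ltnP => H; first by rewrite (_ : phiw i v - epsw i u = 0) /=; lia.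
by rewrite (_ : epsw i u - phiw i v = 0) //; lia.
Qed.

Lemma Bw_cat i u v : Bw i (u ++ v) =
  if phiw i v < degw i u then omap (cat^~ v) (Bw i u)
  else if odd (phiw i v - degw i u) then omap (cat u) (Fw i v)
  else omap (cat u) (Ew i v).
Proof.
rewrite /Bw /degw phiw_cat Fw_cat Ew_cat oddD.
case: (boolP (odd (phiw i u))) => o /=.
  case: (ltnP (phiw i v) (epsw i u).+1) => H.
    by rewrite (_ : phiw i v - epsw i u = 0) //=; lia.
  rewrite (_ : phiw i v - epsw i u = (phiw i v - (epsw i u).+1).+1); last by lia.
  by rewrite /= negbK; case: ifP => _ //; rewrite ifN //; lia.
case: (ltnP (phiw i v) (epsw i u)) => H.
  by rewrite (_ : phiw i v - epsw i u = 0) //; lia.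
case: ifP => // o2; rewrite ifT //; move: H o2; rewrite leq_eqVlt => /orP[/eqP->|//].
by rewrite subnn.
Qed.

(** Each operator changes [phiw] by one, hence flips the parity that selects between [Fw] and
    [Ew]. *)
Lemma Bw_inv i w w' : Bw i w = Some w' -> Bw i w' = Some w.
Proof.
rewrite /Bw; case: ifP => o.
  by move=> /Fw_inv[E]; rewrite E => p _; move: o; rewrite p /= => /negbTE ->.
by move=> /Ew_inv[E p _]; rewrite p /= o E.
Qed.

(** * Crystal operators on a single column *)

Definition repl (a b : nat) (C : seq nat) : seq nat :=
  [seq if c == a then b else c | c <- C].

Lemma path_notin c C : path ltn c C -> forall d, d <= c -> d \notin C.
Proof.
move=> H d dc; apply/negP => /(allP (order_path_min ltn_trans H)) /=.
by rewrite ltnNge dc.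
Qed.

Lemma repl_id a b C : a \notin C -> repl a b C = C.
Proof.
move=> H; rewrite -[RHS]map_id; apply/eq_in_map => c cC /=.
by case: eqP => // e; rewrite -e cC in H.
Qed.

(** A column is read from bottom to top, so that [i.+1] stands just before [i] if both occur, and
    they cancel. Only a column containing exactly one of the two contributes. *)
Lemma sig_column i C : sorted ltn C ->
  [/\ phiw i (rev C) = ((i \in C) && (i.+1 \notin C)),
      epsw i (rev C) = ((i.+1 \in C) && (i \notin C)),
      Fw i (rev C) = (if (i \in C) && (i.+1 \notin C)
                      then Some (rev (repl i i.+1 C)) else None)
    & Ew i (rev C) = (if (i.+1 \in C) && (i \notin C)
                      then Some (rev (repl i.+1 i C)) else None)].
Proof.
have iSF : (i == i.+1) = false by lia.
have SiF : (i.+1 == i) = false by lia.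
elim: C => [|c C IH] //= Hc; have {IH} [p e F E] := IH (path_sorted Hc).
rewrite rev_cons -cats1 phiw_cat epsw_cat Fw_cat Ew_cat phiw1 epsw1 Fw1 Ew1 p e F E.
rewrite !in_cons; have Hn := path_notin Hc.
rewrite !rev_cons -!cats1.
case: (eqVneq c i) => [ci|ni].
  rewrite -ci in Hn *.
  have n1 : c \notin C by apply: Hn.
  have e1 : (c == c.+1) = false by lia.
  have e2 : (c.+1 == c) = false by lia.
  rewrite (negbTE n1) e1 e2 ?andbT /= (repl_id _ n1).
  by case: (c.+1 \in C).
rewrite (eq_sym i.+1 c) /=.
case: (eqVneq c i.+1) => [ci|ni2] /=.
  have n1 : i \notin C by apply: Hn; lia.
  have n2 : i.+1 \notin C by apply: Hn; lia.
  by rewrite (negbTE n1) (negbTE n2) /= ?repl_id.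
by case: (boolP (i \in C)) => i1; case: (boolP (i.+1 \in C)) => i2.
Qed.

Lemma mem_repl a b C x : a \in C -> a != b ->
  x \in repl a b C = (x == b) || (x != a) && (x \in C).
Proof.
move=> aC ab; apply/mapP/idP => [[c cC ->]|].
  by case: (eqVneq c a) => [_|ne]; rewrite ?eqxx // ne cC orbT.
case/orP => [/eqP ->|/andP[xa xC]]; first by exists a; rewrite ?eqxx.
by exists x; rewrite ?(negbTE xa).
Qed.

Lemma sorted_repl_down i C :
  sorted ltn C -> i \notin C -> sorted ltn (repl i.+1 i C).
Proof.
move=> Cs iC; rewrite /repl; apply: (homo_sorted_in _ (allss C) Cs).
move=> x y xC yC xy.
have {}xC : x \in C := xC; have {}yC : y \in C := yC.
have xi : x != i by apply: contraNneq iC => <-.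
have yi : y != i by apply: contraNneq iC => <-.
by do 2![case: eqP => ? /=]; lia.
Qed.

Lemma sorted_repl_up i C :
  sorted ltn C -> i.+1 \notin C -> sorted ltn (repl i i.+1 C).
Proof.
move=> Cs iC; rewrite /repl; apply: (homo_sorted_in _ (allss C) Cs).
move=> x y xC yC xy.
have {}xC : x \in C := xC; have {}yC : y \in C := yC.
have xi : x != i.+1 by apply: contraNneq iC => <-.
have yi : y != i.+1 by apply: contraNneq iC => <-.
by do 2![case: eqP => ? /=]; lia.
Qed.

(** * Pairs of columns *)

Definition cnt (A : seq nat) (k : nat) : nat := count (fun a => a <= k) A.

(** By [domP] this is entrywise comparison of columns together with the comparison of their lengths.
    In terms of counts, moving an entry changes both sides by an indicator, and the remaining claims
    are linear arithmetic. *)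
Definition dom (A D : seq nat) : Prop := forall k, cnt D k <= cnt A k.

Lemma dom_refl A : dom A A. Proof. by []. Qed.

Lemma dom_nil A : dom A [::]. Proof. by []. Qed.

Lemma dom_trans A B C : dom A B -> dom B C -> dom A C.
Proof. by move=> H1 H2 k; apply: leq_trans (H1 k). Qed.

Lemma leq_cnt A j k : j <= k -> cnt A j <= cnt A k.
Proof. by move=> jk; apply: sub_count => a /=; lia. Qed.

Lemma cnt_gt A i k : sorted ltn A ->
  (i < cnt A k) = (i < size A) && (nth 0 A i <= k).
Proof.
elim: A i => [|a A IH] i //= Hp; have Hs := path_sorted Hp.
have Ha := order_path_min ltn_trans Hp.
rewrite -/(cnt A k); case: i => [|i] /=.
  case: (leqP a k) => ak //=; rewrite add0n lt0n; apply: negbTE; rewrite negbK.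
  rewrite /cnt -leqn0 leqNgt -has_count; apply/hasPn => b bA /=.
  by have := allP Ha _ bA => /=; lia.
case: (leqP a k) => ak /=; first by rewrite add1n ltnS IH.
rewrite add0n.
have E : cnt A k = 0.
  apply/eqP; rewrite /cnt -leqn0 leqNgt -has_count; apply/hasPn => b bA /=.
  by have := allP Ha _ bA => /=; lia.
rewrite E ltn0; apply/esym/negbTE; rewrite negb_and ltnS -ltnNge.
case: (ltnP i (size A)) => //= iA; last by rewrite ltnS iA.
by have := allP Ha _ (mem_nth 0 iA) => /=; lia.
Qed.

Lemma cntS A k : uniq A -> cnt A k.+1 = cnt A k + (k.+1 \in A).
Proof.
elim: A => [|a A IH] //= /andP[aA uA]; rewrite -!/(cnt A _) IH // in_cons.
case: (eqVneq k.+1 a) => [e|ne] /=; last by lia.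
by rewrite -e in aA *; rewrite (negbTE aA); lia.
Qed.

Lemma cnt0 A : 0 \notin A -> cnt A 0 = 0.
Proof.
by move=> H; apply/eqP; rewrite -leqn0 leqNgt -has_count; apply/hasPn => b bA /=;
  rewrite -ltnNge lt0n; apply: contraNneq H => <-.
Qed.

Lemma cnt_all A k : (forall a, a \in A -> a <= k) -> cnt A k = size A.
Proof. by move=> H; apply/eqP; rewrite -all_count; apply/allP. Qed.

Lemma domP A D : sorted ltn A -> sorted ltn D ->
  (dom A D <-> size D <= size A /\ forall i, i < size D -> nth 0 A i <= nth 0 D i).
Proof.
move=> As Ds; split.
  move=> H; have K i : i < size D -> (i < size A) && (nth 0 A i <= nth 0 D i).
    move=> iD; rewrite -cnt_gt //; apply: leq_trans (H _).
    by rewrite cnt_gt // iD /=.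
  split; last by move=> i /K/andP[].
  by case E : (size D) => [|k] //; move: (K k); rewrite E ltnSn => /(_ isT)/andP[].
move=> [Hs H] k; rewrite leqNgt; apply/negP => H2.
have := H2; rewrite cnt_gt // => /andP[s1 s2].
have := ltnn (cnt A k); rewrite cnt_gt //.
by rewrite (leq_trans s1 Hs) (leq_trans (H _ s1) s2).
Qed.

Lemma dom_size A D : sorted ltn A -> sorted ltn D -> dom A D -> size D <= size A.
Proof. by move=> As Ds /(domP As Ds)[]. Qed.

Lemma dom_or A D : sorted ltn D -> dom A D \/ exists k, cnt A k < cnt D k.
Proof.
(* The count of [D] increases only at entries of [D], so these values of [k] suffice to decide
   [dom A D]. *)
move=> Ds; case: (boolP (all (fun k => cnt D k <= cnt A k) D)) => [/allP H|].
  left => k; case E : (cnt D k) => [|i] //.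
  have := cnt_gt i k Ds; rewrite E leqnn => /esym/andP[s1 s2].
  apply: (@leq_trans (cnt D (nth 0 D i))); first by rewrite cnt_gt // s1 /=.
  by apply: (leq_trans (H _ (mem_nth 0 s1))); apply: leq_cnt.
by rewrite -has_predC => /hasP[k _ /= Hk]; right; exists k; rewrite ltnNge.
Qed.

Definition addc (y : nat) (A : seq nat) : seq nat :=
  [seq a <- A | a < y] ++ y :: [seq a <- A | y < a].

Definition remc (y : nat) (A : seq nat) : seq nat := [seq a <- A | a != y].

Lemma mem_addc y A x : x \in addc y A = (x == y) || (x \in A).
Proof.
rewrite mem_cat in_cons !mem_filter; case: eqP => [->|ne] /=; first by rewrite orbT.
by case: (x \in A); rewrite ?andbF // !andbT; lia.
Qed.

Lemma mem_remc y A x : x \in remc y A = (x != y) && (x \in A).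
Proof. by rewrite mem_filter. Qed.

Lemma sorted_addc y A : sorted ltn A -> sorted ltn (addc y A).
Proof.
move=> As; rewrite /addc -cat1s !sorted_pairwise; try exact: ltn_trans.
rewrite !pairwise_cat /= -!sorted_pairwise; try exact: ltn_trans.
rewrite !(sorted_filter ltn_trans) // !andbT.
apply/and3P; split; [|by []|by rewrite allrel1l; apply: filter_all].
apply/allrelP => a b; rewrite mem_filter in_cons => /andP[ay _] /orP[/eqP ->//|].
by rewrite mem_filter => /andP[yb _]; lia.
Qed.

Lemma sorted_remc y A : sorted ltn A -> sorted ltn (remc y A).
Proof. exact: (sorted_filter ltn_trans). Qed.

Lemma cnt_remc y A k : sorted ltn A -> y \in A ->
  cnt (remc y A) k + (y <= k) = cnt A k.
Proof.
move=> /(sorted_uniq ltn_trans ltnn) As yA.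
by rewrite /remc -rem_filter // addnC /cnt (permP (perm_to_rem yA)).
Qed.

Lemma cnt_addc y A k : y \notin A -> cnt (addc y A) k = cnt A k + (y <= k).
Proof.
move=> yA; rewrite /cnt count_cat /= addnCA addnC; congr (_ + _).
rewrite addnC -count_cat.
suff /permP -> : perm_eq ([seq a <- A | y < a] ++ [seq a <- A | a < y]) A by [].
rewrite (eq_in_filter (a1 := fun a => a < y) (a2 := predC (fun a => y < a))).
  by rewrite perm_filterC.
move=> a aA /=; rewrite ltn_neqAle -leqNgt (_ : a != y) //.
by apply: contraNneq yA => <-.
Qed.

Lemma size_addc y A : y \notin A -> size (addc y A) = (size A).+1.
Proof.
move=> yA; pose k := maxn y (\max_(a <- A) a).
have H a : a \in A -> a <= k.
  by move=> aA; rewrite leq_max (leq_bigmax_seq _ aA) ?orbT.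
rewrite -(cnt_all H) -(@cnt_all _ k) ?cnt_addc ?leq_maxl ?addn1 //.
by move=> a; rewrite mem_addc => /orP[/eqP ->|/H //]; rewrite leq_maxl.
Qed.

Lemma size_remc y A : sorted ltn A -> y \in A -> (size (remc y A)).+1 = size A.
Proof.
move=> /(sorted_uniq ltn_trans ltnn) As yA; rewrite /remc -rem_filter //.
by rewrite size_rem //; case: A yA {As}.
Qed.

Lemma sorted_mem_eq (C D : seq nat) :
  sorted ltn C -> sorted ltn D -> C =i D -> C = D.
Proof. exact: (irr_sorted_eq ltn_trans ltnn). Qed.

Lemma addcK y A : sorted ltn A -> y \notin A -> remc y (addc y A) = A.
Proof.
move=> As yA; apply: sorted_mem_eq => //; first by apply/sorted_remc/sorted_addc.
move=> x; rewrite mem_remc mem_addc; case: eqP => //= ->.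
by rewrite (negbTE yA).
Qed.

Lemma remcK y A : sorted ltn A -> y \in A -> addc y (remc y A) = A.
Proof.
move=> As yA; apply: sorted_mem_eq => //; first by apply/sorted_addc/sorted_remc.
by move=> x; rewrite mem_addc mem_remc; case: eqP => //= ->.
Qed.

Lemma dom_remc y A : sorted ltn A -> dom A (remc y A).
Proof.
move=> As k; case: (boolP (y \in A)) => yA; first by have := cnt_remc k As yA; lia.
rewrite (_ : remc y A = A) //; apply: sorted_mem_eq (sorted_remc y As) As _ => x.
by rewrite mem_remc; case: eqP => //= ->; rewrite (negbTE yA).
Qed.

(* [dom A D] first fails at [y], and never by more than one, so that moving [y]
   from [D] to [A] repairs it. *)
Definition defect (A D : seq nat) (y : nat) : Prop :=
  [/\ cnt D y = (cnt A y).+1, forall k, k < y -> cnt D k <= cnt A k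
    & forall k, cnt D k <= (cnt A k).+1].

(** Just before the first failure the counts are still in order, so at [y] the count of [D] must
    jump and that of [A] must not. For [y = 0] there is nothing before, and a repetition-free list
    counts at most one entry there. *)
Lemma defect_mem A D y : uniq A -> uniq D -> defect A D y -> y \in D /\ y \notin A.
Proof.
move=> uA uD [E Hb _]; case: y E Hb => [|y] E Hb.
  split.
    case: (boolP (0 \in D)) => // /cnt0 E0; by rewrite E0 in E.
  apply/negP => z; suff H : cnt A 0 > 0.
    have : cnt D 0 <= 1; last by lia.
    rewrite /cnt (eq_count (a2 := pred1 0)); last by case.
    by rewrite count_uniq_mem //; case: (_ \in _).
  by rewrite -has_count; apply/hasP; exists 0.
have := Hb y (ltnSn _); move: E; rewrite !cntS //.
by case: (_ \in D); case: (_ \in A) => //=; lia.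
Qed.

Lemma defect_exists A D : sorted ltn D ->
  (forall k, cnt D k <= (cnt A k).+1) -> dom A D \/ exists y, defect A D y.
Proof.
move=> Ds H; case: (dom_or A Ds) => [|ex]; [by left | right].
case: (ex_minnP ex) => y Hy Hmin; exists y; split => //.
  by have := H y; lia.
by move=> k ky; rewrite leqNgt; apply/negP => /Hmin; lia.
Qed.

Lemma defect_ndom A D y : defect A D y -> ~ dom A D.
Proof. by move=> [E _ _] /(_ y); lia. Qed.

(* Finds the entry [y] whose move from [A] to [D] undoes the move of a defect:
   the counts of [A] and [D] agree just before [y] and never again. *)
Lemma codefect_exists A D w : uniq A -> uniq D -> 0 \notin A ->
  dom A D -> (forall k, w <= k -> cnt D k < cnt A k) ->
  exists y, [/\ y <= w, y \in A, y \notin D, cnt A y = (cnt D y).+1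
              & forall k, y <= k -> cnt D k < cnt A k].
Proof.
(* Beyond [w] strictness is the hypothesis, so a finite test up to [w] is enough; being boolean, it
   has a least solution. *)
move=> uA uD A0 Hd Hw; pose P y := all (fun k => cnt D k < cnt A k) (iota y (w - y)).
have ex : exists y, P y by exists w; rewrite /P subnn.
have PH y : P y -> forall k, y <= k -> cnt D k < cnt A k.
  move=> /allP H k yk; case: (leqP w k) => [|kw]; first exact: Hw.
  by apply: H; rewrite mem_iota; lia.
case: (ex_minnP ex) => y Py Hmin; exists y.
have yw : y <= w by apply: Hmin; rewrite /P subnn.
have Hy := PH _ Py.
case: y Py Hmin yw Hy => [|y] Py Hmin yw Hy.
  by have := Hy 0 (leqnn _); rewrite (cnt0 A0).
have Ey : cnt D y = cnt A y.
  apply/eqP; rewrite eqn_leq Hd /= leqNgt; apply/negP => H.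
  have : P y by rewrite /P (_ : w - y = (w - y.+1).+1) /= ?H //; lia.
  by move/Hmin; rewrite ltnn.
have := Hy _ (leqnn y.+1); rewrite !cntS // Ey.
case: (_ \in A); case: (_ \in D) => //=; try by lia.
by split => //; lia.
Qed.

(** * Moving a defect between two columns is a Knuth equivalence *)

Section KnuthMove.

Fixpoint idom (A D : seq nat) : bool :=
  match A, D with
  | _, [::] => true
  | [::], _ :: _ => false
  | a :: A', d :: D' => (a <= d) && idom A' D'
  end.

Lemma idomP A D : size D <= size A ->
  (forall i, i < size D -> nth 0 A i <= nth 0 D i) -> idom A D.
Proof.
elim: A D => [|a A IH] [|d D] //= sz H; apply/andP; split; first exact: (H 0).
by apply: IH => // i iD; apply: (H i.+1).
Qed.

Lemma idom_cons a A D : path ltn a A -> idom A D -> idom (a :: A) D.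
Proof.
elim: A a D => [|b A IH] a [|d D] //= /andP[ab Hp] /andP[bd H].
by rewrite (leq_trans (ltnW ab) bd) /=; apply: (IH b).
Qed.

(** The small letter [y] can pass an entry [d] of [D] only next to a letter [a] with y < a <= d, and
    [A] supplies one for every [d]. The induction removes the tops [a] and [d]: its hypothesis first
    carries [a] across the rest of [D] to meet [d] and [y], then back again, and finally carries [y]
    across that rest. *)
Lemma knuth_slide1 A D y : sorted ltn (y :: A) -> sorted ltn (y :: D) -> idom A D ->
  knuth (rev A ++ rev D ++ [:: y]) (rev A ++ [:: y] ++ rev D).
Proof.
elim: D A y => [|d D IH] A y; first by move=> _ _ _; apply: Knuth_refl.
case: A => [|a A] //= /andP[ya Ha] /andP[yd Hd] /andP[ad H].
have aD : path ltn a D.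
  rewrite path_min_sorted ?(path_sorted Hd) //.
  by apply/allP => e eD; have := allP (order_path_min ltn_trans Hd) _ eD; rewrite /=; lia.
have yD : path ltn y D.
  rewrite path_min_sorted ?(path_sorted Hd) //.
  by apply/allP => e eD; have := allP (order_path_min ltn_trans Hd) _ eD; rewrite /=; lia.
have I1 := IH A a Ha aD H.
have I2 := IH (a :: A) y (introT andP (conj ya Ha)) yD (idom_cons Ha H).
have K : knuth [:: a; d; y] [:: a; y; d].
  by have := Knuth_ctx [::] [::] (Knuth3_yzx ya ad).
move: I2; rewrite !rev_cons -!cats1 -!catA /= => I2.
apply: (@Knuth_trans _ (rev A ++ rev D ++ [:: a; d; y])).
  have := knuth_catr [:: d; y] (Knuth_sym I1); by rewrite -!catA /=.
apply: (@Knuth_trans _ (rev A ++ rev D ++ [:: a; y; d])).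
  by do 2![apply: knuth_catl].
apply: (@Knuth_trans _ (rev A ++ [:: a] ++ rev D ++ [:: y; d])).
  have := knuth_catr [:: y; d] I1; by rewrite -!catA /=.
by have := knuth_catr [:: d] I2; rewrite -!catA /= -!catA.
Qed.

(** The letters of [q] pass [D] one after the other, and each letter that has passed joins [A]. *)
Lemma knuth_slide A D q : sorted ltn (rev q ++ A) -> sorted ltn (rev q ++ D) ->
  idom A D -> knuth (rev A ++ rev D ++ q) (rev A ++ q ++ rev D).
Proof.
elim: q A => [|y q IH] A; first by rewrite cats0 => *; apply: Knuth_refl.
rewrite rev_cons !cat_rcons => HA HD H.
have /= HA1 := cat_sorted2 HA; have /= HD1 := cat_sorted2 HD.
have k1 := knuth_slide1 HA1.2 HD1.2 H.
apply: (@Knuth_trans _ (rev A ++ [:: y] ++ rev D ++ q)).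
  by have := knuth_catr q k1; rewrite -!catA.
have HD2 : sorted ltn (rev q ++ D).
  apply: (subseq_sorted ltn_trans _ HD).
  by apply: cat_subseq => //; apply: subseq_cons.
have := IH (y :: A) HA HD2 (idom_cons HA1.2 H).
by rewrite rev_cons -cats1 -!catA.
Qed.

(** Comparison of column words from the bottom entries, where [idom] starts from the tops; here it
    is the second column that may be the longer one. *)
Fixpoint bdom (p q : seq nat) : bool :=
  match p, q with
  | [::], _ => true
  | _ :: _, [::] => false
  | a :: p', d :: q' => (a <= d) && bdom p' q'
  end.

Lemma bdom_cons d p q : sorted gtn (d :: q) -> bdom p q -> bdom p (d :: q).
Proof.
elim: p d q => [|a p IH] d [|e q] //= /andP[de Hp] /andP[ae H].
by rewrite (leq_trans ae (ltnW de)) /=; apply: (IH e).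
Qed.

(** The counterpart of [knuth_slide1] for a large letter: the other Knuth relation is used, and the
    letters that make the exchanges possible stand on the right, in [q]. *)
Lemma knuth_slide_up p q y : sorted gtn (y :: p) -> sorted gtn (y :: q) ->
  bdom p q -> knuth ([:: y] ++ p ++ q) (p ++ [:: y] ++ q).
Proof.
have gtn_trans : transitive gtn by move=> a b c /= H1 H2; apply: ltn_trans H2 H1.
elim: p q y => [|a p IH] [|d q] y //=; try by move=> *; apply: Knuth_refl.
move=> /andP[ya Ha] /andP[yd Hd] /andP[ad H].
have dp : path gtn d p.
  rewrite path_min_sorted ?(path_sorted Ha) //.
  by apply/allP => e eD; have := allP (order_path_min gtn_trans Ha) _ eD; rewrite /=; lia.
have yp : path gtn y p.
  rewrite path_min_sorted ?(path_sorted Ha) //.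
  by apply/allP => e eD; have := allP (order_path_min gtn_trans Ha) _ eD; rewrite /=; lia.
have I1 := IH q d dp Hd H.
have I2 := IH (d :: q) y yp (introT andP (conj yd Hd)) (bdom_cons Hd H).
have K : knuth [:: y; a; d] [:: a; y; d].
  by apply: Knuth_sym; have := Knuth_ctx [::] [::] (Knuth3_xzy ad yd).
apply: (@Knuth_trans _ ([:: y; a; d] ++ p ++ q)).
  by have := knuth_catl [:: y; a] (Knuth_sym I1).
apply: (@Knuth_trans _ ([:: a; y; d] ++ p ++ q)).
  by apply: knuth_catr.
apply: (@Knuth_trans _ ([:: a; y] ++ p ++ d :: q)).
  by have := knuth_catl [:: a; y] I1.
by have := knuth_catl [:: a] I2.
Qed.

Lemma cnt_filter_gt y A k : uniq A -> y <= k ->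
  cnt A k = cnt A y + cnt [seq a <- A | y < a] k.
Proof.
move=> uA yk; elim: A uA => //= a A IH /andP[_ uA]; rewrite -!/(cnt A _) IH //.
by case: ltnP => /= H; rewrite -?/(cnt [seq a <- A | y < a] k); lia.
Qed.

Lemma cnt_filter_lt y A k : cnt [seq a <- A | a < y] k = cnt A (minn k y.-1) \/ y = 0.
Proof.
case: y => [|y]; [by right|left]; rewrite /cnt count_filter; apply: eq_count => a /=.
by lia.
Qed.

Lemma sorted_split y A : sorted ltn A -> y \notin A ->
  A = [seq a <- A | a < y] ++ [seq a <- A | y < a].
Proof.
move=> As yA; have := addcK As yA => {1}<-.
rewrite /addc /remc filter_cat /= eqxx /=; congr (_ ++ _); rewrite -filter_predI;
 apply: eq_filter => a /=; lia.
Qed.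

Lemma sorted_split_mem y A : sorted ltn A -> y \in A ->
  A = [seq a <- A | a < y] ++ y :: [seq a <- A | y < a].
Proof.
move=> As yA; rewrite -{1}(remcK As yA) /addc; congr (_ ++ _ :: _);
rewrite /remc -filter_predI; apply: eq_filter => a /=; lia.
Qed.

Lemma cnt_gt_none y A k : k <= y -> cnt [seq a <- A | y < a] k = 0.
Proof.
move=> ky; apply/eqP; rewrite -leqn0 leqNgt -has_count; apply/hasPn => b /=.
by rewrite mem_filter -ltnNge => /andP[H _]; apply: leq_ltn_trans H.
Qed.

Lemma cnt_lt_size y A : cnt [seq a <- A | a < y] y = size [seq a <- A | a < y].
Proof. by apply: cnt_all => a; rewrite mem_filter => /andP[/ltnW]. Qed.

Lemma size_lt_notin y A : sorted ltn A -> y \notin A ->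
  cnt A y = size [seq a <- A | a < y].
Proof.
move=> As yA; rewrite {1}(sorted_split As yA) /cnt count_cat.
by rewrite -/(cnt _ _) cnt_lt_size -/(cnt _ _) cnt_gt_none ?addn0.
Qed.

Lemma size_lt_in y A : sorted ltn A -> y \in A ->
  cnt A y = (size [seq a <- A | a < y]).+1.
Proof.
move=> As yA; rewrite {1}(sorted_split_mem As yA) /cnt count_cat /= leqnn.
by rewrite -/(cnt _ _) cnt_lt_size -/(cnt _ _) cnt_gt_none ?addn0 ?addn1.
Qed.

Lemma defect_above A D y : uniq A -> uniq D -> defect A D y ->
  dom [seq a <- A | y < a] [seq a <- D | y < a].
Proof.
move=> uA uD [E _ H] k; case: (leqP y k) => yk; last by rewrite !cnt_gt_none // ltnW.
move: (cnt_filter_gt uA yk) (cnt_filter_gt uD yk) (H k); clear H; lia.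
Qed.

Lemma defect_below A D y : defect A D y ->
  dom [seq a <- A | a < y] [seq a <- D | a < y].
Proof.
case: (posnP y) => [-> _|y0 [_ H _]] k.
  by rewrite (eq_filter (a2 := pred0)) ?filter_pred0.
have [->|e] := cnt_filter_lt y A k; last by rewrite e in y0.
have [->|e] := cnt_filter_lt y D k; last by rewrite e in y0.
by apply: H; rewrite gtn_min orbC prednK // leqnn.
Qed.

(** Cut both columns at [y], so that the word reads A2 A1 D2 y D1, each piece reversed. First A1
    passes D2 with the help of A2; then [y] passes A1 with the help of D1; finally the block y A1
    passes back over D2. The result A2 y A1 D2 D1 is the word after the move. *)
Lemma knuth_move A D y : sorted ltn A -> sorted ltn D -> defect A D y ->
  knuth (rev A ++ rev D) (rev (addc y A) ++ rev (remc y D)).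
Proof.
move=> As Ds Hd; have uA := sorted_uniq ltn_trans ltnn As.
have uD := sorted_uniq ltn_trans ltnn Ds.
have [yD yA] := defect_mem uA uD Hd.
set A1 := [seq a <- A | a < y]; set A2 := [seq a <- A | y < a].
set D1 := [seq a <- D | a < y]; set D2 := [seq a <- D | y < a].
have eA : A = A1 ++ A2 by apply: sorted_split.
have eD : D = D1 ++ y :: D2 by apply: sorted_split_mem.
have eA' : addc y A = A1 ++ y :: A2 by [].
have eD' : remc y D = D1 ++ D2.
  rewrite [LHS](sorted_split (y := y)) ?sorted_remc ?mem_remc ?eqxx //.
  rewrite /remc -!filter_predI; congr (_ ++ _); apply: eq_filter => a /=;
    clear; lia.
have A1s : sorted ltn A1 by apply: (sorted_filter ltn_trans).
have A2s : sorted ltn A2 by apply: (sorted_filter ltn_trans).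
have D1s : sorted ltn D1 by apply: (sorted_filter ltn_trans).
have D2s : sorted ltn D2 by apply: (sorted_filter ltn_trans).
have d2 : dom A2 D2 by apply: defect_above.
have d1 : dom A1 D1 by apply: defect_below.
(* The defect says that the counts differ by exactly one at [y], and [y] itself accounts for the
   difference. *)
have s1 : size A1 = size D1.
  by have [E _ _] := Hd; move: E; rewrite size_lt_in // size_lt_notin // => -[].
have b1 : bdom (rev A1) (rev D1).
  have [_ H] := (domP A1s D1s).1 d1.
  have : all2 leq A1 D1.
    rewrite all2E s1 eqxx /=; apply/(all_nthP (0, 0)) => i.
    rewrite size_zip s1 minnn => iD; rewrite nth_zip //=; exact: H.
  have all2_rev : all2 leq (rev A1) (rev D1) = all2 leq A1 D1.
    by rewrite !all2E !size_rev -rev_zip // all_rev.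
  rewrite -all2_rev.
  by elim: (rev A1) (rev D1) => [|a p IH] [|d q] //= /andP[-> /IH].
rewrite eD' eA' {1}eA {1}eD !rev_cat !rev_cons -!cats1 -!catA.
have S1 : sorted ltn (A1 ++ A2) by rewrite -eA.
have S3 : sorted ltn (A1 ++ y :: A2) by rewrite -eA'; apply: sorted_addc.
have S4 : sorted ltn (A1 ++ y :: D2).
  have yD2 : sorted ltn (y :: D2).
    by move: Ds; rewrite eD => /cat_sorted2[].
  rewrite sorted_pairwise; last exact: ltn_trans.
  rewrite pairwise_cat -!sorted_pairwise; try exact: ltn_trans.
  rewrite A1s yD2 !andbT; apply/allrelP => a b.
  rewrite mem_filter in_cons => /andP[ay _] /orP[/eqP->//|].
  by rewrite mem_filter => /andP[yb _]; apply: ltn_trans yb.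
have S2 : sorted ltn (A1 ++ D2).
  apply: (subseq_sorted ltn_trans _ S4).
  by apply: cat_subseq => //; apply: subseq_cons.
have i2 : idom A2 D2 by apply/idomP; have [] := (domP A2s D2s).1 d2.
have K1 : knuth (rev A2 ++ rev A1 ++ rev D2) (rev A2 ++ rev D2 ++ rev A1).
  by apply: Knuth_sym; apply: knuth_slide => //; rewrite revK.
have sorted_rcons_gtn s : sorted ltn (rcons s y) -> sorted gtn (y :: rev s).
  by move=> H; rewrite -rev_rcons rev_sorted.
have K2 : knuth ([:: y] ++ rev A1 ++ rev D1) (rev A1 ++ [:: y] ++ rev D1).
  apply: knuth_slide_up => //; apply: sorted_rcons_gtn.
    by move: S3; rewrite -cat_rcons => /cat_sorted2[].
  by move: Ds; rewrite eD -cat_rcons => /cat_sorted2[].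
have K3 : knuth (rev A2 ++ rev D2 ++ [:: y] ++ rev A1) (rev A2 ++ ([:: y] ++ rev A1) ++ rev D2).
  by apply: knuth_slide => //; rewrite rev_cat revK -catA.
apply: (@Knuth_trans _ (rev A2 ++ rev D2 ++ rev A1 ++ [:: y] ++ rev D1)).
  by have := knuth_catr ([:: y] ++ rev D1) K1; rewrite -!catA.
apply: (@Knuth_trans _ (rev A2 ++ rev D2 ++ [:: y] ++ rev A1 ++ rev D1)).
  by do 2![apply: knuth_catl]; apply: Knuth_sym.
by have := knuth_catr (rev D1) K3; rewrite -!catA.
Qed.

End KnuthMove.

(** * Configurations of columns *)

Lemma cnt_compl n C k : uniq C -> (forall a, a \in C -> 0 < a <= n) ->
  cnt (compl_column n C) k + cnt C k = minn k n.
Proof.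
move=> uC HC.
have E : perm_eq C [seq x <- iota 1 n | x \in C].
  apply: uniq_perm; rewrite ?filter_uniq ?iota_uniq // => x.
  rewrite mem_filter mem_iota; case: (boolP (x \in C)) => //= /HC; lia.
rewrite /cnt (permP E) addnC -count_cat.
have /permP -> : perm_eq ([seq x <- iota 1 n | x \in C] ++ compl_column n C) (iota 1 n).
  by rewrite perm_filterC.
elim: n k {HC E} => [|n IH] k /=; first by rewrite minn0.
rewrite -(addn1 1) iotaDl count_map.
case: k => [|k]; first by rewrite (eq_count (a2 := pred0)) ?count_pred0.
rewrite (eq_count (a2 := fun a => a <= k)) ?IH //; lia.
Qed.

Lemma mem_compl n C x : x \in compl_column n C = (0 < x <= n) && (x \notin C).
Proof. by rewrite mem_filter mem_iota andbC add1n ltnS. Qed.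

Lemma sorted_compl n C : sorted ltn (compl_column n C).
Proof. by apply: (sorted_filter ltn_trans); apply: iota_ltn_sorted. Qed.

Lemma size_compl n C : uniq C -> (forall a, a \in C -> 0 < a <= n) ->
  size (compl_column n C) + size C = n.
Proof.
move=> uC HC; have := cnt_compl n uC HC; rewrite minnn !cnt_all //.
  by move=> a /HC /andP[].
by move=> a; rewrite mem_compl => /andP[/andP[]].
Qed.

Lemma complK n C : sorted ltn C -> (forall a, a \in C -> 0 < a <= n) ->
  compl_column n (compl_column n C) = C.
Proof.
move=> Cs HC; apply: sorted_mem_eq (sorted_compl _ _) Cs _ => x.
by rewrite !mem_compl; case: (boolP (x \in C)) => [/HC ->|_]; case: (0 < x <= n).
Qed.

Lemma compl_addc n C y : sorted ltn C ->
  compl_column n (addc y C) = remc y (compl_column n C).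
Proof.
move=> Cs; apply: sorted_mem_eq (sorted_compl _ _) (sorted_remc _ (sorted_compl _ _)) _ => x.
by rewrite mem_remc !mem_compl mem_addc negb_or; case: (0 < x <= n); rewrite ?andbF.
Qed.

Lemma compl_remc n C y : sorted ltn C -> 0 < y <= n ->
  compl_column n (remc y C) = addc y (compl_column n C).
Proof.
move=> Cs yn; apply: sorted_mem_eq (sorted_compl _ _) (sorted_addc _ (sorted_compl _ _)) _ => x.
rewrite mem_addc !mem_compl mem_remc negb_and negbK.
by case: eqP => [->|_] //=; rewrite yn.
Qed.

(* A tableau is encoded by the function giving its columns. *)
Definition config := nat -> seq nat.

Section Configurations.
Variables n N : nat.
Implicit Types x z : config.

Definition upd x j A : config := fun i => if i == j then A else x i.

Definition cpl x : config := upd x 0 (compl_column n (x 0)).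

Definition cword x : word := flatten [seq rev (x j) | j <- iota 0 N].

Definition wf x : Prop :=
  [/\ forall j, sorted ltn (x j), forall j a, a \in x j -> 0 < a <= n
    & forall j, N <= j -> x j = [::]].

Definition chain x : Prop := forall j, dom (x j) (x j.+1).

(* The condition defining AI-tableaux, without the bound on the first column. *)
Definition highest x : Prop := chain x /\ dom (compl_column n (x 0)) (x 1).

(* The raising operator of the commuting action of gl on columns, restricted to
   configurations where it applies at most once. *)
Definition step s x x' : Prop := exists y,
  [/\ defect (x s) (x s.+1) y, x' s = addc y (x s), x' s.+1 = remc y (x s.+1)
    & forall i, i != s -> i != s.+1 -> x' i = x i].

Lemma upd_eq x j A : upd x j A j = A. Proof. by rewrite /upd eqxx. Qed.

Lemma upd_neq x j A i : i != j -> upd x j A i = x i.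
Proof. by rewrite /upd => /negbTE ->. Qed.

Lemma wf_uniq x j : wf x -> uniq (x j).
Proof. by case=> H _ _; apply: (sorted_uniq ltn_trans ltnn). Qed.

Lemma wf_0 x j : wf x -> 0 \notin x j.
Proof. by case=> _ H _; apply/negP => /H. Qed.

Lemma wf_upd x j A : wf x -> j < N -> sorted ltn A ->
  (forall a, a \in A -> 0 < a <= n) -> wf (upd x j A).
Proof.
move=> [H1 H2 H3] jN As HA; split=> i; rewrite /upd; case: (eqVneq i j) => [e|_] //.
- by move=> a; apply: H2.
- by rewrite e leqNgt jN.
- exact: H3.
Qed.

Lemma wf_cpl x : 0 < N -> wf x -> wf (cpl x).
Proof.
move=> N0 w; apply: wf_upd => //; first exact: sorted_compl.
by move=> a; rewrite mem_compl => /andP[].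
Qed.

Lemma cplK x : wf x -> cpl (cpl x) =1 x.
Proof.
move=> [H1 H2 _] i; rewrite /cpl /upd eqxx; case: eqP => // ->.
by rewrite complK //; apply: H2.
Qed.

Lemma step_mem s x x' y : wf x -> defect (x s) (x s.+1) y ->
  y \in x s.+1 /\ y \notin x s.
Proof. by move=> w; apply: defect_mem; apply: wf_uniq. Qed.

Lemma step_wf s x x' : wf x -> s.+1 < N -> step s x x' -> wf x'.
Proof.
move=> w sN [y [d e1 e2 e3]]; have [yD yA] := step_mem x' w d.
have [H1 H2 H3] := w; split=> i.
- have [->|n1] := eqVneq i s; first by rewrite e1 sorted_addc.
  have [->|n2] := eqVneq i s.+1; first by rewrite e2 sorted_remc.
  by rewrite e3.
- move=> a; have [->|n1] := eqVneq i s.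
    by rewrite e1 mem_addc => /orP[/eqP ->|]; [apply: H2 yD | apply: H2].
  have [->|n2] := eqVneq i s.+1; first by rewrite e2 mem_remc => /andP[_]; apply: H2.
  by rewrite e3 //; apply: H2.
- by move=> Ni; rewrite e3 ?H3 //; lia.
Qed.

Lemma step_size s x x' : wf x -> step s x x' ->
  size (x' s) = (size (x s)).+1 /\ (size (x' s.+1)).+1 = size (x s.+1).
Proof.
move=> w [y [d e1 e2 e3]]; have [yD yA] := step_mem x' w d.
by have [H1 _ _] := w; rewrite e1 e2 size_addc // size_remc.
Qed.

Lemma cnt_pred A y : uniq A -> 0 < y -> cnt A y = cnt A y.-1 + (y \in A).
Proof. by case: y => // y uA _; rewrite cntS. Qed.

Lemma step_inj s x x' z z' : wf x -> wf z -> x' =1 z' ->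
  step s x x' -> step s z z' -> x =1 z.
Proof.
move=> wx wz E [y [dx ex1 ex2 ex3]] [y' [dz ez1 ez2 ez3]].
have key t t' u : wf t -> defect (t s) (t s.+1) u ->
    t' s = addc u (t s) -> t' s.+1 = remc u (t s.+1) ->
    [/\ cnt (t' s) u.-1 <= cnt (t' s.+1) u.-1 \/ u = 0
      & forall k, u <= k -> cnt (t' s.+1) k < cnt (t' s) k].
  move=> wt dt e1 e2; have [uD uA] := step_mem t' wt dt.
  have [H1 _ _] := wt; have [a1 a2 a3] := dt; rewrite e1 e2; split.
    case: (posnP u) => u0; [by right | left].
    have := cnt_remc u.-1 (H1 s.+1) uD; rewrite cnt_addc // (_ : u <= u.-1 = false); last lia.
    move: a1; rewrite (cnt_pred (wf_uniq _ wt) u0) (cnt_pred (wf_uniq _ wt) u0).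
    by rewrite uD (negbTE uA); lia.
  move=> k uk; have := cnt_remc k (H1 s.+1) uD; rewrite cnt_addc // uk.
  by have := a3 k; lia.
have [p1 q1] := key _ _ _ wx dx ex1 ex2.
have [p2 q2] := key _ _ _ wz dz ez1 ez2.
have yy : y = y'.
  rewrite -!E in p2 q2; case: (ltngtP y y') => // H.
    by case: p2 => [p2|]; [have := q1 y'.-1; lia | lia].
  by case: p1 => [p1|]; [have := q2 y.-1; lia | lia].
rewrite -yy in dz ez1 ez2 => {yy p1 q1 p2 q2 key}.
have [yD yA] := step_mem x' wx dx; have [yD' yA'] := step_mem z' wz dz.
have [H1 _ _] := wx; have [H1' _ _] := wz.
move=> i; have [->|n1] := eqVneq i s.
  by rewrite -(addcK (H1 s) yA) -(addcK (H1' s) yA') -ex1 -ez1 E.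
have [->|n2] := eqVneq i s.+1.
  by rewrite -(remcK (H1 s.+1) yD) -(remcK (H1' s.+1) yD') -ex2 -ez2 E.
by rewrite -ex3 // E ez3.
Qed.

Lemma cword_split x s : s.+1 < N -> exists u v,
  forall x', (forall i, i != s -> i != s.+1 -> x' i = x i) ->
    cword x' = u ++ (rev (x' s) ++ rev (x' s.+1)) ++ v.
Proof.
move=> sN; exists (flatten [seq rev (x j) | j <- iota 0 s]).
exists (flatten [seq rev (x j) | j <- iota s.+2 (N - s.+2)]) => x' H.
rewrite /cword; have -> : N = s + (2 + (N - s.+2)) by lia.
rewrite iotaD map_cat flatten_cat iotaD map_cat flatten_cat /= cats0 add0n !addn2.
congr (flatten _ ++ (_ ++ flatten _)).
  by apply/eq_in_map => i; rewrite mem_iota => Hi; rewrite H //; lia.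
rewrite (_ : s + _ - _ = N - s.+2); last lia.
by apply/eq_in_map => i; rewrite mem_iota => Hi; rewrite H //; lia.
Qed.

Lemma cword_ext x x' : x =1 x' -> cword x = cword x'.
Proof. by move=> E; rewrite /cword; congr flatten; apply: eq_map => i; rewrite E. Qed.

Lemma step_knuth s x x' : wf x -> s.+1 < N -> step s x x' ->
  knuth (cword x) (cword x').
Proof.
move=> w sN [y [d e1 e2 e3]]; have [H1 _ _] := w.
have [u [v E]] := cword_split x sN.
rewrite (E x) // (E x') // e1 e2; apply: knuth_cat; exact: knuth_move.
Qed.

End Configurations.

(** * A surplus travelling to the left and a deficiency travelling to the right *)

Section Ladder.
Variables n N : nat.
Implicit Types x z : config.
Local Notation wf := (wf n N).
Local Notation highest := (highest n).
Local Notation K := (compl_column n).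
Local Notation cpl := (cpl n).

Lemma highest_upd x s B : highest (upd x s.+1 B) <->
  [/\ dom (x s) B, dom B (x s.+2),
      forall i, i != s -> i != s.+1 -> dom (x i) (x i.+1)
    & dom (K (x 0)) (if s == 0 then B else x 1)].
Proof.
split.
  move=> [H HK]; split.
  - by have := H s; rewrite /upd eqxx ifN //; lia.
  - by have := H s.+1; rewrite /upd eqxx ifN //; lia.
  - by move=> i i1 i2; have := H i; rewrite /upd !ifN.
  - by move: HK; rewrite /upd /=; case: s {H}.
move=> [H1 H2 H3 H4]; split.
  move=> i; rewrite /upd; case: (eqVneq i s.+1) => [->|n1].
    by rewrite ifN //; lia.
  rewrite eqSS; case: (eqVneq i s) => [->|n2] //; exact: H3.
by move: H4; rewrite /upd /=; case: s {H1 H2 H3}.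
Qed.

(* [x] differs from a configuration satisfying [highest] by one additional, resp.
   one missing, entry in column j > 0. *)
Definition added j x : Prop :=
  dom (x j) (x j.+1) /\ exists2 a, a \in x j & highest (upd x j (remc a (x j))).

Definition removed j x : Prop := exists w,
  [/\ w \notin x j, 0 < w <= n & highest (upd x j (addc w (x j)))].

Lemma highest_ext x x' : x =1 x' -> highest x -> highest x'.
Proof. by move=> E [H1 H2]; split => [i|]; rewrite -!E. Qed.

Lemma added_highest j x : added j.+1 x -> dom (x j) (x j.+1) ->
  (j = 0 -> dom (K (x 0)) (x 1)) -> highest x.
Proof.
move=> [H [a _ /highest_upd[H1 H2 H3 H4]]] Hd HK; split.
  move=> i; have [->//|n1] := eqVneq i j; have [->//|n2] := eqVneq i j.+1.
  exact: H3.
by case: (eqVneq j 0) H4 => [/HK|].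
Qed.

Lemma added_count A D a : sorted ltn D -> a \in D -> dom A (remc a D) ->
  forall k, cnt D k <= cnt A k + (a <= k).
Proof. by move=> Ds aD H k; have := cnt_remc k Ds aD; have := H k; lia. Qed.

Lemma defect_ge A D a y : sorted ltn D -> a \in D -> dom A (remc a D) ->
  defect A D y -> a <= y.
Proof.
move=> Ds aD H [E _ _]; have := added_count Ds aD H y; rewrite E.
by case: leqP => //; lia.
Qed.

Lemma defect_addc_remc A D y : sorted ltn A -> sorted ltn D -> defect A D y ->
  dom (addc y A) (remc y D).
Proof.
move=> As Ds d k.
have [yD yA] := defect_mem (sorted_uniq ltn_trans ltnn As) (sorted_uniq ltn_trans ltnn Ds) d.
have [E H1 H2] := d; have := cnt_remc k Ds yD; rewrite cnt_addc //.
by case: (leqP y k) => yk; [have := H2 k | have := H1 k yk]; lia.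
Qed.

Lemma defect_remc A D y : sorted ltn A -> sorted ltn D -> defect A D y ->
  dom A (remc y D).
Proof.
move=> As Ds d k.
have [yD yA] := defect_mem (sorted_uniq ltn_trans ltnn As) (sorted_uniq ltn_trans ltnn Ds) d.
have [E H1 H2] := d; have := cnt_remc k Ds yD.
by case: (leqP y k) => yk; [have := H2 k | have := H1 k yk]; lia.
Qed.

Lemma dom_remc_ge D X a y : sorted ltn D -> a \in D -> y \in D -> a <= y ->
  dom D X -> dom (remc a D) X -> dom (remc y D) X.
Proof.
move=> Ds aD yD ay H1 H2 k; have := cnt_remc k Ds aD; have := cnt_remc k Ds yD.
by have := H1 k; have := H2 k; case: (leqP y k); case: (leqP a k); lia.
Qed.

Lemma dom_remc_le A D a y : sorted ltn D -> a \in D -> y \in D -> y <= a ->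
  dom A (remc a D) -> dom A (remc y D).
Proof.
move=> Ds aD yD ay H k; have := cnt_remc k Ds aD; have := cnt_remc k Ds yD.
by have := H k; case: (leqP y k); case: (leqP a k); lia.
Qed.

Definition move_left s y x : config :=
  upd (upd x s (addc y (x s))) s.+1 (remc y (x s.+1)).

Definition move_right s y x : config :=
  upd (upd x s (remc y (x s))) s.+1 (addc y (x s.+1)).

Lemma move_leftE s y x :
  [/\ move_left s y x s = addc y (x s), move_left s y x s.+1 = remc y (x s.+1)
    & forall i, i != s -> i != s.+1 -> move_left s y x i = x i].
Proof.
by rewrite /move_left /upd; split=> [| |i H1 H2]; rewrite ?eqxx ?ifN //; lia.
Qed.

Lemma move_rightE s y x :
  [/\ move_right s y x s = remc y (x s), move_right s y x s.+1 = addc y (x s.+1)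
    & forall i, i != s -> i != s.+1 -> move_right s y x i = x i].
Proof.
by rewrite /move_right /upd; split=> [| |i H1 H2]; rewrite ?eqxx ?ifN //; lia.
Qed.

Lemma move_left_step s y x : defect (x s) (x s.+1) y -> step s x (move_left s y x).
Proof. by move=> d; exists y; have [] := move_leftE s y x. Qed.

(** The inverse of [step]: the entry given by [codefect_exists] is moved back, and strict separation
    of the counts from [y] on makes [y] the first failure afterwards. *)
Lemma move_right_step s x w : wf x -> s.+1 < N -> dom (x s) (x s.+1) ->
  (forall k, w <= k -> cnt (x s.+1) k < cnt (x s) k) ->
  exists y, [/\ y <= w, y \in x s, y \notin x s.+1, 0 < y <= n
    & [/\ forall k, y <= k -> cnt (x s.+1) k < cnt (x s) k,
          wf (move_right s y x) & step s (move_right s y x) x]].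
Proof.
move=> w0 sN Hd Hw; have [H1 H2 H3] := w0.
have [y [yw yA yD E Hy]] := codefect_exists (wf_uniq s w0) (wf_uniq s.+1 w0) (wf_0 s w0) Hd Hw.
have yn := H2 _ _ yA.
have [e1 e2 e3] := move_rightE s y x.
exists y; split => //; split => //.
  apply: wf_upd => //; last by move=> a; rewrite mem_addc => /orP[/eqP ->//|/H2].
    apply: wf_upd => //; [lia|exact: sorted_remc|by move=> a; rewrite mem_remc => /andP[_ /H2]].
  exact: sorted_addc.
exists y; rewrite e1 e2 remcK // addcK //; split => //; last by move=> i i1 i2; rewrite e3.
split.
- by have := cnt_remc y (H1 s) yA; rewrite cnt_addc // leqnn; lia.
- by move=> k ky; have := cnt_remc k (H1 s) yA; rewrite cnt_addc //; have := Hd k; lia.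
- by move=> k; have := cnt_remc k (H1 s) yA; rewrite cnt_addc //; have := Hd k;
    case: (leqP y k) => [/Hy|]; lia.
Qed.

(** Without the surplus entry [a] the columns are in order, so a failure against the left neighbour
    is by one only and occurs at some y >= a. Once [y] has moved, the old column has lost [y]
    instead of [a], which is no worse for its right neighbour, and [y] is the surplus of the new
    column. *)
Lemma added_step t x : wf x -> added t.+2 x ->
  dom (x t.+1) (x t.+2) \/ exists2 x', step t.+1 x x' & added t.+1 x'.
Proof.
move=> w [Hd [a aD /highest_upd[h1 h2 h3 h4]]]; have [H1 _ _] := w.
have Hk k : cnt (x t.+2) k <= (cnt (x t.+1) k).+1.
  by have := added_count (H1 _) aD h1 k; case: (a <= k); lia.
have [|[y d]] := defect_exists (H1 _) Hk; [by left | right].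
 have [e1 e2 e3] := move_leftE t.+1 y x.
have [yD yA] := defect_mem (wf_uniq _ w) (wf_uniq _ w) d.
have ay := defect_ge (H1 _) aD h1 d.
exists (move_left t.+1 y x); first exact: move_left_step.
split; first by rewrite e1 e2; apply: defect_addc_remc.
exists y; first by rewrite e1 mem_addc eqxx.
apply/highest_upd; rewrite e1 e2 addcK //; split.
- by rewrite e3; try (apply: h3); lia.
- exact: defect_remc.
- move=> i i1 i2; have [->|n2] := eqVneq i t.+2.
    by rewrite e2 e3; [apply: (dom_remc_ge (a := a)) | lia..].
  by rewrite !e3; try (apply: h3); lia.
- rewrite (e3 0) //; case: (eqVneq t 0) h4 => [->|t0] //= h4.
  by rewrite e3 //; lia.
Qed.

(** Dominance without the surplus [a] makes the counts separate strictly from [a] on, so the entry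
    to move back satisfies y <= a, and the left neighbour still dominates what remains. *)
Lemma added_back t x : wf x -> t.+2 < N -> added t.+1 x ->
  exists x', [/\ wf x', step t.+1 x' x & added t.+2 x'].
Proof.
move=> w tN [Hd [a aA /highest_upd[h1 h2 h3 h4]]]; have [H1 _ _] := w.
have [|y [ya yA yD yn [Hy wz sz]]] := move_right_step (w := a) w tN Hd.
  by move=> k ak; have := cnt_remc k (H1 _) aA; have := h2 k; rewrite ak; lia.
have [e1 e2 e3] := move_rightE t.+1 y x.
exists (move_right t.+1 y x); split => //; split.
  rewrite e2 e3; [|lia..] => k; rewrite cnt_addc //.
  by apply: leq_trans (leq_addr _ _); apply: h3; lia.
exists y; first by rewrite e2 mem_addc eqxx.
apply/highest_upd; rewrite e1 e2 addcK // e3; [|lia..]; split.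
- move=> k; have := cnt_remc k (H1 _) yA; have := Hd k.
  by case: (leqP y k) => [/Hy|]; lia.
- by apply: h3; lia.
- move=> i i1 i2; have [->|n2] := eqVneq i t.
    by rewrite e1 e3; [apply: (dom_remc_le (a := a)) | lia..].
  by rewrite !e3; try (apply: h3); lia.
- rewrite /= e3 //; case: (eqVneq t 0) h4 => [t0|t0] /= h4.
    by move: e1; rewrite t0 => ->; rewrite t0 in aA yA ya h4; apply: (dom_remc_le (a := a)).
  by rewrite e3 //; lia.
Qed.

(** Restoring the missing entry [b] would cure every failure on the right, so a failure is by one
    only and occurs at some y >= b. Taking [y] from the right instead gives smaller counts than
    restoring [b], so the left neighbour is not disturbed; now the right column lacks [y]. *)
Lemma removed_step j x : wf x -> removed j.+1 x ->
  dom (x j.+1) (x j.+2) \/ exists2 x', step j.+1 x x' & removed j.+2 x'.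
Proof.
move=> w [b [bD bn /highest_upd[h1 h2 h3 h4]]]; have [H1 H2 _] := w.
have Hk k : cnt (x j.+2) k <= (cnt (x j.+1) k).+1.
  by have := h2 k; rewrite cnt_addc //; case: (b <= k); lia.
have [|[y d]] := defect_exists (H1 _) Hk; [by left | right].
 have [e1 e2 e3] := move_leftE j.+1 y x.
have [yD yA] := defect_mem (wf_uniq _ w) (wf_uniq _ w) d.
have byy : b <= y.
  have [E _ _] := d; have := h2 y; rewrite cnt_addc // E.
  by case: (b <= y); lia.
exists (move_left j.+1 y x); first exact: move_left_step.
exists y; rewrite e2 mem_remc eqxx (H2 _ _ yD); split => //.
have hA k : cnt (addc y (x j.+1)) k <= cnt (addc b (x j.+1)) k.
  by rewrite !cnt_addc //; case: (leqP y k); lia.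
apply/highest_upd; rewrite remcK // e1; split.
- move=> k; have [E H H'] := d; rewrite cnt_addc //.
  by case: (leqP y k) => yk; [have := H' k | have := H k yk]; lia.
- by rewrite e3; try (apply: h3); lia.
- move=> i i1 i2; have [->|n2] := eqVneq i j.
    by rewrite e1 e3; [move=> k; apply: leq_trans (hA k) (h1 k) | lia..].
  by rewrite !e3; try (apply: h3); lia.
- rewrite /= e3 //; case: (eqVneq j 0) h4 => [j0|j0] /= h4.
    by move: e1; rewrite j0 => -> k; apply: leq_trans (h4 k); move: (hA k); rewrite j0.
  by rewrite e3 //; lia.
Qed.

Lemma removed_back j x : wf x -> j.+2 < N -> removed j.+2 x ->
  exists x', [/\ wf x', step j.+1 x' x & removed j.+1 x'].
Proof.
move=> w jN [b [bD bn /highest_upd[h1 h2 h3 h4]]]; have [H1 H2 _] := w.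
have hd : dom (x j.+1) (x j.+2).
  by move=> k; apply: leq_trans (h1 k); rewrite cnt_addc // leq_addr.
have [|y [yb yA yD yn [Hy wz sz]]] := move_right_step (w := b) w jN hd.
  by move=> k bk; have := h1 k; rewrite cnt_addc // bk; lia.
have [e1 e2 e3] := move_rightE j.+1 y x.
exists (move_right j.+1 y x); split => //.
exists y; rewrite e1 mem_remc eqxx yn; split => //.
apply/highest_upd; rewrite remcK // e2; split.
- by rewrite e3; try (apply: h3); lia.
- move=> k; rewrite cnt_addc //; have := hd k.
  by case: (leqP y k) => [/Hy|]; lia.
- move=> i i1 i2; have [->|n2] := eqVneq i j.+2.
    rewrite e2 e3; [|lia..] => k; apply: leq_trans (h2 k) _; rewrite !cnt_addc //.
    by case: (leqP b k); lia.
  by rewrite !e3; try (apply: h3); lia.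
- rewrite /= e3 //; case: (eqVneq j 0) h4 => [j0|j0] /= h4; first by rewrite j0 in h4 *.
  by rewrite e3 //; lia.
Qed.

Lemma removed_highest j x : removed j.+1 x -> dom (x j.+1) (x j.+2) -> highest x.
Proof.
move=> [b [bD bn /highest_upd[h1 h2 h3 h4]]] Hd.
have hb k : cnt (x j.+1) k <= cnt (addc b (x j.+1)) k by rewrite cnt_addc // leq_addr.
split.
  move=> i; have [->|n1] := eqVneq i j; first by move=> k; apply: leq_trans (h1 k).
  by have [->//|n2] := eqVneq i j.+1; apply: h3.
case: (eqVneq j 0) h4 => [j0|//] h4 k; apply: leq_trans (h4 k).
by move: (hb k); rewrite j0.
Qed.

End Ladder.

(** * Moves across the first column *)

Section FirstColumn.
Variables n N : nat.
Implicit Types x z : config.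
Local Notation wf := (wf n N).
Local Notation highest := (highest n).
Local Notation added := (added n).
Local Notation removed := (removed n).
Local Notation K := (compl_column n).
Local Notation cpl := (cpl n).

Lemma cpl0 x : cpl x 0 = K (x 0). Proof. by []. Qed.

Lemma cplS x i : cpl x i.+1 = x i.+1. Proof. by []. Qed.

Lemma wf_complK x : wf x -> K (K (x 0)) = x 0.
Proof. by case=> H1 H2 _; apply: complK => //; apply: H2. Qed.

Lemma highest_cpl x : wf x -> highest x -> highest (cpl x).
Proof.
move=> w [H1 H2]; split; last by rewrite cpl0 wf_complK //; apply: (H1 0).
by case=> [|i]; [exact: H2 | exact: (H1 i.+1)].
Qed.

Lemma added_cpl x : wf x -> added 1 x -> added 1 (cpl x).
Proof.
move=> w [Hd [a aD /highest_upd[h1 h2 h3 h4]]]; split => //; exists a => //.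
apply/highest_upd; rewrite /= cpl0 wf_complK //; split => //.
by move=> [|i] // i1 i2; apply: (h3 i.+1).
Qed.

Lemma step_ext s x x' z : x =1 z -> step s x x' -> step s z x'.
Proof.
move=> E [y [d e1 e2 e3]]; exists y; rewrite -!E; split => // i i1 i2.
by rewrite e3 // E.
Qed.

Lemma chain_move_left y x a : wf x -> a \in x 1 -> dom (x 0) (remc a (x 1)) ->
  dom (x 1) (x 2) -> dom (remc a (x 1)) (x 2) -> (forall i, 1 < i -> dom (x i) (x i.+1)) ->
  defect (x 0) (x 1) y -> chain (move_left 0 y x).
Proof.
move=> w aD h1 hd h2 h3 d; have [H1 _ _] := w.
have ay := defect_ge (H1 _) aD h1 d.
have [yD yA] := defect_mem (wf_uniq _ w) (wf_uniq _ w) d.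
have [e1 e2 e3] := move_leftE 0 y x.
case=> [|[|i]]; [|rewrite e2 e3 //|by rewrite !e3 //; apply: h3].
  by rewrite e1 e2; apply: defect_addc_remc.
by apply: (dom_remc_ge (a := a)).
Qed.

(** A column strictly longer than the next has an entry from which on the counts stay separated; it
    can be taken away, hence regarded as a surplus. *)
Lemma added_of_highest j x : wf x -> highest x -> size (x j.+2) < size (x j.+1) ->
  added j.+1 x.
Proof.
move=> w [hc hK] hs; have [H1 H2 _] := w.
have Hn k : n <= k -> cnt (x j.+2) k < cnt (x j.+1) k.
  by move=> nk; rewrite !cnt_all // => a /H2; lia.
have [y [_ yA yD _ Hy]] :=
  codefect_exists (wf_uniq _ w) (wf_uniq _ w) (wf_0 _ w) (hc j.+1) Hn.
split; first exact: hc.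
exists y => //; have yle := dom_remc y (H1 j.+1).
apply/highest_upd; split.
- exact: dom_trans (hc j) yle.
- move=> k; have := cnt_remc k (H1 _) yA; have := hc j.+1 k.
  by case: (leqP y k) => [/Hy|]; lia.
- by move=> i _ _; apply: hc.
- by case: (eqVneq j 0) => [j0|_] //; apply: dom_trans hK _; rewrite j0 in yle *.
Qed.

Lemma removed_of_highest j x : wf x -> highest x ->
  (forall i, i <= j -> size (x j.+1) < size (x i)) ->
  (j = 0 -> size (x 1) < size (K (x 0))) -> removed j.+1 x.
Proof.
move=> w [hc hK] hs hs'; have [H1 H2 _] := w.
have Hn k : n <= k -> cnt (x j.+1) k < cnt (x j) k.
  by move=> nk; rewrite !cnt_all; [exact: hs|move=> a /H2; lia..].
have [y [_ yA yD _ Hy]] :=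
  codefect_exists (wf_uniq _ w) (wf_uniq _ w) (wf_0 _ w) (hc j) Hn.
have yn := H2 _ _ yA.
(* In column 1 the letter to be added has to respect both the first column and its complement; the
   maximum of the two entries found there does, and it is absent from column 1 because both are. *)
have [b [yb bD bn hb]] : exists b, [/\ y <= b, b \notin x j.+1, 0 < b <= n
    & j = 0 -> forall k, b <= k -> cnt (x 1) k < cnt (K (x 0)) k].
  case: (eqVneq j 0) => [j0|nj]; last first.
    by exists y; split => // j0; rewrite j0 in nj.
  have HnK k : n <= k -> cnt (x 1) k < cnt (K (x 0)) k.
    move=> nk; rewrite !cnt_all //; [exact: hs'| |by move=> a /H2; lia].
    by move=> a; rewrite mem_compl; lia.
  have Ks : sorted ltn (K (x 0)) by apply: sorted_compl.
  have K0 : 0 \notin K (x 0) by rewrite mem_compl.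
  have [z [_ zA zD _ Hz]] :=
    codefect_exists (sorted_uniq ltn_trans ltnn Ks) (wf_uniq _ w) K0 hK HnK.
  move: zA; rewrite mem_compl => /andP[zn _].
  exists (maxn y z); split.
  - exact: leq_maxl.
  - by rewrite j0 in yD *; rewrite /maxn; case: ifP.
  - by rewrite /maxn; case: ifP.
  - by move=> _ k; rewrite geq_max => /andP[_ /Hz].
exists b; split => //; apply/highest_upd; split.
- move=> k; rewrite cnt_addc //; have := hc j k.
  by case: (leqP b k) => bk; [have := Hy k (leq_trans yb bk)|]; lia.
- by move=> k; rewrite cnt_addc //; apply: leq_trans (hc j.+1 k) (leq_addr _ _).
- by move=> i _ _; apply: hc.
- case: (eqVneq j 0) => [j0|//] k.
  rewrite cnt_addc // j0; have := hK k.
  by case: (leqP b k) => bk; [have := hb j0 k bk|]; lia.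
Qed.

Hypothesis N1 : 1 < N.

(** Let [y] be the defect against the first column and [z] the one against its complement. Moving
    [y] takes it away from column 1 and from the complement at once, so the comparison of these two
    is unchanged and [z] remains a defect exactly if it was one. The two letters differ, since [z]
    lies in the first column and [y] does not. If both move, the first column gains [y] and loses
    [z], while column 1 has lost two letters for one surplus. *)
Lemma added_step0 x : wf x -> added 1 x -> dom (x 0) (x 1) \/
  exists x1, [/\ step 0 x x1, chain x1 &
    dom (K (x 0)) (x 1) /\ highest x1 \/
    exists2 x2, step 0 (cpl x1) x2 & removed 1 x2].
Proof.
move=> w [Hd [a aD /highest_upd[h1 h2 h3 h4]]]; have [H1 H2 _] := w.
rewrite /= in h4.
have Hk k : cnt (x 1) k <= (cnt (x 0) k).+1.
  by move: (added_count (H1 _) aD h1 k); clear; case: (a <= k); lia.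
have Hk' k : cnt (x 1) k <= (cnt (K (x 0)) k).+1.
  by move: (added_count (H1 _) aD h4 k); clear; case: (a <= k); lia.
have [|[y d]] := defect_exists (H1 _) Hk; [by left | right].
have ay := defect_ge (H1 _) aD h1 d.
have [yD yA] := defect_mem (wf_uniq _ w) (wf_uniq _ w) d.
have yn := H2 _ _ yD.
have yK : y \in K (x 0) by rewrite mem_compl yn.
have Ks : sorted ltn (K (x 0)) by apply: sorted_compl.
have [e1 e2 e3] := move_leftE 0 y x.
set x1 := move_left 0 y x in e1 e2 e3 *.
have s1 : step 0 x x1 by apply: move_left_step.
have c1 : chain x1.
  by apply: (chain_move_left (a := a)) => // i i1; apply: h3; lia.
exists x1; split => //; have [HK|[z dz]] := defect_exists (H1 _) Hk'.
  left; split => //; split => //; rewrite e1 e2 compl_addc // => k.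
  by move: (cnt_remc k Ks yK) (cnt_remc k (H1 _) yD) (HK k); clear; lia.
right.
have az := defect_ge (H1 _) aD h4 dz.
have [zD zK] := defect_mem (sorted_uniq ltn_trans ltnn Ks) (wf_uniq 1 w) dz.
have zn := H2 _ _ zD.
have zA : z \in x 0 by move: zK; rewrite mem_compl zn /= negbK.
have zy : z != y by apply: contraNneq yA => <-.
have cK k := cnt_remc k Ks yK.
have cD k := cnt_remc k (H1 _) yD.
have dz' : defect (cpl x1 0) (cpl x1 1) z.
  rewrite cpl0 cplS e1 e2 compl_addc //; have [b1 b2 b3] := dz; split.
  - by move: b1 (cK z) (cD z); clear; lia.
  - by move=> k kz; move: (b2 k kz) (cK k) (cD k); clear; lia.
  - by move=> k; move: (b3 k) (cK k) (cD k); clear; lia.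
have [f1 f2 f3] := move_leftE 0 z (cpl x1).
exists (move_left 0 z (cpl x1)); first exact: move_left_step.
rewrite cpl0 e1 compl_addc // in f1; rewrite cplS e2 in f2.
have zD' : z \in remc y (x 1) by rewrite mem_remc zy.
have cD2 k := cnt_remc k (sorted_remc y (H1 1)) zD'.
(* Restoring the larger of the two lost letters keeps the counts of column 1 between [y] and [z] low
   enough for the first column and for its complement. It leaves the smaller one missing, which is
   at least [a], so that column 2 is still dominated. *)
set w0 := maxn y z.
have w0D : w0 \notin remc z (remc y (x 1)).
  by rewrite !mem_remc /w0 maxnE; apply/negP => /and3P[]; clear; lia.
exists w0; rewrite f2; split => //; first by move: yn zn; rewrite /w0; clear; lia.
apply/highest_upd; rewrite /= f1; split.
- move=> k; have [b1 b2 b3] := dz.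
  have zK' : z \notin remc y (K (x 0)) by rewrite mem_remc negb_and zK orbT.
  rewrite !cnt_addc //; move: (cD2 k) (cD k) (cK k) (b3 k); rewrite /w0.
  by case: (ltnP k z) => kz; [move: kz (b2 k kz) | move: kz]; clear; lia.
- rewrite f3 // cplS e3 // => k; rewrite cnt_addc //.
  have := cD2 k; have := cD k; have := cnt_remc k (H1 _) aD; have := h2 k; have := Hd k.
  by rewrite /w0; move: ay az; clear; lia.
- by move=> [|[|i]] // _ _; rewrite !f3 // !cplS !e3 //; apply: h3.
- rewrite compl_addc; last exact: sorted_remc.
  rewrite compl_remc // wf_complK // => k; have [b1 b2 b3] := d.
  have zA' : z \in addc y (x 0) by rewrite mem_addc zA orbT.
  have := cnt_remc k (sorted_addc y (H1 0)) zA'.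
  rewrite !cnt_addc //; move: (cD2 k) (cD k) (b3 k); rewrite /w0.
  by case: (ltnP k y) => kz; [move: kz (b2 k kz) | move: kz]; clear; lia.
Qed.

Lemma added_back0 x : wf x -> highest x -> size (x 1) < size (x 0) ->
  exists x', [/\ wf x', step 0 x' x, added 1 x' & dom (K (x' 0)) (x' 1)].
Proof.
move=> w [hc hK] hs; have [H1 H2 _] := w.
have Hn k : n <= k -> cnt (x 1) k < cnt (x 0) k.
  by move=> nk; rewrite !cnt_all // => a /H2; lia.
have [y [yw yA yD yn [Hy wz sz]]] := move_right_step w N1 (hc 0) Hn.
have [e1 e2 e3] := move_rightE 0 y x.
have yK : y \notin K (x 0) by rewrite mem_compl yA andbF.
have eK : K (remc y (x 0)) = addc y (K (x 0)) by apply: compl_remc.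
exists (move_right 0 y x); split => //.
  split.
    rewrite e2 e3 // => k; rewrite cnt_addc //.
    exact: leq_trans (hc 1 k) (leq_addr _ _).
  exists y; first by rewrite e2 mem_addc eqxx.
  apply/highest_upd; rewrite /= e1 e2 addcK // e3 //; split.
  - move=> k; have := cnt_remc k (H1 _) yA; have := hc 0 k.
    by case: (leqP y k) => [/Hy|]; lia.
  - exact: hc.
  - by move=> [|[|i]] // _ _; rewrite !e3.
  - by rewrite eK => k; rewrite cnt_addc //; apply: leq_trans (hK k) (leq_addr _ _).
by rewrite e1 e2 eK => k; rewrite !cnt_addc // leq_add2r.
Qed.

(** Both moves are undone in the opposite order: [z] leaves the first column, then [y] leaves its
    complement. Of the two letters that enter column 1 the smaller one is declared the surplus,
    dually to the choice of the larger one in [added_step0]. *)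
Lemma removed_back0 x : wf x -> removed 1 x ->
  exists x1 x', [/\ wf x1, wf x', step 0 (cpl x1) x, step 0 x' x1
    & added 1 x' /\ chain x1].
Proof.
move=> w [b [bD bn /highest_upd[h1 h2 h3 h4]]]; have [H1 H2 _] := w.
rewrite /= in h4.
have hd : dom (x 0) (x 1).
  by move=> k; apply: leq_trans (h1 k); rewrite cnt_addc // leq_addr.
have Hb k : b <= k -> cnt (x 1) k < cnt (x 0) k.
  by move=> bk; have := h1 k; rewrite cnt_addc // bk; lia.
have [z [zb zA zD zn [Hz wz sz]]] := move_right_step w N1 hd Hb.
have [e1 e2 e3] := move_rightE 0 z x.
set c := move_right 0 z x in e1 e2 e3 wz sz.
have N0 : 0 < N by lia.
have wx1 : wf (cpl c) by apply: wf_cpl.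
have zK : z \notin K (x 0) by rewrite mem_compl zA andbF.
have f1 : cpl c 0 = addc z (K (x 0)) by rewrite cpl0 e1 compl_remc.
have f2 : cpl c 1 = addc z (x 1) by rewrite cplS e2.
have hd1 : dom (cpl c 0) (cpl c 1).
  by rewrite f1 f2 => k; rewrite !cnt_addc // leq_add2r; have := h4 k; rewrite cnt_addc //; lia.
have Hb1 k : b <= k -> cnt (cpl c 1) k < cnt (cpl c 0) k.
  by move=> bk; rewrite f1 f2 !cnt_addc // ltn_add2r; have := h4 k; rewrite cnt_addc // bk; lia.
have [y [yb yA yD yn [Hy wy sy]]] := move_right_step wx1 N1 hd1 Hb1.
have [g1 g2 g3] := move_rightE 0 y (cpl c).
rewrite f1 mem_addc in yA; rewrite f2 mem_addc negb_or in yD.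
have [yz yD'] := andP yD; rewrite (negbTE yz) /= in yA.
rewrite f1 in g1; rewrite f2 in g2.
have Ks : sorted ltn (K (x 0)) by apply: sorted_compl.
have yz1 : y \in addc z (K (x 0)) by rewrite mem_addc yA orbT.
have yz2 : y \notin addc z (x 1) by rewrite mem_addc negb_or yz.
have Hy' k : y <= k -> cnt (x 1) k < cnt (K (x 0)) k.
  by move=> /Hy; rewrite f1 f2 !cnt_addc // ltn_add2r.
have h4' k : cnt (x 1) k + (b <= k) <= cnt (K (x 0)) k by rewrite -cnt_addc.
have h2' k : cnt (x 2) k <= cnt (x 1) k + (b <= k) by rewrite -cnt_addc.
exists (cpl c), (move_right 0 y (cpl c)); split => //.
  by apply: step_ext sz => i; rewrite (cplK wz).
split; last first.
  case=> [|[|i]] //; rewrite ?f2 !cplS !e3 //; last by apply: h3.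
  by move=> k; have := h2' k; rewrite cnt_addc //; move: zb; clear; lia.
split.
  rewrite g2 g3 // cplS e3 // => k; rewrite !cnt_addc //; have := h2' k.
  by move: yb; clear; lia.
pose a := minn y z.
have aD : a \in addc y (addc z (x 1)).
  by rewrite !mem_addc /a /minn; case: ltnP; rewrite eqxx ?orbT.
have sD : sorted ltn (addc y (addc z (x 1))) by do 2![apply: sorted_addc].
have ca k := cnt_remc k sD aD.
exists a; first by rewrite g2.
apply/highest_upd; rewrite /= g2 g1 g3 // cplS e3 //; split.
- move=> k; have := ca k; have := cnt_remc k (sorted_addc z Ks) yz1.
  rewrite !cnt_addc //; have := h4' k.
  by rewrite /a; case: (leqP y k) => yk; [move: yk (Hy' k yk) | move: yk]; clear; lia.
- move=> k; have := ca k; rewrite !cnt_addc //; have := h2' k.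
  by rewrite /a; move: yb zb; clear; lia.
- by move=> [|[|i]] // _ _; rewrite !g3 // !cplS !e3 //; apply: h3.
- rewrite compl_remc //; last exact: sorted_addc.
  rewrite compl_addc // wf_complK // => k; have := ca k.
  have yA' : y \notin remc z (x 0).
    by move: yA; rewrite mem_compl mem_remc => /andP[_ /negbTE ->]; rewrite andbF.
  rewrite !cnt_addc //; have := cnt_remc k (H1 0) zA; have := hd k.
  by rewrite /a; case: (leqP z k) => zk; [move: zk (Hz k zk) | move: zk]; clear; lia.
Qed.

End FirstColumn.

(** * Sequences of moves and the four possible outcomes *)

Section Outcomes.
Variables n N : nat.
Implicit Types (x z S : config) (d : nat -> nat) (l : seq nat).
Local Notation wf := (wf n N).
Local Notation highest := (highest n).
Local Notation added := (added n).
Local Notation removed := (removed n).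
Local Notation K := (compl_column n).
Local Notation cpl := (cpl n).

Fixpoint steps l x x'' : Prop :=
  if l is s :: l' then exists2 x', step s x x' & steps l' x' x'' else x = x''.

Lemma steps_rcons l s x x'' :
  steps (rcons l s) x x'' <-> exists2 x', steps l x x' & step s x' x''.
Proof.
elim: l x => [|t l IH] x /=.
  by split=> [[x' h <-]|[x' <- h]]; [exists x | exists x''].
split=> [[x' h /IH[x1 h1 h2]]|[x1 [x' h h1] h2]].
  by exists x1 => //; exists x'.
by exists x' => //; apply/IH; exists x1.
Qed.

Lemma steps_wf l x x' : wf x -> all (fun s => s.+1 < N) l -> steps l x x' -> wf x'.
Proof.
elim: l x => [|s l IH] x w /=; first by move=> _ <-.
by move=> /andP[sN H] [x1 h]; apply: IH => //; apply: step_wf w sN h.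
Qed.

Lemma steps_knuth l x x' : wf x -> all (fun s => s.+1 < N) l -> steps l x x' ->
  knuth (cword N x) (cword N x').
Proof.
elim: l x => [|s l IH] x w /=; first by move=> _ <-; apply: Knuth_refl.
move=> /andP[sN H] [x1 h h1]; apply: Knuth_trans (step_knuth w sN h) _.
by apply: IH => //; apply: step_wf w sN h.
Qed.

Lemma steps_inj l x x' z z' : wf x -> wf z -> all (fun s => s.+1 < N) l ->
  x' =1 z' -> steps l x x' -> steps l z z' -> x =1 z.
Proof.
elim: l x z => [|s l IH] x z wx wz /=; first by move=> _ E -> ->.
move=> /andP[sN H] E [x1 h h1] [z1 k k1]; apply: (step_inj wx wz _ h k).
by apply: (IH x1 z1) => //; [apply: step_wf h | apply: step_wf k].
Qed.

(** The move with index s acts between columns s and s + 1. Hence J - 1, ..., j carry a surplus from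
    column J to column j, and the indices 1, ..., k - 1 of [up k] carry a deficiency from column 1
    to column k. *)
Definition down J j := rev (iota j (J - j)).
Definition up k := iota 1 k.-1.

Lemma downn J : down J J = [::].
Proof. by rewrite /down subnn. Qed.

Lemma downS J j : j <= J -> down J.+1 j = J :: down J j.
Proof.
by move=> jJ; rewrite /down subSn // -addn1 iotaD /= rev_cat /= subnKC.
Qed.

Lemma upS k : 0 < k -> up k.+1 = rcons (up k) k.
Proof.
by move=> k0; rewrite /up -cats1 -{1}(prednK k0) -[k.-1.+1]addn1 iotaD add1n prednK.
Qed.

Lemma down_lt J j : J < N -> all (fun s => s.+1 < N) (down J j).
Proof. by move=> JN; rewrite all_rev; apply/allP => s; rewrite mem_iota; lia. Qed.

Lemma up_lt k : k < N -> all (fun s => s.+1 < N) (up k).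
Proof. by move=> kN; apply/allP => s; rewrite mem_iota; lia. Qed.

Lemma down_forward J x : wf x -> J.+1 < N -> added J.+1 x ->
  exists j x', [/\ 0 < j <= J.+1, steps (down J.+1 j) x x', added j x'
                 & highest x' \/ j = 1].
Proof.
elim: J x => [|J IH] x w JN ha.
  by exists 1, x; split => //; right.
have [hd|[x1 h1 ha1]] := added_step w ha.
  exists J.+2, x; split => //; [by rewrite leqnn | by rewrite downn |].
  by left; apply: added_highest ha hd _.
have [j [x' [j1 j2 j3 j4]]] := IH x1 (step_wf w JN h1) (ltnW JN) ha1.
exists j, x'; split => //; first by lia.
by rewrite downS; [exists x1 | lia].
Qed.

Lemma down_backward J j x' : wf x' -> J < N -> 0 < j <= J -> added j x' ->
  exists x, [/\ wf x, added J x & steps (down J j) x x'].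
Proof.
elim: J => [|J IH] w JN Hj ha; first by lia.
case: (ltngtP j J.+1) => [jJ|jJ|eJ]; [|lia|]; last first.
  by exists x'; rewrite -eJ; split => //; rewrite downn.
have [x [wx ax sx]] : exists x, [/\ wf x, added J x & steps (down J j) x x'].
  by apply: IH => //; lia.
case: J IH JN Hj jJ ax sx => [|J] IH JN Hj jJ ax sx; first by lia.
have [z [wz sz az]] := added_back wx JN ax.
by exists z; split => //; rewrite downS; [exists x | lia].
Qed.

Lemma up_forward j x : wf x -> j.+1 < N -> removed j.+1 x -> exists k x',
  [/\ j < k < N, steps (iota j.+1 (k - j.+1)) x x', removed k x' & highest x'].
Proof.
move: {2}(N - j) (leqnn (N - j)) => b.
elim: b j x => [|b IH] j x Hb w jN hr; first by lia.
have [hd|[x1 h1 hr1]] := removed_step w hr.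
  exists j.+1, x; split => //; [lia | by rewrite subnn | exact: removed_highest hr hd].
(* A defect requires an entry in the right-hand column, and the columns from [N] on are empty: the
   deficiency stops before it leaves the range. *)
have jN' : j.+2 < N.
  rewrite ltnNge; apply/negP => H; have [_ _ H3] := w.
  by have [y [dy _ _ _]] := h1; apply: (defect_ndom dy); rewrite (H3 j.+2).
have [|k [x' [k1 k2 k3 k4]]] := IH j.+1 x1 _ (step_wf w jN' h1) jN' hr1; first by lia.
exists k, x'; split => //; first by lia.
have -> : k - j.+1 = (k - j.+2).+1 by lia.
by exists x1.
Qed.

Lemma up_backward k x' : wf x' -> 0 < k < N -> removed k x' ->
  exists x, [/\ wf x, removed 1 x & steps (up k) x x'].
Proof.
elim: k x' => [|k IH] x' w Hk hr; first by lia.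
case: k IH Hk hr => [|k] IH Hk hr; first by exists x'.
have [z [wz sz rz]] := removed_back w (proj2 (andP Hk)) hr.
have [|x [wx rx sx]] := IH z wz _ rz; first by lia.
by exists x; split => //; rewrite upS //; apply/steps_rcons; exists z.
Qed.

Lemma steps_wf_down J j x x' : J < N -> wf x -> steps (down J j) x x' -> wf x'.
Proof. by move=> JN w; apply: steps_wf w (down_lt _ JN). Qed.

Lemma cpl_inj x z : wf x -> wf z -> cpl x =1 cpl z -> x =1 z.
Proof.
move=> wx wz E [|i]; last exact: (E i.+1).
by rewrite -(wf_complK wx) -(wf_complK wz); congr compl_column; apply: (E 0).
Qed.

Definition plus_box d j x := forall i, size (x i) = d i + (i == j).
Definition minus_box d j x := forall i, size (x i) + (i == j) = d i.

Lemma plus_box_step d s x x' : wf x -> step s x x' ->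
  plus_box d s.+1 x <-> plus_box d s x'.
Proof.
move=> w h; have [e1 e2] := step_size w h; have [y [_ _ _ e3]] := h.
move=> {h}; split=> H i; move: (H s) (H s.+1) (H i);
 (case: (eqVneq i s) => [->|i1]; first lia);
 (case: (eqVneq i s.+1) => [->|i2]; first lia); rewrite (e3 i i1 i2); lia.
Qed.

Lemma minus_box_step d s x x' : wf x -> step s x x' ->
  minus_box d s x <-> minus_box d s.+1 x'.
Proof.
move=> w h; have [e1 e2] := step_size w h; have [y [_ _ _ e3]] := h.
move=> {h}; split=> H i; move: (H s) (H s.+1) (H i);
 (case: (eqVneq i s) => [->|i1]; first lia);
 (case: (eqVneq i s.+1) => [->|i2]; first lia); rewrite (e3 i i1 i2); lia.
Qed.

Lemma plus_box_down d J j x x' : wf x -> J < N -> j <= J -> steps (down J j) x x' ->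
  plus_box d J x <-> plus_box d j x'.
Proof.
elim: J x => [|J IH] x w JN jJ.
  by rewrite /down sub0n /= => ->; rewrite (_ : j = 0) //; lia.
case: (ltngtP j J.+1) jJ => [jJ _|//|-> _]; last by rewrite downn /= => ->.
rewrite downS // => -[x1 h1 h2]; have w1 := step_wf w JN h1.
by apply: (iff_trans (plus_box_step d w h1)); apply: IH => //; lia.
Qed.

Lemma minus_box_up d k x x' : wf x -> 0 < k < N -> steps (up k) x x' ->
  minus_box d 1 x <-> minus_box d k x'.
Proof.
elim: k x' => [|k IH] x' w; first by lia.
case: k IH => [|k] IH kN; first by move=> /= ->.
rewrite upS // => /steps_rcons[x1 h1 h2].
have w1 : wf x1 by apply: (steps_wf w _ h1); apply: up_lt; lia.
apply: (iff_trans (IH x1 w _ h1)); first by lia.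
exact: minus_box_step.
Qed.

Definition cpl_len d i := if i == 0 then n - d 0 else d i.

Lemma size_cpl0 x : wf x -> size (cpl x 0) + size (x 0) = n.
Proof. by move=> w; have [_ H2 _] := w; apply: size_compl (wf_uniq 0 w) (H2 0). Qed.

Lemma plus_box_cpl d j x : wf x -> 0 < j -> d 0 <= n ->
  plus_box d j x <-> plus_box (cpl_len d) j (cpl x).
Proof.
move=> w j0 dn; have s0 := size_cpl0 w; rewrite /cpl_len.
by split=> H [|i]; [move: (H 0) | move: (H i.+1) | move: (H 0) | move: (H i.+1)];
  rewrite ?cplS /=; lia.
Qed.

(** A box gained by the first column is a box lost by its complement. This is where a surplus coming
    in turns into a deficiency going out. *)
Lemma minus_box_cpl d x : wf x -> d 0 < n ->
  plus_box d 0 x <-> minus_box (cpl_len d) 0 (cpl x).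
Proof.
move=> w dn; have s0 := size_cpl0 w; rewrite /cpl_len.
by split=> H [|i]; [move: (H 0) | move: (H i.+1) | move: (H 0) | move: (H i.+1)];
  rewrite ?cplS /=; lia.
Qed.

Definition out_plus J j x S := 0 < j <= J /\ steps (down J j) x S.

Lemma out_plus_inj J j x z S S' : J < N -> wf x -> wf z -> S =1 S' ->
  out_plus J j x S -> out_plus J j z S' -> x =1 z.
Proof.
by move=> JN wx wz E [_ h] [_ k]; apply: (steps_inj wx wz (down_lt _ JN) E h k).
Qed.

Hypothesis N1 : 1 < N.

Definition out_first_plus J x S := exists x1,
  [/\ steps (down J 1) x x1, step 0 x1 S & dom (K (x1 0)) (x1 1)].

Definition out_first_minus J x S := exists x1,
  [/\ steps (down J 1) x x1, step 0 (cpl x1) S & chain x1].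

Definition out_minus J k x S := exists x1 x2 x3,
  [/\ steps (down J 1) x x1, step 0 x1 x2, step 0 (cpl x2) x3, chain x2
    & 0 < k < N /\ steps (up k) x3 S].

Lemma added_chain x : added 1 x -> dom (x 0) (x 1) -> chain x.
Proof.
move=> [hd [a _ /highest_upd[h1 h2 h3 h4]]] h0 [|[|i]] //; exact: h3.
Qed.

(** The surplus stops in a column j > 0 or reaches column 1, where each of the two conditions on the
    first column may fail or hold: four combinations. The bound of m on the first column is not yet
    imposed on [S]. *)
Lemma outcome J x : wf x -> 0 < J < N -> added J x -> exists S,
  [/\ wf S, highest S
    & (exists j, out_plus J j x S) \/ out_first_plus J x S \/ out_first_minus J x S
                        \/ (exists k, out_minus J k x S)].
Proof.
case: J => // J w /= JN ha.
have N0 : 0 < N by lia.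
have [j [x1 [Hj s1 a1 h]]] := down_forward w JN ha.
have w1 := steps_wf w (down_lt _ JN) s1.
case: h => [h|j1].
  by exists x1; split => //; left; exists j.
rewrite j1 in Hj s1 a1.
have wc1 := wf_cpl N0 w1.
have [hd|[x2 [s2 c2 [[hK h2]|[x3 s3 r3]]]]] := added_step0 N1 w1 a1.
(* The condition against the first column holds; the one against the complement is examined by the
   same lemma, applied to the complemented configuration. *)
- have [hd'|[x2 [s2 c2 h2]]] := added_step0 N1 wc1 (added_cpl w1 a1).
    exists x1; split => //; last by left; exists 1.
    by split => //; apply: added_chain.
  exists x2; split; first exact: step_wf wc1 N1 s2.
    (* A second defect cannot occur: the moved letter leaves column 1 and the original first column
       at once, so the dominance between these two persists. *)
    case: h2 => [[] //|[x3 [y [dy _ _ _]] _]].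
    case: s2 => z [dz e1 e2 _]; case: (defect_ndom dy).
    rewrite cpl0 e1 cplS e2 cpl0 compl_addc; last exact: sorted_compl.
    rewrite (wf_complK w1); have [H1 H2 _] := w1.
    have [zD zA] := step_mem x2 wc1 dz.
    move: zA; rewrite cpl0 mem_compl (H2 _ _ zD) /= negbK => zA.
    move=> k; have := cnt_remc k (H1 0) zA.
    by move: (cnt_remc k (H1 1) zD) (hd k); rewrite cplS; clear; lia.
  by right; right; left; exists x1; split => //; apply: added_chain.
- exists x2; split => //; first exact: step_wf w1 N1 s2.
  by right; left; exists x1.
have w2 := step_wf w1 N1 s2.
have w3 := step_wf (wf_cpl N0 w2) N1 s3.
have [k [S [k1 k2 k3 k4]]] := up_forward w3 N1 r3.
exists S; split => //.
  by apply: (steps_wf w3 _ k2); apply/allP => s; rewrite mem_iota; lia.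
right; right; right; exists k, x1, x2, x3; split => //; split => //.
by rewrite /up -subn1.
Qed.

Lemma out_first_plus_inj J x z S S' : J < N -> wf x -> wf z -> S =1 S' ->
  out_first_plus J x S -> out_first_plus J z S' -> x =1 z.
Proof.
move=> JN wx wz E [x1 [h1 h2 _]] [z1 [k1 k2 _]].
apply: (steps_inj wx wz (down_lt _ JN) _ h1 k1).
exact: (step_inj (steps_wf_down JN wx h1) (steps_wf_down JN wz k1) E h2 k2).
Qed.

Lemma out_first_minus_inj J x z S S' : J < N -> wf x -> wf z -> S =1 S' ->
  out_first_minus J x S -> out_first_minus J z S' -> x =1 z.
Proof.
move=> JN wx wz E [x1 [h1 h2 _]] [z1 [k1 k2 _]].
have N0 : 0 < N by lia.
have w1 := steps_wf_down JN wx h1; have w2 := steps_wf_down JN wz k1.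
apply: (steps_inj wx wz (down_lt _ JN) _ h1 k1); apply: cpl_inj => //.
exact: (step_inj (wf_cpl N0 w1) (wf_cpl N0 w2) E h2 k2).
Qed.

Lemma out_minus_inj J k x z S S' : J < N -> wf x -> wf z -> S =1 S' ->
  out_minus J k x S -> out_minus J k z S' -> x =1 z.
Proof.
move=> JN wx wz E [x1 [x2 [x3 [h1 h2 h3 _ [/andP[_ kN] h4]]]]].
move=> [z1 [z2 [z3 [k1 k2 k3 _ [_ k4]]]]].
have N0 : 0 < N by lia.
have w1 := steps_wf_down JN wx h1; have v1 := steps_wf_down JN wz k1.
have w2 := step_wf w1 N1 h2; have v2 := step_wf v1 N1 k2.
have w3 := step_wf (wf_cpl N0 w2) N1 h3; have v3 := step_wf (wf_cpl N0 v2) N1 k3.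
apply: (steps_inj wx wz (down_lt _ JN) _ h1 k1).
apply: (step_inj w1 v1 _ h2 k2); apply: cpl_inj => //.
apply: (step_inj (wf_cpl N0 w2) (wf_cpl N0 v2) _ h3 k3).
exact: (steps_inj w3 v3 (up_lt kN) E h4 k4).
Qed.

End Outcomes.

(** * Tableaux and their columns *)

Definition decreasing (S : seq (seq nat)) : Prop := sorted geq (map size S).

Lemma decreasing_nth S i j : decreasing S -> i <= j ->
  size (nth [::] S j) <= size (nth [::] S i).
Proof.
move=> HS ij; case: (ltnP j (size S)) => jS; last by rewrite (nth_default _ jS).
have geq_trans : transitive geq by move=> a b c /= H1 H2; apply: leq_trans H2 H1.
have := sorted_leq_nth geq_trans leqnn 0 HS.
move=> /(_ i j); rewrite !inE size_map => /(_ (leq_ltn_trans ij jS) jS ij).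
by rewrite !(nth_map [::]) // (leq_ltn_trans ij jS).
Qed.

Lemma count_nth S i j : decreasing S ->
  (j < count (fun r => i < size r) S) = (i < size (nth [::] S j)).
Proof.
elim: S j => [|r S IH] j HS /=; first by rewrite nth_nil.
have HS' : decreasing S := path_sorted HS.
case: (ltnP i (size r)) => ir; first by case: j => [|j] /=; rewrite add1n ltnS ?ir // IH.
have E : count (fun r => i < size r) S = 0.
  apply/eqP; rewrite -leqn0 leqNgt -has_count; apply/hasPn => s sS /=.
  rewrite -leqNgt; apply: leq_trans ir; have [k kS <-] := nthP [::] sS.
  exact: (@decreasing_nth (r :: S) 0 k.+1).
rewrite E ltn0; apply/esym/negbTE; rewrite -leqNgt; apply: leq_trans ir.
exact: (@decreasing_nth (r :: S) 0 j).
Qed.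

Lemma size_column S i j : decreasing S ->
  (j < size (column S i)) = (i < size (nth [::] S j)).
Proof. by move=> HS; rewrite size_map size_filter count_nth. Qed.

Lemma columnE S i : decreasing S ->
  column S i = mkseq (fun j => nth 0 (nth [::] S j) i) (size (column S i)).
Proof.
rewrite /column /mkseq size_map; elim: S => [|r S IH] //= HS.
have HS' : decreasing S := path_sorted HS.
case: (ltnP i (size r)) => ir /=.
  rewrite IH //; congr (_ :: _).
  by rewrite -[1]/(1 + 0) iotaDl -map_comp size_filter -size_filter.
suff -> : [seq r <- S | i < size r] = [::] by [].
apply/eqP; rewrite -size_eq0 size_filter -leqn0 leqNgt -has_count.
apply/hasPn => s sS /=; rewrite -leqNgt; apply: leq_trans ir.
have [k kS <-] := nthP [::] sS; exact: (@decreasing_nth (r :: S) 0 k.+1).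
Qed.

Lemma nth_column S i j : decreasing S ->
  nth 0 (column S i) j = nth 0 (nth [::] S j) i.
Proof.
move=> HS; case: (ltnP j (size (column S i))) => H.
  by rewrite columnE // nth_mkseq.
rewrite (nth_default _ H); move: H; rewrite leqNgt size_column // -leqNgt => H.
by rewrite (nth_default _ H).
Qed.

Lemma column_default S i : decreasing S -> size (head [::] S) <= i -> column S i = [::].
Proof.
move=> HS H; apply: size0nil; apply/eqP; rewrite -leqn0 leqNgt size_column //.
by rewrite -leqNgt nth0.
Qed.

Lemma nth_columns S i : decreasing S -> nth [::] (columns S) i = column S i.
Proof.
move=> HS; case: (ltnP i (size (head [::] S))) => H.
  by rewrite (nth_map 0) ?size_iota // nth_iota.
by rewrite nth_default ?size_map ?size_iota // column_default.
Qed.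

Lemma decreasing_columns S : decreasing S -> decreasing (columns S).
Proof.
move=> HS; rewrite /decreasing; apply/(sortedP 0) => i; rewrite size_map => Hi.
rewrite !(nth_map [::]) // ?(ltnW Hi) // !nth_columns //.
rewrite /= leqNgt; apply/negP => H.
have := size_column i.+1 (size (column S i)) HS; rewrite H => /esym H'.
have := size_column i (size (column S i)) HS; rewrite ltnn => /esym/negbT.
by rewrite (ltn_trans (ltnSn i) H').
Qed.

Lemma columnK S j : decreasing S -> column (columns S) j = nth [::] S j.
Proof.
move=> HS; have HC := decreasing_columns HS; apply: (@eq_from_nth _ 0).
  apply/eqP; rewrite eqn_leq; apply/andP; split; rewrite leqNgt; apply/negP.
    by rewrite size_column // nth_columns // size_column // ltnn.
  move=> H; have : size (column (columns S) j) < size (nth [::] S j) := H.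
  by rewrite -size_column // -nth_columns // -size_column // ltnn.
by move=> i _; rewrite nth_column // nth_columns // nth_column.
Qed.

Lemma columnsK S : decreasing S -> 0 \notin map size S -> columns (columns S) = S.
Proof.
move=> HS H0; have E : size (columns (columns S)) = size S.
  rewrite size_map size_iota -nth0 nth_columns // size_map size_filter.
  apply/eqP; rewrite -all_count; apply/allP => r rS; rewrite lt0n.
  by apply: contraNneq H0 => <-; apply: map_f.
apply: (@eq_from_nth _ [::] _ _ E) => i _.
by rewrite nth_columns ?columnK //; apply: decreasing_columns.
Qed.

Lemma column_nseq S k j : column (S ++ nseq k [::]) j = column S j.
Proof.
by rewrite /column filter_cat (_ : filter _ (nseq _ _) = [::]) ?cats0 //; elim: k.
Qed.

Lemma columns_nseq S k : columns (S ++ nseq k [::]) = columns S.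
Proof.
rewrite /columns (eq_map (column_nseq S k)); congr (map _ (iota 0 (size _))).
by case: S => //; case: k.
Qed.

(** * The P-symbol of a column reading *)

Section Psymbol.

Fixpoint add_col (T : tableau) (c : seq nat) : tableau :=
  match T, c with
  | r :: T', a :: c' => rcons r a :: add_col T' c'
  | [::], a :: c' => [:: a] :: add_col [::] c'
  | _, [::] => T
  end.

Fixpoint fits (T : tableau) (c : seq nat) : bool :=
  match T, c with
  | r :: T', a :: c' => all (fun b => b <= a) r && fits T' c'
  | _, _ => true
  end.

Lemma find_all_leq r a s : all (fun b => b <= a) r ->
  find (fun y => a < y) (r ++ s) = size r + find (fun y => a < y) s.
Proof. by elim: r => //= b r IH /andP[ba H]; rewrite ltnNge ba /= IH. Qed.

(** In each row the entry of the last column is the first one that is larger than the incoming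
    letter. So [a] bumps the top of [c], that bumps the next entry, and the whole column moves down
    by one cell. *)
Lemma row_insert_add_col T c a : sorted ltn (a :: c) -> fits T (a :: c) ->
  row_insert (add_col T c) a = add_col T (a :: c).
Proof.
elim: T c a => [|r T IH] c a.
  elim: c a => [|b c IHc] a //= /andP[ab Hb] _.
  by rewrite ab /= IHc.
case: c => [_|b c] /=.
  move=> /andP[H _]; have := find_all_leq [::] H; rewrite cats0 addn0 => ->.
  by rewrite ltnn; case: T {IH}.
move=> /andP[ab Hb] /andP[H HT].
rewrite -cats1 find_all_leq //= ab addn0 size_cat addn1 leqnn.
rewrite nth_cat ltnn subnn /= IH //; congr (_ :: _).
by elim: r {H} => //= d r ->.
Qed.

Lemma fits_behead T a c : sorted ltn (a :: c) -> fits T (a :: c) -> fits T c.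
Proof.
elim: T a c => [|r T IH] a [|b c] //= /andP[ab Hb] /andP[/allP H HT].
rewrite (IH b) // andbT; apply/allP => d /H; lia.
Qed.

Lemma foldl_row_insert_column T c : sorted ltn c -> fits T c ->
  foldl row_insert T (rev c) = add_col T c.
Proof.
elim: c => [|a c IH] Hc HT; first by case: T HT.
rewrite rev_cons foldl_rcons IH; [|exact: path_sorted Hc|exact: fits_behead Hc HT].
exact: row_insert_add_col.
Qed.

Lemma nth_add_col T c i : nth [::] (add_col T c) i =
  nth [::] T i ++ (if i < size c then [:: nth 0 c i] else [::]).
Proof.
elim: T c i => [|r T IH] c i.
  elim: c i => [|a c IHc] [|i] //=; first by rewrite IHc nth_nil.
by case: c i => [|a c] [|i] //=; rewrite ?cats0 ?cats1 ?IH.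
Qed.

Lemma size_add_col T c : size (add_col T c) = maxn (size T) (size c).
Proof.
elim: T c => [|r T IH] c; first by elim: c => //= a c ->; rewrite !max0n.
by case: c => [|a c] /=; rewrite ?maxn0 // IH maxnSS.
Qed.

Lemma column_rcons S c i : column (rcons S c) i =
  column S i ++ (if i < size c then [:: nth 0 c i] else [::]).
Proof. by rewrite /column filter_rcons; case: ifP; rewrite ?map_rcons ?cats1 ?cats0. Qed.

Lemma decreasing_rcons S c : decreasing (rcons S c) -> decreasing S.
Proof. by rewrite /decreasing map_rcons -cats1 => /cat_sorted2[]. Qed.

Lemma add_col_columns S c : decreasing (rcons S c) ->
  add_col (columns S) c = columns (rcons S c).
Proof.
move=> HS; have HS' := decreasing_rcons HS; apply: (@eq_from_nth _ [::]).
  rewrite size_add_col !size_map !size_iota; case: S HS {HS'} => [|s S] HS /=.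
    by rewrite max0n.
  apply/maxn_idPl; have := @decreasing_nth _ 0 (size (s :: S)) HS isT.
  by rewrite nth_rcons ltnn eqxx.
by move=> i _; rewrite nth_add_col !nth_columns // column_rcons.
Qed.

Lemma fits_columns S c : decreasing S -> sorted ltn c ->
  (forall s, s \in S -> sorted ltn s /\ dom s c) -> fits (columns S) c.
Proof.
move=> HS Hc H.
suff F T d : (forall i, i < size d -> all (fun b => b <= nth 0 d i) (nth [::] T i)) -> fits T d.
  apply: F => i ic; rewrite nth_columns //; apply/allP => b /mapP[s].
  rewrite mem_filter => /andP[is_ sS] ->; have [s1 s2] := H _ sS.
  by have [_ ] := (domP s1 Hc).1 s2; apply.
elim: T d => [|r T IH] [|a d] //= HT; rewrite (HT 0) //=.
by apply: IH => i id; apply: (HT i.+1).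
Qed.

Lemma Psym_columns S : decreasing S -> all (sorted ltn) S ->
  (forall i j, i <= j -> dom (nth [::] S i) (nth [::] S j)) ->
  Psym (flatten [seq rev c | c <- S]) = columns S.
Proof.
elim/last_ind: S => [|S c IH] // HS; rewrite all_rcons => /andP[Hc HSs] Hd.
have HS' := decreasing_rcons HS.
rewrite map_rcons flatten_rcons /Psym foldl_cat -/(Psym _) IH //; last first.
  move=> i j ij; case: (ltnP j (size S)) => jS; last first.
    by rewrite (nth_default _ jS); apply: dom_nil.
  by have := Hd i j ij; rewrite !nth_rcons jS (leq_ltn_trans ij jS).
rewrite foldl_row_insert_column // ?add_col_columns //.
apply: fits_columns => // s sS; split; first exact: (allP HSs).
have [k kS <-] := nthP [::] sS; have := Hd k (size S) (ltnW kS).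
by rewrite !nth_rcons kS ltnn eqxx.
Qed.

End Psymbol.

(** * Tableaux as configurations of columns *)

Section Tableaux.
Variables n N : nat.
Hypothesis N0 : 0 < N.
Implicit Types (x : config) (T : tableau).
Local Notation wf := (wf n N).

Definition tab x : tableau := columns (mkseq x N).

Lemma chain_size x i j : wf x -> chain x -> i <= j -> size (x j) <= size (x i).
Proof.
move=> [H1 _ _] hc /subnKC <-; elim: (j - i) => [|k IH]; first by rewrite addn0.
by rewrite addnS; apply: leq_trans IH; apply: dom_size.
Qed.

Lemma chain_dom x i j : chain x -> i <= j -> dom (x i) (x j).
Proof.
move=> hc /subnKC <-; elim: (j - i) => [|k IH]; first by rewrite addn0; apply: dom_refl.
by rewrite addnS; apply: dom_trans IH _; apply: hc.
Qed.

Lemma nth_mkseq_wf x j : wf x -> nth [::] (mkseq x N) j = x j.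
Proof.
move=> [_ _ H]; case: (ltnP j N) => jN; first by rewrite nth_mkseq.
by rewrite nth_default ?size_mkseq // H.
Qed.

Lemma decreasing_mkseq x : wf x -> chain x -> decreasing (mkseq x N).
Proof.
move=> w hc; apply/(sortedP 0) => i; rewrite size_map size_mkseq => Hi.
rewrite !(nth_map [::]) ?size_mkseq // ?(ltnW Hi) // !nth_mkseq // ?(ltnW Hi) //.
exact: chain_size.
Qed.

Lemma column_tab x j : wf x -> chain x -> column (tab x) j = x j.
Proof. by move=> w hc; rewrite columnK ?nth_mkseq_wf //; apply: decreasing_mkseq. Qed.

Lemma decreasing_tab x : wf x -> chain x -> decreasing (tab x).
Proof. by move=> w hc; apply/decreasing_columns/decreasing_mkseq. Qed.

Lemma head_mkseq x : head [::] (mkseq x N) = x 0.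
Proof. by rewrite -nth0 nth_mkseq. Qed.

Lemma size_tab x : size (tab x) = size (x 0).
Proof. by rewrite size_map size_iota head_mkseq. Qed.

Lemma nth_tab x i : wf x -> chain x -> nth [::] (tab x) i = column (mkseq x N) i.
Proof. by move=> w hc; rewrite nth_columns //; apply: decreasing_mkseq. Qed.

Lemma notin_shape_tab x : wf x -> chain x -> 0 \notin shape (tab x).
Proof.
move=> w hc; apply/negP => /(nthP 0)[i]; rewrite size_map size_tab => Hi.
rewrite (nth_map [::]) ?size_tab // nth_tab // => E.
have := size_column i 0 (decreasing_mkseq w hc).
by rewrite E nth_mkseq_wf // Hi.
Qed.

Lemma is_sst_tab x : wf x -> chain x -> is_sst n (tab x).
Proof.
move=> w hc; have D := decreasing_mkseq w hc; have [H1 H2 _] := w.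
apply/and3P; split.
- by rewrite /is_part notin_shape_tab // andbT; apply: decreasing_tab.
- apply/(all_nthP [::]) => i; rewrite size_tab => Hi; rewrite nth_tab //.
  apply/andP; split.
    apply/(sortedP 0) => j Hj; rewrite !nth_column // !nth_mkseq_wf //.
    move: Hj; rewrite size_column // nth_mkseq_wf // => Hj.
    by have [_] := (domP (H1 j) (H1 j.+1)).1 (hc j); apply.
  apply/(all_nthP 0) => j Hj; rewrite nth_column // nth_mkseq_wf //.
  by apply: (H2 j); apply: mem_nth; move: Hj; rewrite size_column // nth_mkseq_wf.
- by apply/allP => c /mapP[j _ ->]; rewrite column_tab.
Qed.

Lemma cword_mkseq x : cword N x = flatten [seq rev c | c <- mkseq x N].
Proof. by rewrite /cword /mkseq -map_comp. Qed.

Lemma Psym_cword x : wf x -> chain x -> Psym (cword N x) = tab x.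
Proof.
move=> w hc; have [H1 _ _] := w; rewrite cword_mkseq Psym_columns //.
- exact: decreasing_mkseq.
- by apply/allP => c /mapP[j _ ->].
- by move=> i j ij; rewrite !nth_mkseq_wf //; apply: chain_dom.
Qed.

Lemma tab_ext x x' : x =1 x' -> tab x = tab x'.
Proof. by move=> E; rewrite /tab /mkseq (eq_map E). Qed.

Lemma sst_decreasing T : is_sst n T -> decreasing T.
Proof. by case/and3P=> /andP[]. Qed.

Lemma sst_notin_shape T : is_sst n T -> 0 \notin shape T.
Proof. by case/and3P=> /andP[]. Qed.

Lemma mkseq_column T : decreasing T -> size (head [::] T) <= N ->
  mkseq (column T) N = columns T ++ nseq (N - size (head [::] T)) [::].
Proof.
move=> D H; rewrite /mkseq -{1}(subnKC H) iotaD map_cat add0n; congr (_ ++ _).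
apply: (@eq_from_nth _ [::]); first by rewrite size_map size_iota size_nseq.
move=> i; rewrite size_map size_iota => Hi; rewrite nth_nseq Hi.
by rewrite (nth_map 0) ?size_iota // nth_iota // column_default // leq_addr.
Qed.

Lemma tab_column T : is_sst n T -> size (head [::] T) <= N -> tab (column T) = T.
Proof.
move=> sT H; have D := sst_decreasing sT.
rewrite /tab mkseq_column // columns_nseq columnsK //; exact: sst_notin_shape sT.
Qed.

Lemma wf_column T : is_sst n T -> size (head [::] T) <= N -> wf (column T).
Proof.
move=> sT H; have D := sst_decreasing sT; have /and3P[_ /allP R /allP C] := sT; split.
- move=> j; case: (ltnP j (size (head [::] T))) => Hj.
    by apply: C; apply: map_f; rewrite mem_iota.
  by rewrite column_default.
- move=> j a /mapP[r]; rewrite mem_filter => /andP[jr rT] ->.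
  by have /andP[_ /allP] := R _ rT; apply; apply: mem_nth.
- by move=> j Hj; rewrite column_default //; apply: leq_trans Hj.
Qed.

Lemma chain_column T : is_sst n T -> chain (column T).
Proof.
move=> sT j; have D := sst_decreasing sT; have /and3P[_ /allP R /allP C] := sT.
have Cs i : sorted ltn (column T i).
  case: (ltnP i (size (head [::] T))) => Hj.
    by apply: C; apply: map_f; rewrite mem_iota.
  by rewrite column_default.
apply/domP => //; split.
  rewrite leqNgt; apply/negP => H; have := ltnn (size (column T j)).
  by rewrite size_column // ltnW // -size_column.
move=> i Hi; rewrite !nth_column //.
have iT : i < size T by apply: leq_trans Hi _; rewrite size_map size_filter count_size.
have /andP[Rs _] := R _ (mem_nth [::] iT).
by apply: sorted_leq_nthP => //; rewrite -size_column.
Qed.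

Lemma flatten_map_nil (f : nat -> seq nat) s :
  (forall j, j \in s -> f j = [::]) -> flatten [seq rev (f j) | j <- s] = [::].
Proof.
elim: s => //= a s IH H; rewrite H ?mem_head // IH // => j js.
by apply: H; rewrite in_cons js orbT.
Qed.

Lemma flatten_cut (f : nat -> seq nat) a k l : l <= k ->
  (forall j, a + l <= j -> f j = [::]) ->
  flatten [seq rev (f j) | j <- iota a k] = flatten [seq rev (f j) | j <- iota a l].
Proof.
move=> lk H; rewrite -{1}(subnKC lk) iotaD map_cat flatten_cat.
rewrite [X in _ ++ X]flatten_map_nil ?cats0 // => j; rewrite mem_iota => /andP[H1 _].
exact: H.
Qed.

Lemma CR_cword T : is_sst n T -> size (head [::] T) <= N -> CR T = cword N (column T).
Proof.
move=> sT H; have D := sst_decreasing sT.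
rewrite /CR /columns -map_comp /cword (@flatten_cut _ 0 N (size (head [::] T))) //.
by move=> j; rewrite add0n => /(column_default D).
Qed.

Lemma CR_tab x : wf x -> chain x -> CR (tab x) = cword N x.
Proof.
move=> w hc; have st := is_sst_tab w hc.
have [_ _ H3] := w.
rewrite CR_cword //; first by apply: cword_ext => j; apply: column_tab.
rewrite -nth0 nth_tab // size_map size_filter.
by apply: leq_trans (count_size _ _) _; rewrite size_mkseq.
Qed.

Lemma K1_cword T : is_sst n T -> size (head [::] T) <= N ->
  K1 n T = Psym (cword N (cpl n (column T))).
Proof.
move=> sT H; have D := sst_decreasing sT; rewrite /K1; congr Psym.
have -> : head [::] (columns T) = column T 0 by rewrite -nth0 nth_columns.
rewrite /cword -[in RHS](prednK N0) /=; congr (rev _ ++ _).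
have -> : [seq rev (cpl n (column T) j) | j <- iota 1 N.-1] =
          [seq rev (column T j) | j <- iota 1 N.-1].
  by apply/eq_in_map => j; rewrite mem_iota => /andP[j1 _]; rewrite /cpl upd_neq // -lt0n.
rewrite (flatten_cut (l := (size (head [::] T)).-1)).
- by rewrite /columns; case: (size _) => //= s; rewrite -map_comp.
- by move: H; case: (size _) => //= s; lia.
- by move=> j Hj; apply: column_default => //; move: Hj; lia.
Qed.

Lemma K1_tab x : wf x -> chain x -> K1 n (tab x) = Psym (cword N (cpl n x)).
Proof.
move=> w hc; have st := is_sst_tab w hc.
rewrite K1_cword //.
  congr Psym; apply: cword_ext => j; rewrite /cpl /upd column_tab //.
  by case: eqP => // _; rewrite column_tab.
rewrite -nth0 nth_tab // size_map size_filter.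
by apply: leq_trans (count_size _ _) _; rewrite size_mkseq.
Qed.

(** The definition compares entries only as far as the second column reaches. That the complement is
    long enough for [dom] follows from d_2 <= d_1 <= m <= n - d_1. *)
Lemma is_AI_highest T : is_sst n T -> size (head [::] T) <= N ->
  is_AI n T <-> size (column T 0) <= n./2 /\ highest n (column T).
Proof.
move=> sT H; have w := wf_column sT H; have hc := chain_column sT.
have [H1 H2 _] := w; rewrite /is_AI sT /=.
have sK := size_compl (wf_uniq 0 w) (H2 0).
have dK := domP (sorted_compl n (column T 0)) (H1 1).
split.
  move=> /andP[sz /allP AI]; split => //; split => //; apply/dK; split.
    have hn : n./2 + n./2 <= n by rewrite addnn -[X in _ <= X]odd_double_half leq_addl.
    rewrite -(leq_add2r (size (column T 0))) sK; apply: leq_trans hn.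
    by apply: leq_add => //; apply: leq_trans (chain_size w hc (leqnSn 0)) sz.
  by move=> i Hi; apply: AI; rewrite mem_iota.
move=> [sz [_ hK]]; rewrite sz /=; apply/allP => i; rewrite mem_iota => Hi.
by have [_] := dK.1 hK; apply.
Qed.

End Tableaux.

(** * Crystal operators on tableaux *)

Definition readw (S : seq (seq nat)) : word := flatten [seq rev c | c <- S].

Lemma phiw_ge i u v : phiw i u <= phiw i (u ++ v).
Proof. by rewrite phiw_cat leq_addr. Qed.

(** [Ew] changes the leftmost undeleted [i.+1]. If the column to its left also had [i.+1] without
    [i], that letter would be undeleted too, as nothing between the two could cancel it. The last
    clause serves the induction, where the column is put in front. *)
Lemma Ew_readw i S w : all (sorted ltn) S -> Ew i (readw S) = Some w -> exists j,
  [/\ j < size S, (i.+1 \in nth [::] S j) && (i \notin nth [::] S j),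
      w = readw (set_nth [::] S j (repl i.+1 i (nth [::] S j))),
      0 < j -> ~~ ((i.+1 \in nth [::] S j.-1) && (i \notin nth [::] S j.-1))
    & j = 0 -> phiw i (readw S) = 0].
Proof.
elim: S w => [|c S IH] w //= /andP[cs Ss]; have [p e _ E] := sig_column i cs.
rewrite /readw /= -/(readw S) Ew_cat; case: ltnP => H.
  rewrite E; move: H; rewrite e; case: ifP => // ic H [<-]; exists 0; split => // _.
  rewrite phiw_cat p e ic; move: H; case/andP: ic => -> /negbTE -> /=; lia.
case ES: (Ew i (readw S)) => [v|] //= [<-].
have [j [h1 h2 h3 h4 h5]] := IH v Ss ES; exists j.+1; split => //; first by rewrite h3.
case: j h1 h2 h3 h4 h5 => [|j] h1 h2 h3 h4 h5 // _. 
by move: H; rewrite (h5 erefl) e leqn0; case: (_ && _).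
Qed.

Lemma Fw_readw i S w : all (sorted ltn) S -> Fw i (readw S) = Some w -> exists j,
  [/\ j < size S, (i \in nth [::] S j) && (i.+1 \notin nth [::] S j),
      w = readw (set_nth [::] S j (repl i i.+1 (nth [::] S j)))
    & ~~ ((i \in nth [::] S j.+1) && (i.+1 \notin nth [::] S j.+1))].
Proof.
elim: S w => [|c S IH] w //= /andP[cs Ss]; have [p e F _] := sig_column i cs.
rewrite /readw /= -/(readw S) Fw_cat; case: ltnP => H.
  case ES: (Fw i (readw S)) => [v|] //= [<-].
  have [j [h1 h2 h3 h4]] := IH v Ss ES; exists j.+1; split => //; by rewrite h3.
rewrite F; case: ifP => // ic [<-]; exists 0; split => //=.
move: H; rewrite e; case/andP: ic => -> /negbTE -> /= H.
case: S Ss H {IH} => [|c' S] //= /andP[c's _] H.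
have [p' _ _ _] := sig_column i c's.
have := leq_trans (phiw_ge i (rev c') (readw S)) H.
by rewrite p' leqn0; case: (_ && _).
Qed.

Lemma repl_down_eq i C : sorted ltn C -> i.+1 \in C -> i \notin C ->
  repl i.+1 i C = addc i (remc i.+1 C).
Proof.
move=> Cs i1 i0; apply: sorted_mem_eq; first exact: sorted_repl_down.
  exact/sorted_addc/sorted_remc.
by move=> x; rewrite mem_repl ?mem_addc ?mem_remc //; lia.
Qed.

Lemma repl_up_eq i C : sorted ltn C -> i \in C -> i.+1 \notin C ->
  repl i i.+1 C = addc i.+1 (remc i C).
Proof.
move=> Cs i1 i0; apply: sorted_mem_eq; first exact: sorted_repl_up.
  exact/sorted_addc/sorted_remc.
by move=> x; rewrite mem_repl ?mem_addc ?mem_remc //; lia.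
Qed.

Lemma cnt_repl_down i C k : sorted ltn C -> i.+1 \in C -> i \notin C ->
  cnt (repl i.+1 i C) k = cnt C k + (k == i).
Proof.
move=> Cs i1 i0; rewrite repl_down_eq // cnt_addc ?mem_remc ?(negbTE i0) ?andbF //.
by have := cnt_remc k Cs i1; case: (ltngtP k i); lia.
Qed.

Lemma cnt_repl_up i C k : sorted ltn C -> i \in C -> i.+1 \notin C ->
  cnt (repl i i.+1 C) k + (k == i) = cnt C k.
Proof.
move=> Cs i1 i0; rewrite repl_up_eq // cnt_addc ?mem_remc ?(negbTE i0) ?andbF //.
by have := cnt_remc k Cs i1; case: (ltngtP k i); lia.
Qed.

Lemma compl_repl_down n i C : sorted ltn C -> 0 < i < n -> i.+1 \in C -> i \notin C ->
  compl_column n (repl i.+1 i C) = repl i i.+1 (compl_column n C).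
Proof.
move=> Cs Hi i1 i0; apply: sorted_mem_eq; first exact: sorted_compl.
  by apply: sorted_repl_up; rewrite ?sorted_compl // mem_compl i1 andbF.
move=> x; rewrite mem_compl !mem_repl //; try by lia.
  rewrite mem_compl; case: (eqVneq x i) => [->|n1] /=; first by rewrite andbF; lia.
  by case: (eqVneq x i.+1) => [->|n2] //=; lia.
by rewrite mem_compl i0; lia.
Qed.

Lemma compl_repl_up n i C : sorted ltn C -> 0 < i < n -> i \in C -> i.+1 \notin C ->
  compl_column n (repl i i.+1 C) = repl i.+1 i (compl_column n C).
Proof.
move=> Cs Hi i1 i0; apply: sorted_mem_eq; first exact: sorted_compl.
  by apply: sorted_repl_down; rewrite ?sorted_compl // mem_compl i1 andbF.
move=> x; rewrite mem_compl !mem_repl //; try by lia.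
  rewrite mem_compl; case: (eqVneq x i.+1) => [->|n1] /=; first by rewrite andbF; lia.
  by case: (eqVneq x i) => [->|n2] //=; lia.
by rewrite mem_compl i0; lia.
Qed.

Section Crystal.
Variables n N i : nat.
Hypothesis N0 : 0 < N.
Hypothesis i_bounds : 0 < i < n.
Implicit Types (x : config).
Local Notation wf := (wf n N).
Local Notation K := (compl_column n).
Local Notation cpl := (cpl n).
Local Notation tab := (tab N).
Local Notation cword := (cword N).

Lemma mkseq_set x j A : j < N -> set_nth [::] (mkseq x N) j A = mkseq (upd x j A) N.
Proof.
move=> jN; apply: (@eq_from_nth _ [::]); rewrite size_set_nth !size_mkseq.
  by apply/maxn_idPr.
move=> k; rewrite (maxn_idPr jN) => kN.
by rewrite nth_set_nth /= !nth_mkseq // /upd; case: eqP.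
Qed.

Lemma cword_readw x : cword x = readw (mkseq x N).
Proof. exact: cword_mkseq. Qed.

Lemma size_repl a b C : size (repl a b C) = size C.
Proof. exact: size_map. Qed.

Definition same_sizes x x' := forall j, size (x' j) = size (x j).

Lemma wf_repl x j a b : wf x -> j < N -> 0 < b <= n -> sorted ltn (repl a b (x j)) ->
  wf (upd x j (repl a b (x j))).
Proof.
move=> w jN Hb Hs; apply: wf_upd => // c /mapP[e ex ->]; have [_ H2 _] := w.
by case: eqP => // _; apply: H2 ex.
Qed.

Lemma same_sizes_repl x j a b : same_sizes x (upd x j (repl a b (x j))).
Proof. by move=> k; rewrite /upd; case: eqP => // ->; rewrite size_repl. Qed.

Lemma Ew_cword x w : wf x -> chain x -> Ew i (cword x) = Some w ->
  exists x', [/\ wf x', chain x', same_sizes x x' & w = cword x'].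
Proof.
move=> wx hc; rewrite cword_readw => /Ew_readw[|j]; have [H1 H2 H3] := wx.
  by apply/allP => c /mapP[j _ ->].
rewrite size_mkseq => -[jN]; rewrite nth_mkseq // => /andP[i1 i0] -> hj _.
rewrite mkseq_set //; exists (upd x j (repl i.+1 i (x j))); split.
- by apply: wf_repl => //; [lia|apply: sorted_repl_down].
- move=> k l; rewrite /upd; case: (eqVneq k j) => [->|kj].
    rewrite (_ : j.+1 == j = false) ?cnt_repl_down //; last by lia.
    by apply: leq_trans (hc j l) (leq_addr _ _).
  case: (eqVneq k.+1 j) => [ekj|kj2]; last exact: hc.
  have := hj; rewrite -ekj /= nth_mkseq; last by lia.
  move=> /(_ isT) hk; rewrite -ekj in i0 i1 *; rewrite cnt_repl_down //.
  case: (eqVneq l i) => [->|_]; last by rewrite addn0; apply: hc.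
  (* Only the count at [i] grows. If the counts of columns [k] and [k.+1] agreed there, the value at
     i + 1 would force [i.+1] into column [k], hence also [i] by the choice of the column, and then
     dominance would fail at i - 1. *)
  have u j' : uniq (x j') by apply: (wf_uniq _ wx).
  have := cntS i (u k); have := cntS i (u k.+1); have := hc k i.+1; have := hc k i.-1.
  have ei : i = i.-1.+1 by lia.
  have := cntS i.-1 (u k); have := cntS i.-1 (u k.+1); rewrite -ei i1 (negbTE i0).
  by move: hk; case: (i.+1 \in x k); case: (i \in x k) => //= _; clear; lia.
- exact: same_sizes_repl.
- by rewrite cword_readw.
Qed.

Lemma Fw_cword x w : wf x -> chain x -> Fw i (cword x) = Some w ->
  exists x', [/\ wf x', chain x', same_sizes x x' & w = cword x'].
Proof.
move=> wx hc; rewrite cword_readw => /Fw_readw[|j]; have [H1 H2 H3] := wx.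
  by apply/allP => c /mapP[j _ ->].
rewrite size_mkseq => -[jN]; rewrite nth_mkseq // => /andP[i0 i1] -> hj.
rewrite (nth_mkseq_wf _ wx) in hj.
rewrite mkseq_set //; exists (upd x j (repl i i.+1 (x j))); split.
- by apply: wf_repl => //; [lia|apply: sorted_repl_up].
- move=> k l; rewrite /upd; case: (eqVneq k.+1 j) => [kj|kj].
    rewrite (_ : k == j = false); last by lia.
    by have := cnt_repl_up l (H1 j) i0 i1; have := hc k l; rewrite kj; clear; lia.
  case: (eqVneq k j) => [ekj|kj2]; last exact: hc.
  rewrite ekj; have := cnt_repl_up l (H1 j) i0 i1.
  case: (eqVneq l i) => [->|_]; last by rewrite addn0 => ->; apply: hc.
  have u j' : uniq (x j') by apply: (wf_uniq _ wx).
  have := cntS i (u j); have := cntS i (u j.+1); have := hc j i.+1; have := hc j i.-1.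
  have ei : i = i.-1.+1 by lia.
  have := cntS i.-1 (u j); have := cntS i.-1 (u j.+1); rewrite -ei i0 (negbTE i1).
  by move: hj; case: (i.+1 \in x j.+1); case: (i \in x j.+1) => //= _; clear; lia.
- exact: same_sizes_repl.
- by rewrite cword_readw.
Qed.

Lemma Bw_cword x w : wf x -> chain x -> Bw i (cword x) = Some w ->
  exists x', [/\ wf x', chain x', same_sizes x x' & w = cword x'].
Proof. by rewrite /Bw; case: ifP => _; [apply: Fw_cword | apply: Ew_cword]. Qed.

Lemma cword_inj x x' : wf x -> wf x' -> same_sizes x x' ->
  cword x = cword x' -> x =1 x'.
Proof.
move=> w w' ss E; have [_ _ H3] := w; have [_ _ H3'] := w'.
have Es : [seq rev (x j) | j <- iota 0 N] = [seq rev (x' j) | j <- iota 0 N].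
  rewrite -[LHS]flattenK -[RHS]flattenK -!/(cword _) E; congr reshape.
  by rewrite /seq.shape -!map_comp; apply: eq_map => j /=; rewrite !size_rev ss.
move=> j; case: (ltnP j N) => jN; last by rewrite H3 ?H3'.
have := congr1 (fun s => nth [::] s j) Es.
rewrite !(nth_map 0) ?size_iota // nth_iota // add0n => /(congr1 rev).
by rewrite !revK.
Qed.

Lemma BT_Bw T : BT i T = omap (refill T) (Bw i (CR T)).
Proof. by rewrite /BT /Bw /phi; case: ifP. Qed.

Lemma degT_degw T : degT i T = degw i (CR T).
Proof. by []. Qed.

Lemma refill_tab x x' : wf x -> chain x -> wf x' -> same_sizes x x' ->
  refill (tab x) (cword x') = tab x'.
Proof.
move=> w hc w' ss; have st := is_sst_tab N0 w hc.
have E : columns (tab x) = [seq x j | j <- iota 0 (size (head [::] (tab x)))].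
  by rewrite /columns; apply: eq_map => j; apply: (column_tab j w hc).
have hN : size (head [::] (tab x)) <= N.
  rewrite -nth0 (nth_tab _ w hc) size_map size_filter.
  by apply: leq_trans (count_size _ _) _; rewrite size_mkseq.
have x'0 j : size (head [::] (tab x)) <= j -> x' j = [::].
  move=> Hj; apply: size0nil; rewrite ss -(column_tab j w hc).
  by rewrite column_default //; apply: (decreasing_tab w hc).
rewrite /refill E; move: hN x'0; move: (size (head [::] (tab x))) => s hN x'0.
rewrite -map_comp.
have -> : cword x' = flatten [seq rev (x' j) | j <- iota 0 s].
  by rewrite /cword; apply: flatten_cut => // j; rewrite add0n; apply: x'0.
have -> : [seq (size \o x) j | j <- iota 0 s] =
    map size [seq rev (x' j) | j <- iota 0 s].
  by rewrite -map_comp; apply: eq_map => j /=; rewrite size_rev ss.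
rewrite flattenK -map_comp (eq_map (g := x')); last by move=> j /=; rewrite revK.
rewrite /tab /tab /mkseq -(subnKC hN) iotaD map_cat add0n.
rewrite -[LHS](columns_nseq _ (N - s)); congr (columns (_ ++ _)).
apply: (@eq_from_nth _ [::]); first by rewrite size_nseq size_map size_iota.
move=> k; rewrite size_nseq => Hk; rewrite nth_nseq Hk (nth_map 0) ?size_iota //.
by rewrite nth_iota // x'0 // leq_addr.
Qed.

Lemma BT_tab x : wf x -> chain x -> BT i (tab x) = omap (Psym) (Bw i (cword x)).
Proof.
move=> w hc; rewrite BT_Bw (CR_tab N0 w hc).
case E : (Bw i (cword x)) => [v|] //=; congr Some.
have [x' [w' hc' ss ->]] := Bw_cword w hc E.
by rewrite refill_tab // (Psym_cword w' hc').
Qed.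

(** If [C] contains exactly one of [i] and [i.+1], then [K C] contains exactly the other. One of
    them has phi = 1 and moves by [Fw], the other has eps = 1 and moves by [Ew]; both have degree 1,
    and the results are complementary again. Otherwise both have degree 0 and no operator
    applies. *)
Lemma column_crystal C : sorted ltn C -> 
  degw i (rev C) = degw i (rev (K C)) /\
  match Bw i (rev C) with
  | Some w => Bw i (rev (K C)) = Some (rev (K (rev w))) /\ size w = size C
  | None => Bw i (rev (K C)) = None
  end.
Proof.
move=> Cs; have [p e F E] := sig_column i Cs.
have [p' e' F' E'] := sig_column i (sorted_compl n C).
have m1 : (i \in K C) = (i \notin C) by rewrite mem_compl; case: (i \in C); lia.
have m2 : (i.+1 \in K C) = (i.+1 \notin C) by rewrite mem_compl; case: (i.+1 \in C); lia.
rewrite m1 m2 in p' e' F' E'.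
rewrite /degw /Bw p p' e e' F F' E E'.
case: (boolP (i \in C)) => a; case: (boolP (i.+1 \in C)) => b //=.
  by rewrite revK compl_repl_up // size_rev size_repl.
by rewrite revK compl_repl_down // size_rev size_repl.
Qed.

Definition tailw x := flatten [seq rev (x j) | j <- iota 1 N.-1].

Lemma cword_tail x : cword x = rev (x 0) ++ tailw x.
Proof. by rewrite /cword -[N](prednK N0). Qed.

Lemma tailw_cpl x : tailw (cpl x) = tailw x.
Proof.
rewrite /tailw; congr flatten; apply/eq_in_map => j; rewrite mem_iota => /andP[j1 _].
by rewrite /cpl upd_neq // -lt0n.
Qed.

Lemma degw_cpl x : wf x -> degw i (cword (cpl x)) = degw i (cword x).
Proof.
move=> [H1 _ _]; rewrite !cword_tail tailw_cpl !degw_cat /cpl upd_eq.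
by have [-> _] := column_crystal (H1 0).
Qed.

(** Whether the operator acts on the first column or on the rest is decided by the degree of the
    first column, which complementation preserves. Equal column lengths allow the resulting word to
    be cut after the first column. *)
Lemma Bw_cpl x x' : wf x -> wf x' -> same_sizes x x' ->
  Bw i (cword x) = Some (cword x') -> Bw i (cword (cpl x)) = Some (cword (cpl x')).
Proof.
move=> w w' ss; have [H1 _ _] := w; rewrite !cword_tail !tailw_cpl !Bw_cat.
rewrite /cpl !upd_eq; have [-> Bc] := column_crystal (H1 0).
have key (u v : word) : size u = size (x 0) -> Some (u ++ v) = Some (rev (x' 0) ++ tailw x') ->
    u = rev (x' 0) /\ v = tailw x'.
  move=> su [] /eqP; rewrite eqseq_cat; last by rewrite su size_rev ss.
  by move=> /andP[/eqP -> /eqP ->].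
have szr : size (rev (x 0)) = size (x 0) by rewrite size_rev.
case: ifP => _.
  case: (Bw i (rev (x 0))) Bc => [u|] //= [-> su] /(key _ _ su)[-> ->].
  by rewrite revK.
case: ifP => _.
  case: (Fw i (tailw x)) => [v|] //= /(key _ _ szr)[/(congr1 rev) + ->].
  by rewrite !revK => ->.
case: (Ew i (tailw x)) => [v|] //= /(key _ _ szr)[/(congr1 rev) + ->].
by rewrite !revK => ->.
Qed.

Lemma Bw_cpl_None x : wf x -> Bw i (cword x) = None -> Bw i (cword (cpl x)) = None.
Proof.
move=> [H1 _ _]; rewrite !cword_tail !tailw_cpl !Bw_cat.
rewrite /cpl !upd_eq; have [-> Bc] := column_crystal (H1 0).
case: ifP => _; first by case: (Bw i (rev (x 0))) Bc => [u|] //= ->.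
by case: ifP => _; [case: (Fw i _) | case: (Ew i _)].
Qed.

Lemma same_sizes_cpl x x' : wf x -> wf x' -> same_sizes x x' -> same_sizes (cpl x) (cpl x').
Proof.
move=> w w' ss [|j]; last exact: ss.
have [_ H2 _] := w; have [_ H2' _] := w'.
have := size_compl (wf_uniq 0 w) (H2 0); have := size_compl (wf_uniq 0 w') (H2' 0).
rewrite ss /cpl !upd_eq => e1 e2.
by apply/eqP; rewrite -(eqn_add2r (size (x 0))) e1 e2.
Qed.

(** The condition against the complement is the chain condition of the complemented configuration,
    and [Bw_cword] applied there preserves it. *)
Lemma highest_Bw x x' : wf x -> highest n x -> wf x' -> chain x' -> same_sizes x x' ->
  Bw i (cword x) = Some (cword x') -> highest n x'.
Proof.
move=> w h w' hc' ss E; split => //.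
have wc := wf_cpl N0 w.
have hcc : chain (cpl x).
  by case=> [|j]; [exact: (proj2 h) | exact: (proj1 h j.+1)].
have [y [wy hy sy Ey]] := Bw_cword wc hcc (Bw_cpl w w' ss E).
have Eyx : y =1 cpl x'.
  apply: cword_inj => //; first exact: wf_cpl.
  by move=> j; rewrite sy; apply: same_sizes_cpl.
by have := hy 0; rewrite !Eyx.
Qed.

End Crystal.

(** * Iterating K1 *)

Lemma PAI_iter n T r : is_AI n (iter r (K1 n) T) ->
  (forall q, q < r -> ~~ is_AI n (iter q (K1 n) T)) -> PAI n T = iter r (K1 n) T.
Proof.
move=> Hr Hq; rewrite /PAI; case: boolp.pselect => [h|[]]; last by exists r.
case: ex_minnP => q Aq Hmin; congr iter; apply/eqP; rewrite eqn_leq Hmin //= leqNgt.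
by apply/negP => /Hq; rewrite Aq.
Qed.

Lemma PAI_AI n T : is_AI n T -> PAI n T = T.
Proof. by move=> H; rewrite (@PAI_iter n T 0). Qed.

Lemma PAI_K1 n T : ~~ is_AI n T -> (exists r, is_AI n (iter r (K1 n) (K1 n T))) ->
  PAI n T = PAI n (K1 n T).
Proof.
move=> HT ex; case: (ex_minnP ex) => r Hr Hmin.
rewrite (@PAI_iter n T r.+1) ?iterSr //.
  rewrite (@PAI_iter n _ r) // => q qr; apply/negP => /Hmin; lia.
by case=> [|q] // qr; rewrite iterSr; apply/negP => /Hmin; lia.
Qed.

(** When no iterate is an AI-tableau, [PAI] returns [T], and the hypothesis makes [T] the iterate
    sought. This turns a known value of [PAI] into the termination required by [PAI_K1]. *)
Lemma PAI_exists n T : is_AI n (PAI n T) -> exists r, is_AI n (iter r (K1 n) T).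
Proof. by rewrite /PAI; case: boolp.pselect => [h|_ H] //; exists 0. Qed.

(** * Lengths, converses and iterates of K1 for the four outcomes *)

Section Outcomes.
Variables n N J : nat.
Hypothesis J0 : 0 < J.
Hypothesis JN : J < N.
Implicit Types (x z S : config) (d : nat -> nat).
Local Notation wf := (wf n N).
Local Notation highest := (highest n).
Local Notation added := (added n).
Local Notation removed := (removed n).
Local Notation K := (compl_column n).
Local Notation cpl := (cpl n).
Local Notation tab := (tab N).

Let N1 : 1 < N. Proof. by lia. Qed.
Let N0 : 0 < N. Proof. by lia. Qed.

Lemma plus_box_ext d j x x' : x =1 x' -> plus_box d j x -> plus_box d j x'.
Proof. by move=> E H i; rewrite -E. Qed.

Lemma out_plus_size d j x S : wf x -> out_plus J j x S -> plus_box d J x -> plus_box d j S.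
Proof. by by move=> w [/andP[_ jJ] h] H; apply/(plus_box_down d w JN jJ h). Qed.

Lemma out_first_plus_size d x S : wf x -> out_first_plus n J x S -> plus_box d J x ->
  plus_box d 0 S.
Proof.
move=> w [x1 [h1 h2 _]] H; have w1 := steps_wf_down JN w h1.
by apply/(plus_box_step d w1 h2)/(plus_box_down d w JN J0 h1).
Qed.

Lemma out_first_minus_size d x S : d 0 <= n -> wf x -> out_first_minus n J x S ->
  plus_box d J x ->
  plus_box (cpl_len n d) 0 S.
Proof.
move=> dn w [x1 [h1 h2 _]] H; have w1 := steps_wf_down JN w h1.
apply/(plus_box_step _ (wf_cpl N0 w1) h2)/(plus_box_cpl w1) => //.
exact/(plus_box_down d w JN J0 h1).
Qed.

Lemma out_minus_size d k x S : d 0 < n -> wf x -> out_minus n N J k x S -> plus_box d J x ->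
  minus_box (cpl_len n d) k S.
Proof.
move=> dn w [x1 [x2 [x3 [h1 h2 h3 _ [kN h4]]]]] H.
have w1 := steps_wf_down JN w h1; have w2 := step_wf w1 N1 h2.
have w3 := step_wf (wf_cpl N0 w2) N1 h3.
apply/(minus_box_up _ w3 kN h4)/(minus_box_step _ (wf_cpl N0 w2) h3).
apply/(minus_box_cpl w2 dn)/(plus_box_step d w1 h2).
exact/(plus_box_down d w JN J0 h1).
Qed.

Lemma size_compl0 x : wf x -> size (K (x 0)) + size (x 0) = n.
Proof. exact: size_cpl0. Qed.

Section Backward.
Variable d : nat -> nat.
Hypothesis dmono : forall i j, i <= j -> d j <= d i.
Hypothesis dn : d 0 <= n./2.

Let half_le : n./2 + n./2 <= n.
Proof. by rewrite addnn -[X in _ <= X]odd_double_half leq_addl. Qed.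

(** Here and in the three lemmas below, the lengths alone show that the last move can be undone: the
    column with the new box is longer than the next one, and the column lacking a box is shorter
    than those before it and, for k = 1, than the complement of the first column. *)
Lemma out_plus_back j S : wf S -> highest S -> 0 < j <= J -> plus_box d j S ->
  exists x, [/\ wf x, added J x, plus_box d J x & out_plus J j x S].
Proof.
move=> w hS Hj H; have aS : added j S.
  case: j Hj H => // j Hj H; apply: (added_of_highest w) => //.
  by rewrite !H eqxx; have := dmono (leqnSn j.+1); lia.
have [x [wx ax sx]] := down_backward w JN Hj aS.
exists x; split => //; by apply/(plus_box_down d wx JN (proj2 (andP Hj)) sx).
Qed.

Lemma out_first_plus_back S : wf S -> highest S -> plus_box d 0 S ->
  exists x, [/\ wf x, added J x, plus_box d J x & out_first_plus n J x S].
Proof.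
move=> w hS H.
have [|x1 [w1 s1 a1 k1]] := added_back0 N1 w hS.
  by rewrite !H; have := dmono (leqnSn 0); lia.
have [x [wx ax sx]] := down_backward w1 JN (introT andP (conj (leqnn 1) J0)) a1.
exists x; split => //; last by exists x1.
by apply/(plus_box_down d wx JN J0 sx) => //; apply/(plus_box_step d w1 s1).
Qed.

Lemma out_first_minus_back S : wf S -> highest S -> plus_box (cpl_len n d) 0 S ->
  exists x, [/\ wf x, added J x, plus_box d J x & out_first_minus n J x S].
Proof.
move=> w hS H.
have [|x1 [w1 s1 a1 k1]] := added_back0 N1 w hS.
  by rewrite !H /cpl_len /=; have := dmono (leqnSn 0); lia.
have wc := wf_cpl N0 w1.
have [x [wx ax sx]] := down_backward wc JN (introT andP (conj (leqnn 1) J0)) (added_cpl w1 a1).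
exists x; split => //.
  apply/(plus_box_down d wx JN J0 sx) => //; apply/(plus_box_cpl wc) => //; first by lia.
  apply: plus_box_ext (fsym (cplK w1)) _.
  exact/(plus_box_step _ w1 s1).
exists (cpl x1); split => //; last by apply: added_chain => //; apply: added_cpl w1 a1.
exact: step_ext (fsym (cplK w1)) s1.
Qed.

Lemma out_minus_back k S : 0 < n -> wf S -> highest S -> 0 < k < N ->
  minus_box (cpl_len n d) k S ->
  exists x, [/\ wf x, added J x, plus_box d J x & out_minus n N J k x S].
Proof.
move=> n0 w hS kN H; have sK := size_compl0 w.
have rS : removed k S.
  case: k kN H => // k kN H; apply: (removed_of_highest w) => //.
    move=> i ik; move: (H i) (H k.+1); rewrite /cpl_len eqxx /=.
    have := dmono (leq0n k.+1); have := dmono (leqW ik).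
    by case: (eqVneq i 0) => [->|i0]; rewrite (_ : _ == k.+1 = false); lia.
  move=> k0; move: (H 0) (H 1); rewrite k0 /cpl_len /=.
  by have := dmono (leqnSn 0); lia.
have [x3 [w3 r3 s3]] := up_backward w kN rS.
have [x2 [x1 [w2 w1 s2 s1 [a1 c2]]]] := removed_back0 N1 w3 r3.
have [x [wx ax sx]] := down_backward w1 JN (introT andP (conj (leqnn 1) J0)) a1.
exists x; split => //; last by exists x1, x2, x3.
apply/(plus_box_down d wx JN J0 sx) => //; apply/(plus_box_step d w1 s1).
apply/(minus_box_cpl w2); first by lia.
apply/(minus_box_step _ (wf_cpl N0 w2) s2).
exact/(minus_box_up _ w3 kN s3).
Qed.

End Backward.

Lemma size_head_tab S : wf S -> chain S -> size (head [::] (tab S)) <= N.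
Proof.
move=> w hc; rewrite -nth0 (nth_tab _ w hc) size_map size_filter.
by apply: leq_trans (count_size _ _) _; rewrite size_mkseq.
Qed.

Lemma eq_highest S S' : S =1 S' -> highest S <-> highest S'.
Proof. by move=> E; split; apply: highest_ext => // i; rewrite E. Qed.

Lemma is_AI_tab S : wf S -> chain S ->
  is_AI n (tab S) <-> size (S 0) <= n./2 /\ highest S.
Proof.
move=> w hc; have E j := column_tab j w hc.
rewrite (is_AI_highest (is_sst_tab N0 w hc) (size_head_tab w hc)) E.
by rewrite (eq_highest E).
Qed.

(** Applied when both [S] and its complement satisfy the AI-condition up to the bound on the length.
    If both first columns have m entries, [S] itself is taken. *)
Definition short S : config := if size (S 0) <= n./2 then S else cpl S.

Lemma short_wf S : wf S -> wf (short S).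
Proof. by rewrite /short; case: ifP => // _ w; apply: wf_cpl. Qed.

Lemma short_highest S : wf S -> highest S -> highest (short S).
Proof. by rewrite /short; case: ifP => // _; apply: highest_cpl. Qed.

Lemma short_size S : wf S -> size (short S 0) <= n./2.
Proof.
rewrite /short; case: (leqP (size (S 0))) => // H w; have := size_compl0 w; rewrite cpl0.
by have := odd_double_half n; rewrite -addnn; case: (odd n); lia.
Qed.

Lemma AI_short S : wf S -> highest S -> is_AI n (tab (short S)).
Proof.
move=> w h; have hs := short_highest w h.
by apply/is_AI_tab => //; [exact: short_wf | exact: (proj1 hs) | split => //; apply: short_size].
Qed.

(** A run of [K1] in terms of configurations, each reached from the complement of the preceding one
    up to Knuth equivalence. The negated condition in [reducesS] makes the number of iterations
    minimal. *)
Inductive reduces : config -> config -> Prop :=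
| reduces0 x : wf x -> chain x -> is_AI n (tab x) -> reduces x x
| reducesS x S V : wf x -> chain x -> ~~ is_AI n (tab x) -> wf S -> chain S ->
    knuth (cword N (cpl x)) (cword N S) -> reduces S V -> reduces x V.

Lemma reduces_wf x V : reduces x V -> [/\ wf V, chain V & is_AI n (tab V)].
Proof. by elim. Qed.

Lemma K1_knuth x S : wf x -> chain x -> wf S -> chain S ->
  knuth (cword N (cpl x)) (cword N S) -> K1 n (tab x) = tab S.
Proof. by move=> w c wS cS k; rewrite K1_tab // (Psym_knuth k) (Psym_cword wS). Qed.

Lemma reduces_PAI x V : reduces x V -> PAI n (tab x) = tab V.
Proof.
elim=> [x1 w c A|x1 S V1 w c A wS cS k r IH]; first exact: PAI_AI.
have E := K1_knuth w c wS cS k.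
by rewrite PAI_K1 ?E //; apply: PAI_exists; rewrite IH; case: (reduces_wf r).
Qed.

Lemma reduces_short S : wf S -> highest S -> reduces S (short S).
Proof.
move=> w h; have hA := AI_short w h; move: hA; rewrite /short.
have [c _] := h; case: (leqP (size (S 0))) => H hA; first exact: reduces0.
have [c' h'] := highest_cpl w h.
apply: (reducesS (S := cpl S)) => //; [|exact: wf_cpl|exact: Knuth_refl|].
  by apply/negP => /(is_AI_tab w c)[]; rewrite leqNgt H.
by apply: reduces0 => //; apply: wf_cpl.
Qed.

(* [x1] encodes the P-symbol of the word of [x], [short S] its image under [PAI],
   and [b] tells whether the insertion lengthens the first column. *)
Definition inserted d x x1 (b : bool) S : Prop :=
  [/\ wf x1, chain x1, knuth (cword N x) (cword N x1), size (x1 0) = d 0 + b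
    & reduces x1 (short S)].

Lemma out_plus_reduces d j x S : wf x -> wf S -> highest S -> out_plus J j x S ->
  plus_box d J x -> inserted d x S false S.
Proof.
move=> w wS h o H; have [c _] := h; have [_ st] := o; split => //.
- exact: steps_knuth w (down_lt _ JN) st.
- by have [Hj _] := o; rewrite (out_plus_size w o H) (_ : 0 == j = false) //; lia.
- exact: reduces_short.
Qed.

Lemma out_first_plus_reduces d x S : wf x -> wf S -> highest S -> out_first_plus n J x S ->
  plus_box d J x -> inserted d x S true S.
Proof.
move=> w wS h o H; have [c _] := h; split => //.
- have [x1 [st s1 _]] := o; apply: Knuth_trans (steps_knuth w (down_lt _ JN) st) _.
  exact: step_knuth (steps_wf_down JN w st) N1 s1.
- exact: (out_first_plus_size w o H).
- exact: reduces_short.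
Qed.

Lemma out_first_minus_reduces d x S : wf x -> wf S -> highest S -> out_first_minus n J x S ->
  plus_box d J x -> exists x1, inserted d x x1 false S.
Proof.
move=> w wS h [x1 [st s1 c1]] H; have w1 := steps_wf_down JN w st.
have [c _] := h; exists x1; split => //.
- exact: steps_knuth w (down_lt _ JN) st.
- by rewrite ((plus_box_down d w JN J0 st).1 H).
apply: (reducesS (S := S)) => //; last exact: reduces_short.
  (* The defect that triggers the move into the complement is itself a failure of the AI-condition,
     so [K1] has to be applied at this point. *)
  apply/negP => /(is_AI_tab w1 c1)[_ [_ hK]].
  by have [y [dy _ _ _]] := s1; apply: (defect_ndom dy).
exact: step_knuth (wf_cpl N0 w1) N1 s1.
Qed.

Lemma out_minus_reduces d k x S : wf x -> wf S -> highest S -> out_minus n N J k x S ->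
  plus_box d J x -> exists x1, inserted d x x1 true S.
Proof.
move=> w wS h [x1 [x2 [x3 [st s1 s2 c2 [/andP[_ kN] st3]]]]] H.
have w1 := steps_wf_down JN w st; have w2 := step_wf w1 N1 s1.
have w3 := step_wf (wf_cpl N0 w2) N1 s2.
have [c _] := h; exists x2; split => //.
- apply: Knuth_trans (steps_knuth w (down_lt _ JN) st) _.
  exact: step_knuth w1 N1 s1.
- by rewrite ((plus_box_step d w1 s1).1 ((plus_box_down d w JN J0 st).1 H)).
apply: (reducesS (S := S)) => //; last exact: reduces_short.
  apply/negP => /(is_AI_tab w2 c2)[_ [_ hK]].
  by have [y [dy _ _ _]] := s2; apply: (defect_ndom dy).
apply: Knuth_trans (step_knuth (wf_cpl N0 w2) N1 s2) _.
exact: steps_knuth w3 (up_lt kN) st3.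
Qed.

Lemma degw_reduces i x V : 0 < i < n -> reduces x V ->
  degw i (cword N x) = degw i (cword N V).
Proof.
move=> Hi; elim=> // x1 S V1 w c A wS cS k r <-.
by rewrite -(degw_cpl N0 Hi w) (degw_knuth i k).
Qed.

Lemma Bw_reduces_None i x V : 0 < i < n -> reduces x V ->
  Bw i (cword N x) = None -> Bw i (cword N V) = None.
Proof.
move=> Hi; elim=> // x1 S V1 w c A wS cS k r IH E; apply: IH.
by have := Bw_knuth i k; rewrite (Bw_cpl_None N0 Hi w E); case: (Bw i _).
Qed.

Lemma AI_Bw i x x' : 0 < i < n -> wf x -> chain x -> wf x' -> chain x' ->
  same_sizes x x' -> Bw i (cword N x) = Some (cword N x') ->
  is_AI n (tab x) -> is_AI n (tab x').
Proof.
move=> Hi w c w' c' ss E /(is_AI_tab w c)[sz h]; apply/(is_AI_tab w' c').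
rewrite ss; split => //; exact: (highest_Bw N0 Hi w h w' c' ss E).
Qed.

(** The runs of [K1] from [x] and from [x'] stop at the same time: the operator preserves being an
    AI-tableau, and since it is undone by itself, it preserves the opposite as well. *)
Lemma Bw_reduces i x V x' : 0 < i < n -> reduces x V -> wf x' -> chain x' ->
  same_sizes x x' -> Bw i (cword N x) = Some (cword N x') ->
  exists V', [/\ wf V', chain V', same_sizes V V',
    Bw i (cword N V) = Some (cword N V')
    & PAI n (tab x') = tab V' /\ is_AI n (tab V')].
Proof.
move=> Hi r; elim: r x' => [x1 w c A|x1 S V1 w c A wS cS k r IH] x' w' c' ss E.
  have A' := AI_Bw Hi w c w' c' ss E A.
  by exists x'; split => //; rewrite PAI_AI.
have := Bw_knuth i k; rewrite (Bw_cpl N0 Hi w w' ss E).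
case ES: (Bw i (cword N S)) => [v|] //= kv.
have [S' [wS' cS' ssS eS]] := Bw_cword N0 Hi wS cS ES; rewrite eS in ES kv.
have [V' [wV cV sV EV [PV AV]]] := IH S' wS' cS' ssS ES.
exists V'; split => //; split => //.
have EK := K1_knuth w' c' wS' cS' kv.
rewrite PAI_K1 ?EK //; last by apply: PAI_exists; rewrite PV.
apply/negP => A'; case/negP: A; apply: (AI_Bw Hi w' c' w c _ (Bw_inv E) A').
by move=> j; rewrite ss.
Qed.

End Outcomes.

(** * Shapes *)

Definition conj_part (la : seq nat) (j : nat) : nat := count (fun r => j < r) la.

Lemma size_column_conj (T : tableau) j : size (column T j) = conj_part (shape T) j.
Proof. by rewrite size_map size_filter /conj_part count_map. Qed.

Lemma conj_part_mono la i j : i <= j -> conj_part la j <= conj_part la i.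
Proof. by move=> ij; apply: sub_count => r /=; apply: leq_ltn_trans. Qed.

Lemma sorted_geq_count la i j : sorted geq la ->
  (i < conj_part la j) = (j < nth 0 la i).
Proof.
elim: la i => [|r la IH] i /=; first by rewrite nth_nil.
move=> H; have Hs := path_sorted H.
have geq_trans : transitive geq by move=> a b c /= H1 H2; apply: leq_trans H2 H1.
have /allP Ha := order_path_min geq_trans H.
rewrite /conj_part /= -/(conj_part la j).
case: (ltnP j r) => jr; first by case: i => [|i] /=; rewrite add1n ltnS ?jr // IH.
have E : conj_part la j = 0.
  apply/eqP; rewrite -leqn0 leqNgt -has_count; apply/hasPn => s /Ha /= sr.
  by rewrite -leqNgt; apply: leq_trans jr.
rewrite E ltn0; case: i => [|i] /=; apply/esym/negbTE; rewrite -leqNgt //.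
case: (ltnP i (size la)) => iN; last by rewrite nth_default.
by apply: leq_trans (Ha _ (mem_nth 0 iN)) jr.
Qed.

Lemma conj_part_size la : 0 \notin la -> conj_part la 0 = size la.
Proof.
move=> H; apply/eqP; rewrite -all_count; apply/allP => r rla; rewrite lt0n.
by apply: contraNneq H => <-.
Qed.

Lemma eq_part la mu : is_part la -> sorted geq mu -> 0 \notin mu ->
  conj_part la =1 conj_part mu -> la = mu.
Proof.
move=> /andP[la1 la0] mu1 mu0 E; apply: (@eq_from_nth _ 0).
  by rewrite -(conj_part_size la0) -(conj_part_size mu0) E.
move=> i _; apply/eqP; rewrite eqn_leq; apply/andP; split; rewrite leqNgt; apply/negP.
  by rewrite -(sorted_geq_count _ _ la1) E (sorted_geq_count _ _ mu1) ltnn.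
by rewrite -(sorted_geq_count _ _ mu1) -E (sorted_geq_count _ _ la1) ltnn.
Qed.

Lemma conj_part_incr la k j : k <= size la ->
  conj_part (incr_nth la k) j = conj_part la j + (j == nth 0 la k).
Proof.
rewrite /conj_part; elim: la k => [|r la IH] [|k] //=.
- by move=> _; rewrite addn0; case: j.
- move=> _; rewrite addnAC; congr (_ + _).
  by rewrite ltnS leq_eqVlt; case: (ltngtP j r).
- by rewrite ltnS => /IH ->; rewrite addnA.
Qed.

Lemma notin_incr la k : k <= size la -> 0 \notin la -> 0 \notin incr_nth la k.
Proof.
elim: la k => [|r la IH] [|k] //=; rewrite !in_cons !negb_or.
  by move=> _ /andP[_ ->].
by rewrite ltnS => /IH H /andP[-> /H].
Qed.

Lemma adds_box_conj la mu : is_part la -> is_part mu ->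
  adds_box la mu <-> exists j, forall i, conj_part mu i = conj_part la i + (i == j).
Proof.
move=> Hla Hmu; have /andP[la1 la0] := Hla; have /andP[mu1 mu0] := Hmu; split.
  move=> /hasP[k]; rewrite mem_iota add0n ltnS => kla /eqP ->.
  by exists (nth 0 la k) => i; rewrite conj_part_incr.
(* A box added at the bottom of column [j] lies in the row whose 0-based index is the length of that
   column. *)
move=> [j Hj]; pose k := conj_part la j.
have kla : k <= size la by rewrite /k count_size.
have ekj : nth 0 la k = j.
  apply/eqP; rewrite eqn_leq; apply/andP; split.
    by rewrite leqNgt -sorted_geq_count // ltnn.
  case: j Hj @k kla => // j Hj k kla; rewrite -sorted_geq_count //.
  have := conj_part_mono mu (leqnSn j); rewrite !Hj eqxx.
  by rewrite (_ : j == j.+1 = false) ?addn0 ?addn1 //; lia.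
apply/hasP; exists k; first by rewrite mem_iota add0n ltnS.
apply/eqP; apply: (eq_part Hmu); last by move=> i; rewrite conj_part_incr // ekj Hj.
  apply/(sortedP 0) => i Hi.
  rewrite /= leqNgt; apply/negP => H.
  (* The parts of [incr_nth la k] are compared with the column lengths of [mu] before they are known
     to decrease; an increase between two consecutive parts would contradict these lengths. *)
  have E c i' : (i' < conj_part mu c) = (c < nth 0 (incr_nth la k) i').
    rewrite Hj nth_incr_nth; have := sorted_geq_count i' c la1.
    case: (eqVneq k i') => [<-|ki].
      rewrite ekj /k; case: (eqVneq c j) => [->|cj] _; first by rewrite addn1 add1n !ltnSn.
      rewrite addn0 add1n ltnS (leq_eqVlt c j) (negbTE cj) /=.
      by have := sorted_geq_count k c la1; rewrite ekj /k.
    rewrite add0n; case: (eqVneq c j) => [->|cj] <-; last by rewrite addn0.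
    by rewrite addn1 ltnS (leq_eqVlt i' k) -/k eq_sym (negbTE ki).
  have := ltnn (nth 0 (incr_nth la k) i); rewrite -E => /negbT; rewrite -leqNgt => H1.
  have := H; rewrite -E => H2.
  by have := leq_trans H2 H1; rewrite ltnNge leqnSn.
exact: notin_incr.
Qed.

Lemma neighbours_conj la mu : is_part la -> is_part mu ->
  mu \in neighbours la <->
  (exists j, forall i, conj_part mu i = conj_part la i + (i == j)) \/
  (exists j, forall i, conj_part la i = conj_part mu i + (i == j)).
Proof.
move=> Hla Hmu; rewrite inE; split.
  by case/orP => [/(adds_box_conj Hla Hmu)|/(adds_box_conj Hmu Hla)]; [left|right].
by case=> H; apply/orP;
  [left; apply/(adds_box_conj Hla Hmu) | right; apply/(adds_box_conj Hmu Hla)].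
Qed.

Lemma conj_part_take la k j : sorted geq la ->
  conj_part (take k la) j = minn k (conj_part la j).
Proof.
move=> la1; have tk : sorted geq (take k la) by apply: take_sorted.
apply/eqP; rewrite eqn_leq; apply/andP; split.
  rewrite leq_min; apply/andP; split.
    by apply: leq_trans (count_size _ _) _; rewrite size_take; case: ltnP.
  by rewrite -[X in _ <= conj_part X _](cat_take_drop k) /conj_part count_cat leq_addr.
case E : (minn k (conj_part la j)) => [|i] //.
have : i < minn k (conj_part la j) by rewrite E.
rewrite leq_min => /andP[ik]; rewrite sorted_geq_count // => H.
by rewrite sorted_geq_count // nth_take.
Qed.

(** * Insertion into an AI-tableau *)

Section Insertion.
Variables (n : nat) (rho : seq nat).
Hypothesis n0 : 0 < n.
Hypothesis rho_part : is_part rho.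
Hypothesis rho_size : size rho <= n./2.

Local Notation d := (conj_part rho).
Local Notation J := (head 0 rho).+1.
Local Notation N := (head 0 rho).+2.
Local Notation K := (compl_column n).
Local Notation tab := (tab N).

Let JN : J < N. Proof. by []. Qed.
Let J0 : 0 < J. Proof. by []. Qed.
Let N0 : 0 < N. Proof. by []. Qed.
Let N1 : 1 < N. Proof. by []. Qed.

Let rho_sorted : sorted geq rho. Proof. by case/andP: rho_part. Qed.
Let rho_pos : 0 \notin rho. Proof. by case/andP: rho_part. Qed.

Let dmono i j : i <= j -> d j <= d i. Proof. exact: conj_part_mono. Qed.

Let d0 : d 0 = size rho. Proof. exact: conj_part_size. Qed.

Let d_gt0 j : (0 < d j) = (j < head 0 rho).
Proof. by rewrite sorted_geq_count // nth0. Qed.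

Let dJ j : head 0 rho <= j -> d j = 0.
Proof. by move=> H; apply/eqP; rewrite -leqn0 leqNgt d_gt0 -leqNgt. Qed.

Let half_le : n./2 + n./2 <= n.
Proof. by rewrite addnn -[X in _ <= X]odd_double_half leq_addl. Qed.

(** [J] is rho_1 + 1, so an empty column separates [l] from the tableau. This makes [J] positive
    even for empty [rho]: the letter always starts to the right of the first column. *)
Definition start (T : tableau) (l : nat) : config := upd (column T) J [:: l].

Lemma head_shape (T : tableau) : size (head [::] T) = head 0 (shape T).
Proof. by case: T. Qed.

Lemma start_wf T l : T \in SSTAI n rho -> 0 < l <= n ->
  [/\ wf n N (start T l), added n J (start T l), plus_box d J (start T l)
    & cword N (start T l) = CR T ++ [:: l]].
Proof.
move=> /andP[AT /eqP sT] ln; have st : is_sst n T by case/and3P: AT.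
have hT : size (head [::] T) <= N by rewrite head_shape sT; apply: leqW.
have w := wf_column st hT; have cT j : size (column T j) = d j.
  by rewrite size_column_conj sT.
have cJ : column T J = [::] by apply: size0nil; rewrite cT dJ.
have [_ h] := (is_AI_highest st hT).1 AT; split.
- by apply: wf_upd => // a; rewrite inE => /eqP ->.
- split.
    have [_ _ H] := w; rewrite /start [upd _ _ _ J.+1]upd_neq; last by rewrite neq_ltn ltnSn orbT.
    by rewrite (H N).
  exists l; first by rewrite /start upd_eq mem_head.
  apply: highest_ext h => j; rewrite /start /upd eqxx /= eqxx /=.
  by case: eqP => // ->; rewrite cJ.
- move=> i; rewrite /start /upd; case: (eqVneq i J) => [->|_] /=; first by rewrite dJ.
  by rewrite cT addn0.
- rewrite (CR_cword st hT) /cword -[N]addn1 iotaD !map_cat !flatten_cat /= add0n !cats0.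
  rewrite /start upd_eq cJ cats0.
  congr ((rev _ ++ flatten _) ++ _).
  apply/eq_in_map => j; rewrite mem_iota => /andP[_ Hj].
  by rewrite upd_neq // neq_ltn -add1n Hj.
Qed.

Lemma row_insert_start T l : T \in SSTAI n rho -> 0 < l <= n ->
  row_insert T l = Psym (cword N (start T l)).
Proof.
move=> hT ln; have [_ _ _ ->] := start_wf hT ln.
have /andP[AT /eqP sT] := hT; have st : is_sst n T by case/and3P: AT.
have hN : size (head [::] T) <= N by rewrite head_shape sT; apply: leqW.
rewrite /Psym foldl_cat -/(Psym (CR T)) (CR_cword st hN).
rewrite (Psym_cword (wf_column st hN) (chain_column st)).
by rewrite (tab_column st hN).
Qed.

Lemma start_inv x : wf n N x -> added n J x -> plus_box d J x ->
  exists T l, [/\ T \in SSTAI n rho, 0 < l <= n & x =1 start T l].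
Proof.
move=> w [_ [a aJ h]] H; have [H1 H2 H3] := w.
have := H J; rewrite eqxx dJ // add0n => sJ.
have [l xJ] : exists l, x J = [:: l] by case: (x J) sJ => [|l [|? ?]] // _; exists l.
have ea : a = l by move: aJ; rewrite xJ inE => /eqP.
have ln : 0 < l <= n by apply: (H2 J); rewrite xJ mem_head.
rewrite xJ ea /remc /= eqxx /= in h.
pose y := upd x J [::].
have wy : wf n N y by apply: wf_upd.
have cy : chain y by case: h.
have sy i : size (y i) = d i.
  rewrite /y /upd; case: eqP => [->|/eqP ne]; first by rewrite dJ.
  by rewrite H (negbTE ne) addn0.
have sT : shape (tab y) = rho.
  have /and3P[/andP[p1 p2] _ _] := is_sst_tab N0 wy cy.
  apply/esym/eq_part => // i.
  by rewrite -size_column_conj (column_tab i wy cy) sy.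
exists (tab y), l; split => //.
  rewrite !inE sT eqxx andbT; apply/(is_AI_tab J0 JN wy cy).
  by rewrite sy d0.
move=> i; rewrite /start /upd (column_tab i wy cy) /y /upd.
by case: eqP => // ->.
Qed.

(* Where the inserted letter ends: in column j > 0, where it adds a box; in the
   first column, or in the complement of the first column; or, reflected at both,
   back in column k > 0, where it removes a box. *)
Inductive class := Plus_in of nat | Plus_first | Minus_first | Minus_in of nat.

Definition out (c : class) (x S : config) : Prop :=
  match c with
  | Plus_in j => out_plus J j x S
  | Plus_first => out_first_plus n J x S
  | Minus_first => out_first_minus n J x S
  | Minus_in k => out_minus n N J k x S
  end.

Definition index_gt0 (c : class) : bool :=
  match c with Plus_in j | Minus_in j => 0 < j | _ => true end.

Definition index_ok (c : class) : bool :=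
  match c with
  | Plus_in j => 0 < j <= J
  | Minus_in k => 0 < k < N
  | _ => true
  end.

Definition grows (c : class) : bool :=
  match c with Plus_first | Minus_in _ => true | _ => false end.

(** Column lengths of the final AI-tableau. For [Plus_first] with a full first column, the m + 1
    entries are replaced by their complement. The last two classes end with a first column related
    to the complement of the original one; [profile] gives the lengths after returning to the
    shorter of the two. *)
Definition profile (c : class) (e : nat -> nat) : Prop :=
  match c with
  | Plus_in j => 0 < j /\ forall i, e i = d i + (i == j)
  | Plus_first =>
      if d 0 < n./2 then forall i, e i = d i + (i == 0)
      else forall i, e i = if i == 0 then n - (n./2).+1 else d i
  | Minus_first => forall i, d i = e i + (i == 0)
  | Minus_in k => 0 < k /\ forall i, d i = e i + (i == k)
  end.

Definition raw_sizes (c : class) (S : config) : Prop :=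
  match c with
  | Plus_in j => plus_box d j S
  | Plus_first => plus_box d 0 S
  | Minus_first => plus_box (cpl_len n d) 0 S
  | Minus_in k => minus_box (cpl_len n d) k S
  end.

Lemma d0_le : d 0 <= n./2. Proof. by rewrite d0. Qed.

Lemma out_sizes c x S : wf n N x -> out c x S -> plus_box d J x -> raw_sizes c S.
Proof.
have dn := d0_le => w; case: c => [j| | |k] /= o H.
- exact: (out_plus_size JN w o H).
- exact: (out_first_plus_size J0 JN w o H).
- by apply: (out_first_minus_size J0 JN _ w o H); lia.
- by apply: (out_minus_size J0 JN _ w o H); lia.
Qed.

Lemma out_reduces c x S : wf n N x -> wf n N S -> highest n S -> out c x S ->
  plus_box d J x -> exists x1, inserted n N d x x1 (grows c) S.
Proof.
move=> w wS h; case: c => [j| | |k] /= o H.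
- by exists S; apply: (out_plus_reduces J0 JN w wS h o H).
- by exists S; apply: (out_first_plus_reduces J0 JN w wS h o H).
- exact: (out_first_minus_reduces J0 JN w wS h o H).
- exact: (out_minus_reduces J0 JN w wS h o H).
Qed.

Lemma raw_profile c S : wf n N S -> index_gt0 c -> raw_sizes c S ->
  profile c (fun i => size (short n S i)).
Proof.
move=> w c1; have dn := d0_le; have sK := size_compl0 w.
have sc i : size (cpl n S i.+1) = size (S i.+1) by [].
have sc0 : size (cpl n S 0) = size (K (S 0)) by [].
rewrite /short; case: c c1 => [j| | |k] /= c1 H; have := H 0;
 rewrite ?eqxx /cpl_len /= => HS0.
- split => // i; rewrite HS0 (_ : 0 == j = false) ?addn0 ?dn //; lia.
- case: ifP => dm i; first by rewrite ifT //; lia.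
  rewrite ifN; last by lia.
  by case: i => [|i] /=; [lia | rewrite sc H addn0].
- move=> i; rewrite ifN; last by lia.
  by case: i => [|i] /=; [lia | rewrite sc H /cpl_len /= !addn0].
- split => // i; rewrite (_ : 0 == k = false) in HS0; last by lia.
  case: leqP => H0; case: i => [|i].
  + by rewrite (_ : 0 == k = false); lia.
  + by rewrite (H i.+1).
  + by rewrite (_ : 0 == k = false); lia.
  + by rewrite sc (H i.+1).
Qed.

Lemma out_pos c x S : out c x S -> index_gt0 c.
Proof.
case: c => [j| | |k] //=; first by case=> /andP[].
by move=> [x1 [x2 [x3 [_ _ _ _ [/andP[]]]]]].
Qed.

Lemma raw_short c S S' : wf n N S -> wf n N S' -> raw_sizes c S -> raw_sizes c S' ->
  short n S =1 short n S' -> S =1 S'.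
Proof.
move=> w w' r r'; have E : size (S 0) = size (S' 0).
  case: c r r' => [j| | |k] /= r r'; move: (r 0) (r' 0); lia.
by rewrite /short E; case: ifP => // _; apply: (cpl_inj w w').
Qed.

Lemma out_inj c x x' S S' : wf n N x -> wf n N x' -> S =1 S' -> out c x S ->
  out c x' S' -> x =1 x'.
Proof.
move=> w w' E; case: c => [j| | |k] /= o o'.
- exact: out_plus_inj JN w w' E o o'.
- exact: (out_first_plus_inj JN w w' E o o').
- exact: (out_first_minus_inj N1 JN w w' E o o').
- exact: (out_minus_inj N1 JN w w' E o o').
Qed.

Lemma raw_back c S : wf n N S -> highest n S -> raw_sizes c S ->
  index_ok c ->
  exists x, [/\ wf n N x, added n J x, plus_box d J x & out c x S].
Proof.
move=> w h; case: c => [j| | |k] /= H c1.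
- exact: (out_plus_back J0 JN dmono d0_le w h c1 H).
- exact: (out_first_plus_back J0 JN dmono d0_le w h H).
- exact: (out_first_minus_back J0 JN dmono d0_le w h H).
- exact: (out_minus_back J0 JN dmono d0_le n0 w h c1 H).
Qed.

(** Recovers the configuration to which [short] was applied. For [Minus_in] its first column has n -
    [d 0] entries, which exceeds m unless n is even and [d 0] = m. *)
Definition lift (c : class) (U : config) : config :=
  match c with
  | Plus_in _ => U
  | Plus_first => if d 0 < n./2 then U else cpl n U
  | Minus_first => cpl n U
  | Minus_in _ => if n - d 0 <= n./2 then U else cpl n U
  end.

Lemma lift_sizes c U : wf n N U -> (if c is Plus_first then d 0 < n else true) ->
  profile c (fun i => size (U i)) -> raw_sizes c (lift c U).
Proof.
move=> w; have dn := d0_le; have sK := size_compl0 w.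
have sc i : size (cpl n U i.+1) = size (U i.+1) by [].
have sc0 : size (cpl n U 0) = size (K (U 0)) by [].
case: c => [j| | |k] /=; rewrite /plus_box /minus_box.
- by move=> _ [].
- move=> _; case: ifP => dm H // [|i]; last by rewrite sc H addn0.
  by move: (H 0); rewrite /= sc0; lia.
- move=> _ H [|i]; last by rewrite sc /cpl_len /= (H i.+1) /= !addn0.
  by move: (H 0); rewrite /= sc0 /cpl_len /=; lia.
- move=> _ [k0 H]; have k0' : (0 == k) = false by lia.
  case: ifP => dm [|i]; rewrite /cpl_len /=.
  + by move: (H 0); rewrite k0'; lia.
  + by rewrite (H i.+1).
  + by move: (H 0); rewrite k0' sc0; lia.
  + by rewrite sc (H i.+1).
Qed.

End Insertion.

(** * Classes of insertions, recovery of the argument and compatibility with the operators *)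

Section Classes.
Variables (n : nat) (rho : seq nat).
Hypothesis n0 : 0 < n.
Hypothesis rho_part : is_part rho.
Hypothesis rho_size : size rho <= n./2.

Local Notation d := (conj_part rho).
Local Notation J := (head 0 rho).+1.
Local Notation N := (head 0 rho).+2.
Local Notation tab := (tab N).
Local Notation start := (start rho).
Local Notation out := (out n rho).
Local Notation profile := (profile n rho).

Let JN : J < N. Proof. by []. Qed.
Let J0 : 0 < J. Proof. by []. Qed.
Let N0 : 0 < N. Proof. by []. Qed.
Let N1 : 1 < N. Proof. by []. Qed.
Let d0 : d 0 = size rho.
Proof. by apply: conj_part_size; case/andP: rho_part. Qed.
Let d_gt0 j : (0 < d j) = (j < head 0 rho).
Proof. by rewrite sorted_geq_count ?nth0 //; case/andP: rho_part. Qed.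
Let half_le : n./2 + n./2 <= n.
Proof. by rewrite addnn -[X in _ <= X]odd_double_half leq_addl. Qed.

Definition in_class (c : class) (T : tableau) (l : nat) (U : tableau) : Prop :=
  exists S, [/\ wf n N S, highest n S, out c (start T l) S & U = tab (short n S)].

Lemma in_class_facts c T l U : T \in SSTAI n rho -> 0 < l <= n -> in_class c T l U ->
  [/\ PAI n (row_insert T l) = U, is_AI n U, profile c (fun i => size (column U i))
    & size (row_insert T l) = d 0 + grows c].
Proof.
move=> hT ln [S [wS hS o ->]].
have [w a H _] := start_wf rho_part hT ln.
have [x1 [w1 c1 k1 s1 r1]] := out_reduces w wS hS o H.
have ws := short_wf J0 JN wS; have hs := short_highest wS hS.
have [cs _] := hs.
rewrite (row_insert_start rho_part hT ln) (Psym_knuth k1) (Psym_cword w1 c1).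
rewrite (reduces_PAI J0 JN r1) size_tab // s1; split => //.
  exact: (AI_short J0 JN).
have p1 := out_pos o.
have rs := out_sizes n0 rho_part rho_size w o H.
have := raw_profile n0 rho_part rho_size wS p1 rs.
have E i : size (column (tab (short n S)) i) = size (short n S i) by rewrite (column_tab i ws cs).
case: (c) => [j| | |k] /=; try case: ifP => _.
- by move=> [? Hi]; split => // i; rewrite E.
- by move=> Hi i; rewrite E.
- by move=> Hi i; rewrite E.
- by move=> Hi i; rewrite E.
- by move=> [? Hi]; split => // i; rewrite E.
Qed.

Lemma in_class_ex T l : T \in SSTAI n rho -> 0 < l <= n ->
  exists c, in_class c T l (PAI n (row_insert T l)).
Proof.
move=> hT ln; have [w a H _] := start_wf rho_part hT ln.
have [S [wS hS o]] := outcome N1 w (introT andP (conj J0 JN)) a.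
suff [c oc] : exists c, out c (start T l) S.
  have ic : in_class c T l (tab (short n S)) by exists S.
  by exists c; have [-> _ _ _] := in_class_facts hT ln ic.
case: o => [[j oj]|[o|[o|[k ok]]]].
- by exists (Plus_in j).
- by exists Plus_first.
- by exists Minus_first.
- by exists (Minus_in k).
Qed.

Lemma SSTAI_sst T : T \in SSTAI n rho -> is_sst n T /\ size (head [::] T) <= N.
Proof.
move=> /andP[/and3P[st _ _] /eqP sT]; split => //.
by rewrite head_shape sT; apply: leqW.
Qed.

Lemma start_inj T T' l l' : T \in SSTAI n rho -> T' \in SSTAI n rho ->
  start T l =1 start T' l' -> T = T' /\ l = l'.
Proof.
move=> hT hT' E; have [st sz] := SSTAI_sst hT; have [st' sz'] := SSTAI_sst hT'.
have cT U : U \in SSTAI n rho -> column U J = [::].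
  move=> /andP[_ /eqP sU]; apply: size0nil; rewrite size_column_conj sU.
  by apply/eqP; rewrite -leqn0 leqNgt d_gt0 -leqNgt.
split; last by have := E J; rewrite /start !upd_eq => -[].
rewrite -(tab_column st sz) -(tab_column st' sz'); apply: tab_ext => i.
case: (eqVneq i J) => [->|ne]; first by rewrite !cT.
by have := E i; rewrite /start !upd_neq.
Qed.

Lemma in_class_inj c T T' l l' U : T \in SSTAI n rho -> T' \in SSTAI n rho ->
  0 < l <= n -> 0 < l' <= n -> in_class c T l U -> in_class c T' l' U ->
  T = T' /\ l = l'.
Proof.
move=> hT hT' ln ln' [S [wS hS o ->]] [S' [wS' hS' o' E]].
have [w a H _] := start_wf rho_part hT ln.
have [w' a' H' _] := start_wf rho_part hT' ln'.
have rs := out_sizes n0 rho_part rho_size w o H.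
have rs' := out_sizes n0 rho_part rho_size w' o' H'.
have ws := short_wf J0 JN wS; have [cs _] := short_highest wS hS.
have ws' := short_wf J0 JN wS'; have [cs' _] := short_highest wS' hS'.
have Es : short n S =1 short n S'.
  by move=> i; rewrite -(column_tab i ws cs) E (column_tab i ws' cs').
have ES := raw_short n0 rho_part rho_size wS wS' rs rs' Es.
exact: (start_inj hT hT' (out_inj w w' ES o o')).
Qed.

(** In a partition no box can be added beyond the first empty column, nor removed from an empty one.
    So the index lies among the columns that the moves reach, and the result fits into [N]
    columns. *)
Lemma profile_bounds c e : profile c e -> (forall i, e i.+1 <= e i) ->
  e N = 0 /\ index_ok rho c.
Proof.
have dN : d N = 0 by apply/eqP; rewrite -leqn0 leqNgt d_gt0 -leqNgt; lia.
case: c => [j| | |k] /=.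
- move=> [j0 He] em.
  have jJ : j <= head 0 rho.
    case: j j0 He => // j _ He; rewrite -d_gt0.
    have := em j; rewrite !He eqxx (_ : j == j.+1 = false); lia.
  by split => //; [rewrite He dN (_ : N == j = false) //; lia | lia].
- by case: ifP => _ He em; split; rewrite // He dN.
- by move=> He em; split => //; have := He N; rewrite dN /= addn0.
- move=> [k0 He] em; have kN : k < head 0 rho by rewrite -d_gt0 He eqxx addn1.
  by split => //; [have := He N; rewrite dN; lia | lia].
Qed.

Lemma lift_short c V : wf n N V -> size (V 0) <= n./2 ->
  profile c (fun i => size (V i)) -> short n (lift n rho c V) =1 V.
Proof.
move=> w sV p; have sK := size_compl0 w; have dn : d 0 <= n./2 by rewrite d0.
have sc0 : size (cpl n V 0) = size (compl_column n (V 0)) by [].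
have key : size (cpl n V 0) > n./2 -> short n (cpl n V) =1 V.
  by rewrite ltnNge /short => /negbTE ->; apply: cplK w.
have key' : short n V =1 V by rewrite /short sV.
case: c p => [j| | |k] //=.
- by case: ifP => // dm He; apply: key; move: (He 0); rewrite sc0 /=; lia.
- by move=> He; apply: key; move: (He 0); rewrite sc0 /=; lia.
- move=> [k0 He]; case: ifP => // dm; apply: key; move: (He 0); rewrite sc0.
  by rewrite (_ : 0 == k = false); lia.
Qed.

(** [lift] undoes the final choice between a column and its complement; then the moves of the class
    are run backwards to a configuration with a single letter in column [J]. *)
Lemma in_class_surj c U : is_AI n U -> profile c (fun i => size (column U i)) ->
  exists T l, [/\ T \in SSTAI n rho, 0 < l <= n & in_class c T l U].
Proof.
move=> AU p; have st : is_sst n U by case/and3P: AU.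
have D := sst_decreasing st.
have em i : size (column U i.+1) <= size (column U i).
  by rewrite !size_column_conj; apply: conj_part_mono.
have [eN b1] := profile_bounds p em.
have hN : size (head [::] U) <= N.
  by rewrite leqNgt -(nth0 [::] U) -size_column // eN.
have w := wf_column st hN; have [sz h] := (is_AI_highest st hN).1 AU.
have wl : wf n N (lift n rho c (column U)).
  by case: (c) => [j| | |k] //=; try case: ifP => _ //; apply: wf_cpl.
have hl : highest n (lift n rho c (column U)).
  by case: (c) => [j| | |k] //=; try case: ifP => _ //; apply: (highest_cpl w).
have rl : raw_sizes n rho c (lift n rho c (column U)).
  apply: (lift_sizes n0 rho_part rho_size w) => //.
  by case: (c) => //; rewrite d0; lia.
have [x [wx ax H o]] := raw_back n0 rho_part rho_size wl hl rl b1.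
have [T [l [hT ln E]]] := start_inv rho_part rho_size wx ax H.
exists T, l; split => //; exists (lift n rho c (column U)); split => //.
  by rewrite -(boolp.funext E).
rewrite -[LHS](tab_column st hN); apply: tab_ext => i.
by rewrite (lift_short w sz p).
Qed.

(** Only [Plus_first] and [Minus_first] can share a profile, namely for n even and [d 0] = m, with m
    - 1 entries in the first column. Each alternative of the hypothesis excludes this; if [d 1] =
    [d 0], the first column would become shorter than the second. *)
Lemma profile_inj c c' e : profile c e -> profile c' e ->
  [\/ d 0 < n./2, odd n, d 1 = d 0 /\ e 1 <= e 0 \/ e 0 = n./2 | grows c = grows c'] ->
  c = c'.
Proof.
have dn : d 0 <= n./2 by rewrite d0.
have key j k : (forall i, e i = d i + (i == j)) ->
    (forall i, d i = e i + (i == k)) -> False.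
  by move=> H1 H2; move: (H1 j) (H2 j); rewrite eqxx; lia.
have first_plus j : 0 < j -> profile Plus_first e ->
    (forall i, e i = d i + (i == j)) -> False.
  case: j => // j _ /=; case: ifP => _ H1 H2.
    by move: (H1 j.+1) (H2 j.+1); rewrite eqxx /=; lia.
  by move: (H1 j.+1) (H2 j.+1); rewrite eqxx /=; lia.
have first_minus k : 0 < k -> profile Plus_first e ->
    (forall i, d i = e i + (i == k)) -> False.
  case: k => // k _ /=; case: ifP => _ H1 H2.
    by move: (H1 k.+1) (H2 k.+1); rewrite eqxx /=; lia.
  by move: (H1 k.+1) (H2 k.+1); rewrite eqxx /=; lia.
have first_first : [\/ d 0 < n./2, odd n | d 1 = d 0 /\ e 1 <= e 0 \/ e 0 = n./2] ->
    profile Plus_first e -> (forall i, d i = e i + (i == 0)) -> False.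
  move=> H /=; case: ifP => dm H1 H2; first exact: (key 0 0).
  have dm' : d 0 = n./2 by apply/eqP; rewrite eqn_leq dn leqNgt dm.
  case: H => [|on|[[e1 e2]|e1]]; first by rewrite dm.
    have hodd : n = (n./2 + n./2).+1 by rewrite -[LHS]odd_double_half on addnn.
    by move: (H1 0) (H2 0); rewrite /= {2}hodd; lia.
    by move: (H1 1) (H2 0) (H1 0); rewrite /=; lia.
  by move: (H2 0); rewrite /= e1; lia.
have key2 (f g : nat -> nat) j k : (forall i, f i = g i + (i == j)) ->
    (forall i, f i = g i + (i == k)) -> j = k.
  move=> H1 H2; move: (H1 j) (H2 j); rewrite eqxx => -> /addnI.
  by case: eqP.
case: c c' => [j| | |k] [j'| | |k'] p p' H //.
- by have [_ h] := p; have [_ h'] := p'; rewrite (key2 _ _ _ _ h h').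
- by case: p => j0 h; case: (first_plus _ j0 p' h).
- by case: p => _ h; case: (key _ _ h p').
- by case: p => _ h; case: p' => _ h'; case: (key _ _ h h').
- by case: p' => j0 h; case: (first_plus _ j0 p h).
- by case: (first_first _ p p'); case: H => //; [constructor 1|constructor 2|constructor 3].
- by case: p' => k0 h; case: (first_minus _ k0 p h).
- by case: p' => _ h; case: (key _ _ h p).
- by case: (first_first _ p' p); case: H => //; [constructor 1|constructor 2|constructor 3].
- by case: p' => k0 h; have e0 := key2 _ _ _ _ p h; rewrite -e0 in k0.
- by case: p => _ h; case: p' => _ h'; case: (key _ _ h' h).
- by case: p => k0 h; case: (first_minus _ k0 p' h).
- by case: p => k0 h; have e0 := key2 _ _ _ _ p' h; rewrite -e0 in k0.
- by have [_ h] := p; have [_ h'] := p'; rewrite (key2 _ _ _ _ h h').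
Qed.

Lemma CR_box l : CR [:: [:: l]] = [:: l].
Proof. by []. Qed.

Lemma refill_box l l' : refill [:: [:: l]] [:: l'] = [:: [:: l']].
Proof. by []. Qed.

Lemma CR_Psym T : T \in SSTAI n rho -> Psym (CR T) = T.
Proof.
move=> hT; have [st sz] := SSTAI_sst hT.
by rewrite (CR_cword st sz) (Psym_cword (wf_column st sz) (chain_column st)) (tab_column st sz).
Qed.

Lemma Psym_rcons w l : Psym (w ++ [:: l]) = row_insert (Psym w) l.
Proof. by rewrite /Psym foldl_cat. Qed.

Lemma Fw_box i l v : Fw i [:: l] = Some v -> exists l', v = [:: l'].
Proof. by rewrite Fw1; case: ifP => // _ [<-]; exists i.+1. Qed.

Lemma Ew_box i l v : Ew i [:: l] = Some v -> exists l', v = [:: l'].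
Proof. by rewrite Ew1; case: ifP => // _ [<-]; exists i. Qed.

(** The rule defining the tensor product is the concatenation rule [Bw_cat] with a single letter as
    right factor, and inserting [l] is appending it to the word. *)
Lemma insert_box_tensor i T l : 0 < i < n -> T \in SSTAI n rho -> 0 < l <= n ->
  omap insert_box (B_tensor i (T, [:: [:: l]])) = omap Psym (Bw i (CR T ++ [:: l])).
Proof.
move=> Hi hT ln; have [st sz] := SSTAI_sst hT.
rewrite Bw_cat /B_tensor /= /phi CR_box degT_degw; case: ifP => _.
  have E : BT i T = omap Psym (Bw i (CR T)).
    rewrite -[in BT i T](tab_column st sz) (BT_tab N0 Hi (wf_column st sz) (chain_column st)).
    by rewrite (CR_cword st sz).
  rewrite E; case: (Bw i (CR T)) => //= v; congr Some.
  by rewrite /insert_box /= Psym_rcons.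
case: ifP => _; rewrite /Ft /Et CR_box.
  case EF: (Fw i [:: l]) => [v|] //=; have [l' ->] := Fw_box EF.
  by rewrite refill_box Psym_rcons CR_Psym.
case EF: (Ew i [:: l]) => [v|] //=; have [l' ->] := Ew_box EF.
by rewrite refill_box Psym_rcons CR_Psym.
Qed.

(** The two equalities of sizes say that an operator changes neither the number of rows after
    insertion nor that of the result; hence it preserves the branch, and with it the sign, in
    [PAI_insert_signed]. *)
Lemma PAI_insert_crystal i T l (b := (T, [:: [:: l]])) :
  0 < i < n -> T \in SSTAI n rho -> 0 < l <= n ->
  degT i (PAI_insert n b) = deg_tensor i b /\
  match B_tensor i b with
  | Some b' => [/\ BT i (PAI_insert n b) = Some (PAI_insert n b'),
                  size (insert_box b') = size (insert_box b)
                & size (PAI_insert n b') = size (PAI_insert n b)]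
  | None => BT i (PAI_insert n b) = None
  end.
Proof.
move=> Hi hT ln; have [c ic] := in_class_ex hT ln.
have [S [wS hS o _]] := ic.
have [w a H ew] := start_wf rho_part hT ln.
have [x1 [w1 c1 k1 s1 r1]] := out_reduces w wS hS o H.
have [wV cV AV] := reduces_wf r1; set V := short n S in r1 wV cV AV.
have E1 : insert_box b = tab x1.
  by rewrite /insert_box /= (row_insert_start rho_part hT ln) (Psym_knuth k1) (Psym_cword w1 c1).
have E2 : PAI_insert n b = tab V by rewrite /PAI_insert E1 (reduces_PAI J0 JN r1).
rewrite E2; split.
  rewrite degT_degw (CR_tab N0 wV cV) -(degw_reduces J0 JN Hi r1) -(degw_knuth i k1) ew.
  by rewrite degw_cat.
have EB := insert_box_tensor Hi hT ln; rewrite -/b -ew in EB.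
rewrite (BT_tab N0 Hi wV cV); have := Bw_knuth i k1.
case EW : (Bw i (cword N (start T l))) EB => [v|] /=; last first.
  case: (B_tensor i b) => // _; case E: (Bw i (cword N x1)) => [//|] _.
  by rewrite (Bw_reduces_None J0 JN Hi r1 E).
case: (B_tensor i b) => [b'|] //= [Eb'].
case E: (Bw i (cword N x1)) => [v1|] //= kv.
have [x1' [w1' c1' ss1 ev1]] := Bw_cword N0 Hi w1 c1 E; rewrite ev1 in E kv.
have [V' [wV' cV' sV EV [PV AV']]] := Bw_reduces J0 JN Hi r1 w1' c1' ss1 E.
have Eb : insert_box b' = tab x1' by rewrite Eb' (Psym_knuth kv) (Psym_cword w1' c1').
have Eb2 : PAI_insert n b' = tab V' by rewrite /PAI_insert Eb.
by rewrite EV /= Eb E1 Eb2 (Psym_cword wV' cV') !size_tab ?ss1 ?sV.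
Qed.

End Classes.

Lemma SST_boxP n S : reflect (exists2 l, 0 < l <= n & S = [:: [:: l]]) (S \in SST n [:: 1]).
Proof.
apply: (iffP idP) => [|[l ln ->]]; last first.
  by apply/andP; split => //; rewrite /is_sst /= ln.
move=> /andP[/and3P[_ R _] /eqP]; case: S R => [|[|l [|? ?]] [|? ?]] //= R _.
by exists l => //; move: R; rewrite !andbT.
Qed.

(** * The isomorphisms, case by case *)

Section Isomorphisms.
Variables (n : nat) (rho : seq nat).
Hypothesis n0 : 0 < n.
Hypothesis rho_part : is_part rho.
Hypothesis rho_size : size rho <= n./2.
Local Notation d := (conj_part rho).
Local Notation e U := (fun i => size (column U i)).
Local Notation profile := (profile n rho).

Lemma in_tensor b : b \in elements (SSTAI_tensor_box n rho) ->
  exists T l, [/\ b = (T, [:: [:: l]]), T \in SSTAI n rho & 0 < l <= n].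
Proof.
case: b => T S /andP[/= hT /SST_boxP[l ln ->]].
by exists T, l.
Qed.

Lemma tensor_in T l : T \in SSTAI n rho -> 0 < l <= n ->
  (T, [:: [:: l]]) \in elements (SSTAI_tensor_box n rho).
Proof. by move=> hT ln; apply/andP; split => //; apply/SST_boxP; exists l. Qed.

Lemma AI_shape U : is_AI n U ->
  [/\ is_part (shape U), size (shape U) = e U 0, size (shape U) <= n./2
    & e U 1 <= e U 0].
Proof.
case/and3P => /and3P[p _ _] sz _.
have s0 : size (shape U) = size (column U 0).
  by rewrite size_column_conj conj_part_size //; case/andP: p.
by rewrite s0; split => //; rewrite !size_column_conj; apply: conj_part_mono.
Qed.

(** The first hypothesis makes the class recoverable from the shape, which gives injectivity. The
    other two say that, among AI-tableaux, [Sh] consists of exactly the shapes realised by the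
    classes. *)
Lemma PAI_insert_iso (Sh : {pred seq nat}) :
  [\/ d 0 < n./2, odd n | d 1 = d 0] ->
  (forall c U, is_AI n U -> profile c (e U) -> shape U \in Sh) ->
  (forall U, is_AI n U -> shape U \in Sh -> exists c, profile c (e U)) ->
  @is_AI_iso n (SSTAI_tensor_box n rho) (bigsqcup_SSTAI n Sh) (PAI_insert n).
Proof.
move=> Hd H1 H2; split.
- move=> b /in_tensor[T [l [-> hT ln]]].
  have [c ic] := in_class_ex n0 rho_part rho_size hT ln.
  have [_ AU p _] := in_class_facts n0 rho_part rho_size hT ln ic.
  by apply/andP; split; [apply: H1 p | apply/andP; split].
- move=> b b' /in_tensor[T [l [-> hT ln]]] /in_tensor[T' [l' [-> hT' ln']]].
  have [c ic] := in_class_ex n0 rho_part rho_size hT ln.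
  have [c' ic'] := in_class_ex n0 rho_part rho_size hT' ln'.
  rewrite /PAI_insert /insert_box /= => E; rewrite -E in ic'.
  have [_ AU p _] := in_class_facts n0 rho_part rho_size hT ln ic.
  have [_ _ p' _] := in_class_facts n0 rho_part rho_size hT' ln' ic'.
  have [_ _ _ em] := AI_shape AU.
  have ecc : c = c'.
    apply: (profile_inj n0 rho_part rho_size p p').
    by case: Hd => H; [constructor 1 | constructor 2 | constructor 3; left].
  rewrite -ecc in ic'.
  by have [-> ->] := in_class_inj n0 rho_part rho_size hT hT' ln ln' ic ic'.
- move=> U /andP[hU /andP[AU _]]; have [c p] := H2 U AU hU.
  have [T [l [hT ln ic]]] := in_class_surj n0 rho_part rho_size AU p.
  exists (T, [:: [:: l]]); first exact: tensor_in.
  by have [E _ _ _] := in_class_facts n0 rho_part rho_size hT ln ic; exact: E.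
- move=> i b Hi /in_tensor[T [l [-> hT ln]]] /=.
  have [_] := PAI_insert_crystal n0 rho_part rho_size Hi hT ln.
  by case: (B_tensor i _) => [b'|] //= [].
- move=> i b Hi /in_tensor[T [l [-> hT ln]]] /=.
  by have [] := PAI_insert_crystal n0 rho_part rho_size Hi hT ln.
Qed.

Lemma in_ParP k U : is_part (shape U) -> size (shape U) <= k -> shape U \in Par k.
Proof. by move=> p sz; apply/andP. Qed.

Lemma neighbours_profile c U : is_AI n U -> profile c (e U) ->
  (c = Plus_first -> d 0 < n./2) -> shape U \in neighbours rho.
Proof.
move=> AU p H; have [pU _ _ _] := AI_shape AU.
apply/(neighbours_conj rho_part pU).
case: c p H => [j| | |k] /= p H.
- by case: p => _ p; left; exists j => i; rewrite -size_column_conj p.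
- by move: p; rewrite (H erefl) => p; left; exists 0 => i; rewrite -size_column_conj p.
- by right; exists 0 => i; rewrite -size_column_conj p.
- by case: p => _ p; right; exists k => i; rewrite -size_column_conj p.
Qed.

Lemma profile_neighbours U : is_AI n U -> shape U \in neighbours rho ->
  exists2 c, profile c (e U) & c = Plus_first -> d 0 < n./2.
Proof.
move=> AU; have [pU sU szU _] := AI_shape AU.
move=> /(neighbours_conj rho_part pU)[[j Hj]|[k Hk]].
  case: j Hj => [|j] Hj.
    have dm : d 0 < n./2 by move: szU; rewrite sU size_column_conj Hj addn1.
    by exists Plus_first => //=; rewrite dm => i; rewrite size_column_conj Hj.
  by exists (Plus_in j.+1) => //; split => // i; rewrite size_column_conj Hj.
case: k Hk => [|k] Hk.
  by exists Minus_first => // i; rewrite size_column_conj Hk.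
by exists (Minus_in k.+1) => //; split => // i; rewrite size_column_conj Hk.
Qed.

Lemma iso_neighbours : d 0 < n./2 \/ d 1 = d 0 /\ ~~ odd n /\ 0 < n./2 ->
  @is_AI_iso n (SSTAI_tensor_box n rho)
    (bigsqcup_SSTAI n [pred sigma | (sigma \in Par n./2) && (sigma \in neighbours rho)])
    (PAI_insert n).
Proof.
move=> Hd; apply: PAI_insert_iso.
- by case: Hd => [H|[H _]]; [constructor 1 | constructor 3].
- move=> c U AU p; have [pU sU szU em] := AI_shape AU.
  apply/andP; split; first exact: in_ParP.
  apply: (neighbours_profile AU p) => ec; case: Hd => // -[d1 [on m0]].
  move: p; rewrite ec /=; case: ifP => // dm H; exfalso.
  have en : n = n./2 + n./2 by rewrite -[LHS]odd_double_half (negbTE on) addnn.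
  (* Growing and complementing would leave m - 1 entries in the first column, below the m entries of
     the second. *)
  have := H 0; have := H 1; move: em; rewrite /= d1; move: dm; lia.
- by move=> U AU /andP[_ /(profile_neighbours AU)[c p _]]; exists c.
Qed.

Lemma iso_odd : odd n -> d 0 = n./2 ->
  @is_AI_iso n (SSTAI_tensor_box n rho)
    (bigsqcup_SSTAI n [pred sigma | (sigma \in Par n./2) &&
                         ((rho == sigma) || (sigma \in neighbours rho))])
    (PAI_insert n).
Proof.
move=> on d0; have en : n = (n./2 + n./2).+1.
  by rewrite -[LHS]odd_double_half on addnn.
have e0 : n - (n./2).+1 = n./2 by rewrite {1}en; lia.
apply: PAI_insert_iso; first by constructor 2.
- move=> c U AU p; have [pU sU szU em] := AI_shape AU.
  apply/andP; split; first exact: in_ParP.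
  case: c p => [j| | |k] p; last 2 first.
  + by apply/orP; right; apply: (neighbours_profile AU p).
  + by apply/orP; right; apply: (neighbours_profile AU p).
  + by apply/orP; right; apply: (neighbours_profile AU p).
  apply/orP; left; apply/eqP; have /andP[q1 q2] := pU.
  apply: (eq_part rho_part) => // i; rewrite -size_column_conj.
  by move: p; rewrite /= d0 ltnn => ->; case: eqP => // ->; rewrite e0.
- move=> U AU /andP[_ /orP[/eqP eU|/(profile_neighbours AU)[c p _]]]; last by exists c.
  exists Plus_first; rewrite /= d0 ltnn => i; rewrite size_column_conj -eU.
  by case: eqP => // ->; rewrite e0.
Qed.

Definition keeps_first (c : class) : bool :=
  match c with Plus_in _ | Minus_in _ => true | _ => false end.

(** [Plus_first] and [Minus_first] both end with m - 1 entries in the first column and the other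
    columns unchanged. As [d 1] < m, this is rho without its last row, so the two classes supply the
    two copies; the length of the first column before [PAI] separates them. All other classes keep m
    entries in the first column. *)
Lemma iso_signed : ~~ odd n -> d 0 = n./2 -> d 1 < n./2 ->
  @is_AI_iso n (SSTAI_tensor_box n rho)
    (sqcup
      (bigsqcup_SSTAI n
         [pred sigma | [&& sigma \in Par n./2, sigma \notin Par (n./2).-1
                         & sigma \in neighbours rho]])
      (SSTAI_times_signs n (take (n./2).-1 rho)))
    (PAI_insert_signed n).
Proof.
move=> on d0 d1; have en : n = n./2 + n./2.
  by rewrite -[LHS]odd_double_half (negbTE on) addnn.
have m0 : 0 < n./2 by lia.
have e0 : n - (n./2).+1 = (n./2).-1 by rewrite {1}en; lia.
have /andP[rs r0] := rho_part.
pose rho' := take (n./2).-1 rho.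
have ps : sorted geq rho' by apply: take_sorted.
have p0 : 0 \notin rho' by apply: contra r0; apply: mem_take.
have cr i : conj_part rho' i = if i == 0 then (n./2).-1 else d i.
  rewrite conj_part_take //; case: eqP => [->|/eqP i0]; first by rewrite d0; lia.
  have : d i <= d 1 by apply: conj_part_mono; rewrite lt0n.
  by lia.
have shapeP U : is_AI n U -> (shape U == rho') <->
    (forall i, e U i = if i == 0 then (n./2).-1 else d i).
  move=> AU; have [pU _ _ _] := AI_shape AU; split.
    by move=> /eqP eU i; rewrite size_column_conj eU.
  by move=> H; apply/eqP/(eq_part pU) => // i; rewrite -size_column_conj H cr.
have first_plus U : profile Plus_first (e U) <->
    (forall i, e U i = if i == 0 then (n./2).-1 else d i).
  by rewrite /= d0 ltnn e0.
have first_minus U : profile Minus_first (e U) <->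
    (forall i, e U i = if i == 0 then (n./2).-1 else d i).
  split=> H i; have := H i; case: eqP => [->|_] /=; rewrite ?d0; lia.
(* [size U = n./2] selects the classes whose first column keeps its length. *)
have szP c U : is_AI n U -> profile c (e U) ->
    (size U == n./2) = keeps_first c.
  move=> AU p; have [_ sU _ _] := AI_shape AU; rewrite -[size U](size_map size) sU.
  case: c p => [j [j0 p]|/first_plus p|/first_minus p|k [k0 p]].
  - by rewrite p d0 (_ : 0 == j = false) ?addn0 ?eqxx //; lia.
  - by rewrite p /=; lia.
  - by rewrite p /=; lia.
  - by move: (p 0); rewrite (_ : 0 == k = false) ?addn0 ?d0 => [->|]; rewrite ?eqxx //; lia.
have fE T l c (b := (T, [:: [:: l]])) : T \in SSTAI n rho -> 0 < l <= n ->
    in_class n rho c T l (PAI_insert n b) ->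
    PAI_insert_signed n b = match c with
      | Plus_in _ | Minus_in _ => inl (PAI_insert n b)
      | Plus_first => inr (PAI_insert n b, Plus)
      | Minus_first => inr (PAI_insert n b, Minus)
      end.
  move=> hT ln ic; have [_ AU p sz] := in_class_facts n0 rho_part rho_size hT ln ic.
  rewrite /PAI_insert_signed [size (shape (PAI_insert n b))](size_map size).
  rewrite (szP c) // [size (shape (insert_box b))](size_map size) sz d0.
  by case: (c) => //=; rewrite ?addn0 ?ltnn // addn1 ltnSn.
split.
- move=> b /in_tensor[T [l [-> hT ln]]].
  have [c ic] := in_class_ex n0 rho_part rho_size hT ln; rewrite (fE T l c) //.
  have [_ AU p _] := in_class_facts n0 rho_part rho_size hT ln ic.
  have [pU sU szU em] := AI_shape AU.
  have hs := szP c _ AU p.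
  rewrite -[size _](size_map size) in hs.
  have inl_in : size (shape (PAI_insert n (T, [:: [:: l]]))) == n./2 ->
      (c = Plus_first -> d 0 < n./2) ->
      inl (PAI_insert n (T, [:: [:: l]])) \in elements (sqcup
      (bigsqcup_SSTAI n
         [pred sigma | [&& sigma \in Par n./2, sigma \notin Par (n./2).-1
                         & sigma \in neighbours rho]])
      (SSTAI_times_signs n (take (n./2).-1 rho))).
    move=> /eqP hsz hc; apply/andP; split; last by apply/andP.
    apply/and3P; split; [exact: in_ParP | | exact: (neighbours_profile AU p)].
    by apply/negP => /andP[_]; rewrite hsz -ltnS prednK // ltnn.
  case: c p ic hs inl_in => [j| | |k] p ic hs inl_in.
  + exact: inl_in.
  + by apply/andP; split => //; apply/(shapeP _ AU)/first_plus.
  + by apply/andP; split => //; apply/(shapeP _ AU)/first_minus.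
  + exact: inl_in.
- move=> b b' /in_tensor[T [l [-> hT ln]]] /in_tensor[T' [l' [-> hT' ln']]].
  have [c ic] := in_class_ex n0 rho_part rho_size hT ln.
  have [c' ic'] := in_class_ex n0 rho_part rho_size hT' ln'.
  rewrite (fE T l c) // (fE T' l' c') // => E.
  have [EU Eg] : PAI_insert n (T, [:: [:: l]]) = PAI_insert n (T', [:: [:: l']]) /\
      (grows c = grows c' \/ keeps_first c).
    by case: (c) (c') E => [j| | |k] [j'| | |k'] // [->]; split => //; auto.
  rewrite /PAI_insert /insert_box /= in EU; rewrite -EU in ic'.
  have [_ AU p _] := in_class_facts n0 rho_part rho_size hT ln ic.
  have [_ _ p' _] := in_class_facts n0 rho_part rho_size hT' ln' ic'.
  have [_ sU _ _] := AI_shape AU.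
  have ecc : c = c'.
    apply: (profile_inj n0 rho_part rho_size p p').
    case: Eg => [Eg|Eg]; first by constructor 4.
    (* A value without sign has m entries in the first column, whereas the two coinciding classes
       give m - 1. *)
    constructor 3; right; move: (szP c _ AU p); rewrite Eg -[size _](size_map size) sU.
    by move=> /eqP.
  rewrite -ecc in ic'.
  by have [-> ->] := in_class_inj n0 rho_part rho_size hT hT' ln ln' ic ic'.
- have back c U : is_AI n U -> profile c (e U) -> exists T l,
    [/\ T \in SSTAI n rho, 0 < l <= n, in_class n rho c T l U
      & PAI_insert n (T, [:: [:: l]]) = U].
    move=> AU p; have [T [l [hT ln ic]]] := in_class_surj n0 rho_part rho_size AU p.
    exists T, l; split => //.
    by have [E _ _ _] := in_class_facts n0 rho_part rho_size hT ln ic; exact: E.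
  move=> [U /andP[/and3P[h1 h2 h3] /andP[AU _]]|[U s] /andP[/= AU hs]].
    have [c p cP] := profile_neighbours AU h3.
    have [T [l [hT ln ic EU]]] := back c U AU p.
    exists (T, [:: [:: l]]); first exact: tensor_in.
    have [pU sU szU _] := AI_shape AU.
    have hsz : size U == n./2.
      rewrite eqn_leq -[size U](size_map size) szU /=.
      rewrite leqNgt; apply: contra h2 => H; apply: in_ParP => //.
      by rewrite -ltnS prednK.
    rewrite (fE T l c) ?EU //; move: (szP c _ AU p); rewrite hsz.
    by case: (c).
  have pf := (shapeP _ AU).1 hs.
  case: s.
    have [T [l [hT ln ic EU]]] := back Plus_first U AU ((first_plus U).2 pf).
    exists (T, [:: [:: l]]); first exact: tensor_in.
    by rewrite (fE T l Plus_first) ?EU.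
  have [T [l [hT ln ic EU]]] := back Minus_first U AU ((first_minus U).2 pf).
  exists (T, [:: [:: l]]); first exact: tensor_in.
  by rewrite (fE T l Minus_first) ?EU.
- move=> i b Hi /in_tensor[T [l [-> hT ln]]] /=.
  have [_] := PAI_insert_crystal n0 rho_part rho_size Hi hT ln.
  rewrite /PAI_insert_signed !(size_map size).
  case: (B_tensor i _) => [b'|] /=.
    move=> [E1 E2 E3]; rewrite !(size_map size) E2 E3.
    by case: ifP => _ /=; [rewrite E1 | case: ifP => _ /=; rewrite E1].
  by move=> E1; case: ifP => _ /=; [rewrite E1 | case: ifP => _ /=; rewrite E1].
- move=> i b Hi /in_tensor[T [l [-> hT ln]]] /=.
  have [Ed _] := PAI_insert_crystal n0 rho_part rho_size Hi hT ln.
  by rewrite /PAI_insert_signed; case: ifP => _ //; case: ifP.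
Qed.

End Isomorphisms.

Theorem proposition4p1p4 (n m : nat) (rho : seq nat) :
  3 <= n -> m = n./2 -> rho \in Par m ->
  [/\ ~~ odd n -> part rho m <> 1 ->
        @is_AI_iso n (SSTAI_tensor_box n rho)
          (bigsqcup_SSTAI n
             [pred sigma | (sigma \in Par m) && (sigma \in neighbours rho)])
          (PAI_insert n),
      ~~ odd n -> part rho m = 1 ->
        @is_AI_iso n (SSTAI_tensor_box n rho)
          (sqcup
             (bigsqcup_SSTAI n
                [pred sigma | [&& sigma \in Par m, sigma \notin Par m.-1
                                & sigma \in neighbours rho]])
             (SSTAI_times_signs n (take m.-1 rho)))
          (PAI_insert_signed n),
      odd n -> part rho m = 0 ->
        @is_AI_iso n (SSTAI_tensor_box n rho)
          (bigsqcup_SSTAI n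
             [pred sigma | (sigma \in Par m) && (sigma \in neighbours rho)])
          (PAI_insert n)
    & odd n -> part rho m <> 0 ->
        @is_AI_iso n (SSTAI_tensor_box n rho)
          (bigsqcup_SSTAI n
             [pred sigma | (sigma \in Par m) &&
                           ((rho == sigma) || (sigma \in neighbours rho))])
          (PAI_insert n)].
Proof.
move=> n3 -> /andP[rho_part rho_size]; have n0 : 0 < n by lia.
have /andP[rs r0] := rho_part.
have m0 : 0 < n./2 by rewrite half_gt0; lia.
have d0 : conj_part rho 0 = size rho by apply: conj_part_size.
(* Column [j] is full exactly if rho_m > j. So comparing rho_m with 0 and 1 tells whether the first
   and the second column have m entries, which is what the four cases depend on. *)
have d_part j : ((n./2).-1 < conj_part rho j) = (j < part rho n./2).
  by rewrite sorted_geq_count.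
have d_full : part rho n./2 <> 0 -> conj_part rho 0 = n./2.
  move=> H; apply/eqP; rewrite eqn_leq d0 rho_size /= -d0 -(prednK m0) d_part.
  by rewrite lt0n; apply/eqP.
split => on Hp.
- apply: iso_neighbours => //; case: (ltnP (conj_part rho 0) n./2) => H; first by left.
  right; split => //; apply/eqP; rewrite eqn_leq conj_part_mono //=.
  apply: leq_trans (_ : n./2 <= _); first by rewrite d0.
  rewrite -(prednK m0) d_part.
  have : 0 < part rho n./2 by rewrite -d_part (prednK m0).
  by case: (part rho n./2) Hp => [|[|k]].
- apply: iso_signed => //; first by apply: d_full; rewrite Hp.
  by rewrite ltnNge -(prednK m0) d_part Hp.
- apply: iso_neighbours => //; left.
  by rewrite ltnNge -{1}(prednK m0) d_part Hp.
- by apply: iso_odd => //; apply: d_full.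
Qed.
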